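(* Let $\gamma<1$ and $c>0$ be real numbers. Let $(p_i)_{i\in\mathbb{N}}$, $(q_i)_{i\in\mathbb{N}}$, $(d_i)_{i\in\mathbb{N}}$ be strictly increasing sequences of prime numbers with $q_i<p_{i+1}$ and $p_i<q_i<2p_i$ for all $i\in\mathbb{N}$. Let $f(x)$ be one of the functions $\log(x)$, the constant $c$, or $1/\log(x)$. If $\gamma\ge0$, assume that \[\exp\big(f(d_i)d_i^{1-\gamma}\big)\le p_i\le 2\exp\big(f(d_i)d_i^{1-\gamma}\big)\quad\text{for all } i\in\mathbb{N}.\] If $\gamma<0$, assume that \[\exp\big(f(d_i)(d_1\cdots d_{i-1})^{-\gamma}d_i^{1-\gamma}\big)\le p_i\le 2\exp\big(f(d_i)(d_1\cdots d_{i-1})^{-\gamma}d_i^{1-\gamma}\big)\quad\text{for all } i\in\mathbb{N},\] and that $\lim_{i\to\infty}\frac{i\log(d_i)}{d_i^{-\gamma}}=0$. Let $L:=\mathbb{Q}\big((p_i/q_i)^{1/d_i}\mid i\in\mathbb{N}\big)$. Then: (1) if $f(x)=\log(x)$, then $I_N(L)=I_B(L)=[\gamma,\infty)$; (2) if $f(x)=c$, then $I_N(L)=(\gamma,\infty)\subsetneq[\gamma,\infty)=I_B(L)$ and $\mathrm{Nor}_\gamma(L)=c$; (3) if $f(x)=1/\log(x)$, then $I_N(L)=I_B(L)=(\gamma,\infty)$.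
   Context: $\mathbb{N}$ denotes the positive integers; $(p_i/q_i)^{1/d_i}$ denotes the positive real $d_i$-th root of $p_i/q_i$, and for $i=1$ the empty product $d_1\cdots d_0$ equals $1$. $h$ is the absolute logarithmic Weil height on $\overline{\mathbb{Q}}$, $\deg(a):=[\mathbb{Q}(a):\mathbb{Q}]$, $h_\gamma(a):=\deg(a)^\gamma h(a)$. For $A\subset\overline{\mathbb{Q}}$ and $C>0$, $N_\gamma(A,C):=\#\{a\in A: h_\gamma(a)<C\}$, $\mu_A$ is the set of roots of unity in $A$, and $\mathrm{Nor}_\gamma(A):=\inf\{C>0: N_\gamma(A,C)=\infty\}$ (with $\inf\emptyset=\infty$). $A$ has $\gamma$-(N) if $N_\gamma(A,C)<\infty$ for all $C>0$; $A$ has $\gamma$-(B) if $N_\gamma(A\setminus\mu_A,C)<\infty$ for some $C>0$. $I_N(A):=\{\gamma\in\mathbb{R}: A\text{ has }\gamma\text{-(N)}\}$, $I_B(A):=\{\gamma\in\mathbb{R}: A\text{ has }\gamma\text{-(B)}\}$. *)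

(* Defs.v *)
From HB Require Import structures.
From mathcomp Require Import all_boot all_order all_algebra.
From mathcomp Require Import all_classical all_reals all_analysis.
From mathcomp Require Import complex.

Set Implicit Arguments.
Unset Strict Implicit.
Unset Printing Implicit Defensive.

Import Order.TTheory GRing.Theory Num.Theory.
Import numFieldNormedType.Exports.

Local Open Scope classical_set_scope.
Local Open Scope complex_scope.
Local Open Scope ring_scope.

(* The algebraic closure of Q is taken inside R[i]. The functions [algdeg],
   [weil_height] and [wheight] have junk values at transcendental numbers. *)
Section AlgebraicNumbers.
Variable R : realType.
Implicit Types (a x z : R[i]) (A S K : set R[i]).

(* Q(S). A subset of R[i] containing 1 and stable under subtraction and
   division (with x / 0 = 0) is exactly a subfield. *)
Definition adjoinQ S : set R[i] :=
  [set x | forall F : {pred R[i]},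
     divring_closed F -> (forall s, S s -> s \in F) -> x \in F].

Definition is_Qbasis (n : nat) (b : 'I_n -> R[i]) K : Prop :=
  (forall x, K x <-> exists c : 'I_n -> rat, x = \sum_(i < n) ratr (c i) * b i)
  /\ (forall c : 'I_n -> rat,
        \sum_(i < n) ratr (c i) * b i = 0 -> forall i, c i = 0).

(* [K : Q], with value 0 when the extension is infinite. *)
Definition Qdim K : nat :=
  xget 0%N [set n | exists b : 'I_n -> R[i], is_Qbasis b K].

Definition algdeg a : nat := Qdim (adjoinQ [set a]).

(* [zcontents] carries the sign of the leading coefficient, so
   [zcontents P = 1] says that P is primitive with positive leading term. *)
Definition is_minpolyZ a (P : {poly int}) : Prop :=
  [/\ zcontents P = 1,
      irreducible_poly (map_poly (intr : int -> rat) P)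
    & root (map_poly (intr : int -> R[i]) P) a].

Definition minpolyZ a : {poly int} := xget 0 [set P | is_minpolyZ a P].

Definition mahler_measure (P : {poly R[i]}) : R :=
  Normc.normc (lead_coef P) *
  \prod_(z <- sval (closed_field_poly_normal P)) Num.max 1 (Normc.normc z).

(* h(a) = log M(P) / deg a, with P the minimal polynomial of a over Z and M the
   Mahler measure; by Gauss's lemma at the finite places this is the
   normalised sum of log max(1, |a|_v) over the places v of Q(a). *)
Definition weil_height a : R :=
  ln (mahler_measure (map_poly (intr : int -> R[i]) (minpolyZ a))) /
  (algdeg a)%:R.

Definition wheight (g : R) a : R := (algdeg a)%:R `^ g * weil_height a.

Definition Ncount (g : R) A (C : R) : \bar R :=
  counting [set a | A a /\ wheight g a < C].

Definition roots_of_unity A : set R[i] :=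
  [set a | A a /\ exists2 n, (0 < n)%N & n.-unity_root a].

Definition Northcott_number (g : R) A : \bar R :=
  ereal_inf [set C%:E | C in [set C : R | 0 < C /\ Ncount g A C = +oo%E]].

Definition has_N (g : R) A : Prop :=
  forall C : R, 0 < C -> (Ncount g A C < +oo)%E.

Definition has_B (g : R) A : Prop :=
  exists2 C : R, 0 < C & (Ncount g (A `\` roots_of_unity A) C < +oo)%E.

Definition I_N A : set R := [set g | has_N g A].

Definition I_B A : set R := [set g | has_B g A].

Definition rootfield (p q d : nat -> nat) : set R[i] :=
  adjoinQ (range (fun i : nat =>
    (((p i)%:R / (q i)%:R) `^ ((d i)%:R^-1) : R)%:C)).

End AlgebraicNumbers.

(* Main.v *)
(* Let beta be the product of the first n radicals and D = d_1 ... d_n. Then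
   K_n = Q(beta), beta^D is rational, X^D - beta^D is irreducible, and L is the
   union of the K_n.

   Lower bound. Let a = F(beta) lie in K_n but not in K_(n-1), and write d, p, q
   for d_n, p_n, q_n. The norm from K_(n-1) to Q of the discriminant of a over
   K_(n-1) is a nonzero rational number. It is bounded above at infinity by the
   Leibniz expansion of Vandermonde determinants. At the primes p and q the
   extension K_n / K_(n-1) is totally ramified while p and q are unramified in
   K_(n-1), so the terms of F(beta) have distinct valuations modulo d and every
   difference of relative conjugates gains a factor beta, respectively 1/beta.
   Comparing at all places gives
     h(a) >= log(p q) / (2 d) - log d / (d - 1).
   Places above a prime l are represented by maximal subrings of R[i] not
   containing 1/l, which are valuation rings. With Northcott's theorem in K_n
   this yields all finiteness statements.

   Upper bound. The radical of index n has height log q_n / d_n and degree d_n,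
   and beta has height the sum of the log q_i / d_i and degree D: the former
   elements show infiniteness when gamma >= 0, the latter when gamma < 0. *)

Require Import Defs.
From HB Require Import structures.
From mathcomp Require Import all_boot all_order all_algebra all_fingroup all_solvable all_field.
From mathcomp Require Import all_classical all_reals all_analysis.
From mathcomp Require Import complex.
From mathcomp Require Import ring lra zify.

Set Implicit Arguments.
Unset Strict Implicit.
Unset Printing Implicit Defensive.

Import Order.TTheory GRing.Theory Num.Theory.
Import numFieldNormedType.Exports.

Local Open Scope classical_set_scope.
Local Open Scope ring_scope.

(** Absolute values are never constructed. At a place [O], the comparison |x| <= |y| is the
    membership of x / y in [O], and [mu] supplies an element of absolute value max(1, |x|). In place
    of the product formula stands one fact: a nonzero rational number that is integral at a place
    above every prime has absolute value at least 1. It is applied to the norm of the discriminant,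
    divided by the power of p q that ramification provides and multiplied by a power of the leading
    coefficient of an integral characteristic polynomial, which by Gauss's lemma clears the
    denominators at all finite places.

    Relative field theory is avoided as well: conjugates are values of one rational polynomial at
    the roots of X^D - beta^D, and coordinates over K_(n-1) are the classes of exponents modulo d.

    The term log d / (d - 1) comes from the d! terms of the Leibniz expansion. The degree of an
    element new at level n lies between d_n and D; as deg^g is least at one end or the other
    according to the sign of g, the case g < 0 needs the factor (d_1 ... d_(n-1))^(-g) in the
    exponent that governs p_n. *)

(** * Existence of valuation rings above a prime *)

Section ValuationRings.
Variable F : numFieldType.
Implicit Types (A O : set F) (x y z : F) (s t : {poly F}).

(** The last two fields say that [O] is a valuation ring and that l lies in its maximal ideal: a
    place above l, encoded without a value group. *)
Record valring (l : nat) O : Prop := Valring {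
  vr1 : O 1;
  vrB : forall x y, O x -> O y -> O (x - y);
  vrM : forall x y, O x -> O y -> O (x * y);
  vrT : forall x, O x \/ O x^-1;
  vrl : ~ O l%:R^-1 }.

(** Only a nonempty [A] is asked to contain 1: Zorn's lemma is used for unions of arbitrary chains,
    and the empty chain has the empty union. *)
Definition presubring l A :=
  [/\ forall x, A x -> A 1, forall x y, A x -> A y -> A (x - y),
      forall x y, A x -> A y -> A (x * y) & ~ A (l%:R^-1 : F)].

Section Maximal.
Variables (l : nat) (A : set F).
Hypotheses (l_gt1 : (1 < l)%N) (PA : presubring l A).
Hypothesis maxA : forall B, A `<` B -> ~ presubring l B.

Let lF_neq0 : (l%:R : F) != 0.
Proof. by rewrite pnatr_eq0; case: l l_gt1. Qed.

Let A1 : A 1.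
Proof.
have [A1 AB AM Al] := PA.
(* Lacking 1, [A] would be empty, and the ring of integers, where l > 1 is not invertible, would
   properly contain it. *)
apply: contrapT => nA1; pose Z := [set x : F | exists n : int, x = n%:~R].
have A0 x : ~ A x by move=> /A1.
apply: (maxA (B := Z)).
  split; last by move=> /(_ 1) ZA; apply/nA1/ZA; exists 1.
  by move=> x /A0.
split.
- by move=> _ _; exists 1.
- by move=> _ _ [m ->] [n ->]; exists (m - n); rewrite rmorphB.
- by move=> _ _ [m ->] [n ->]; exists (m * n); rewrite rmorphM.
- case=> n /(congr1 ( *%R l%:R)); rewrite divff // => /eqP.
  have -> : (l%:R : F) = (l%:Z)%:~R by [].
  rewrite -intrM -[1]/(1%:~R) eqr_int => /eqP ln1.
  have /eqP : (l * `|n|)%N = 1%N by rewrite -[l]/(`|l%:Z|%N) -abszM -ln1.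
  rewrite muln_eq1 => /andP[/eqP l1 _].
  by move: l_gt1; rewrite l1.
Qed.

Let AB x y : A x -> A y -> A (x - y). Proof. by case: PA => _ + _ _; apply. Qed.
Let AM x y : A x -> A y -> A (x * y). Proof. by case: PA => _ _ + _; apply. Qed.
Let nAl : ~ A l%:R^-1. Proof. by case: PA. Qed.
Let A0 : A 0. Proof. by rewrite -(subrr 1); apply: AB. Qed.
Let AN x : A x -> A (- x). Proof. by rewrite -sub0r; apply: AB. Qed.
Let AD x y : A x -> A y -> A (x + y).
Proof. by move=> Ax Ay; rewrite -[y]opprK; apply: AB => //; apply: AN. Qed.
Let Anat n : A n%:R.
Proof. by elim: n => [|n IH]; rewrite ?mulr0n // mulrS; apply: AD. Qed.
Let Asum (I : Type) (r : seq I) (P : pred I) (G : I -> F) :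
  (forall i, P i -> A (G i)) -> A (\sum_(i <- r | P i) G i).
Proof. by move=> AG; elim/big_rec: _ => // i x Pi; apply: AD; apply: AG. Qed.
Let AX x n : A x -> A (x ^+ n).
Proof. by move=> Ax; elim: n => [|n IH]; rewrite ?expr0 // exprS; apply: AM. Qed.

(** Maximality applied to A[x]: it properly contains [A], so it must contain 1/l. *)
Let adjoin x : ~ A x ->
  exists2 s : {poly F}, (forall i, A s`_i) & s.[x] = l%:R^-1.
Proof.
move=> nAx; pose B := [set y | exists2 s : {poly F}, (forall i, A s`_i) & s.[x] = y].
suff : B l%:R^-1 by case=> s; exists s.
apply: contrapT => nBl; apply: (maxA (B := B)).
  split; last first.
    move=> /(_ x) BA; apply: nAx; apply: BA.
    by exists 'X; rewrite ?hornerX// => i; rewrite coefX; apply: Anat.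
  move=> y Ay; exists y%:P; rewrite ?hornerC// => i.
  by rewrite coefC; case: ifP.
split=> //.
- by move=> _ _; exists 1%:P; rewrite ?hornerC// => i; rewrite coefC; case: ifP.
- move=> _ _ [s As <-] [t At <-]; exists (s - t); rewrite ?hornerE// => i.
  by rewrite coefB; apply: AB.
- move=> _ _ [s As <-] [t At <-]; exists (s * t); rewrite ?hornerE// => i.
  by rewrite coefM; apply: Asum => j _; apply: AM.
Qed.

(** Otherwise 1/l is a polynomial in u^-1, where u = 1 - l b; clearing denominators puts u^n / l in
    [A], and u^n = 1 - l c then puts 1/l itself in [A]. *)
Let local_unit b : A b -> A (1 - l%:R * b)^-1.
Proof.
move=> Ab; apply: contrapT; set u := 1 - _ => nAu.
have Au : A u by apply: AB => //; apply: AM.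
have [s As su] := adjoin nAu.
have u0 : u != 0 by apply/eqP => u0; apply: nAu; rewrite u0 invr0.
have Aun : A (u ^+ size s / l%:R).
  rewrite -su horner_coef mulr_sumr; apply: Asum => i _.
  rewrite mulrCA; apply: AM => //; rewrite exprVn.
  by rewrite -expfB_cond ?(negPf u0)//= ?(ltnW (ltn_ord i)); [apply: AX|].
have [c Ac uE] : exists2 c, A c & u ^+ size s = 1 - l%:R * c.
  elim: (size s) => [|n [c Ac IH]]; first by exists 0; rewrite ?mulr0 ?subr0.
  exists (b + c - l%:R * b * c); first by do ?[apply: AB|apply: AD|apply: AM].
  by rewrite exprS IH /u; ring.
apply: nAl; have -> : l%:R^-1 = u ^+ size s / l%:R + c by rewrite uE; field.
exact: AD.
Qed.

(** Chevalley's descent. The shorter relation, solved for a power x^k by means of the unit 1 - l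
    t_0, rewrites the leading term of the longer one in lower powers of x. The two relations play
    symmetric roles under x -> x^-1, and [N] bounds their total size. *)
Let no_relations N x s t : (size s + size t <= N)%N -> x != 0 ->
  (forall i, A s`_i) -> (forall i, A t`_i) ->
  s.[x] = l%:R^-1 -> t.[x^-1] = l%:R^-1 -> False.
Proof.
elim: N x s t => [|N IH] x s t.
  rewrite leqn0 addn_eq0 !size_poly_eq0 => /andP[/eqP -> _] _ _ _.
  by rewrite horner0 => /eqP; rewrite eq_sym invr_eq0 (negPf lF_neq0).
wlog lets : x s t / (size t <= size s)%N => [wl|] sz x0 As At sx tx.
  case: (leqP (size t) (size s)) => [le|/ltnW le]; first exact: (wl x s t).
  by apply: (wl x^-1 t s); rewrite ?invr_eq0 ?invrK // addnC.
case t0 : (size t) => [|k].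
  move: tx => /eqP; move/eqP: t0; rewrite size_poly_eq0 => /eqP ->.
  by rewrite horner0 eq_sym invr_eq0 (negPf lF_neq0).
have [n ns] : exists n, size s = n.+1 by case: (size s) lets => [|n]; [lia|exists n].
have Au := local_unit (At 0%N); set u := 1 - l%:R * t`_0 in Au.
have u0 : u != 0.
  apply/eqP => /eqP; rewrite subr_eq0 => /eqP lt0; apply: nAl.
  by have -> : l%:R^-1 = t`_0; [apply: (mulfI lF_neq0); rewrite divff// -lt0|].
(* Multiplying 1 - l t_0 = l (t_1 x^-1 + ... + t_k x^-k) by x^k and dividing by u gives x^k = l
   w(x). *)
pose w := \poly_(i < k) (u^-1 * t`_(k - i)).
have Aw i : A w`_i by rewrite coef_poly; case: ifP => // _; apply: AM.
have xk : x ^+ k = l%:R * w.[x].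
  have : l%:R * t.[x^-1] = 1 by rewrite tx divff.
  rewrite horner_coef t0 big_ord_recl expr0 mulr1; set S := \sum_(i < _) _ => lE.
  have uE : u = l%:R * S by rewrite /u -[X in X - _]lE mulrDr [_ + _ * S]addrC addrK.
  have Sw : u * w.[x] = S * x ^+ k.
    rewrite horner_poly mulr_sumr mulr_suml (reindex_inj rev_ord_inj) /=.
    apply: eq_bigr => i _; rewrite mulrA mulVKf//.
    have ik := ltn_ord i.
    rewrite /bump /= add1n subKn // -[RHS]mulrA; congr (_ * _).
    by rewrite exprVn mulrC -expfB_cond ?(negPf x0).
  by apply: (mulfI u0); rewrite mulrCA Sw mulrA -uE.
pose s' := \poly_(i < n) s`_i + (l%:R * s`_n) *: ('X^(n - k) * w).
have kn : (k <= n)%N by rewrite -ltnS -ns -t0.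
apply: (IH x s' t) => //.
- rewrite -ltnS (leq_trans _ sz)// ltn_add2r ns ltnS.
  rewrite (leq_trans (size_polyD _ _))// geq_max size_poly /=.
  rewrite (leq_trans (size_scale_leq _ _))// (leq_trans (size_polyMleq _ _))//.
  have sw : (size w <= k)%N := size_poly _ _.
  by rewrite size_polyXn addSn /= -{2}(subnK kn) leq_add2l.
- move=> i; rewrite coefD coefZ; apply: AD.
    by rewrite coef_poly; case: ifP.
  apply: AM; first by apply: AM.
  by rewrite coefXnM; case: ifP.
- have e : l%:R * s`_n * (x ^+ (n - k) * w.[x]) = s`_n * x ^+ n.
    have -> : x ^+ n = x ^+ (n - k) * (l%:R * w.[x]) by rewrite -xk -exprD subnK.
    by ring.
  rewrite hornerD hornerZ hornerM hornerXn e.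
  by rewrite -sx [in RHS]horner_coef ns big_ord_recr /= horner_poly.
Qed.

Lemma maximal_valring : valring l A.
Proof.
split=> // x; apply: contrapT => /not_orP[nx nVx].
have x0 : x != 0 by apply/eqP => x0; apply: nx; rewrite x0.
have [[s As sx] [t At tx]] := (adjoin nx, adjoin nVx).
exact: (no_relations (leqnn _) x0 As At sx tx).
Qed.
End Maximal.

Lemma valring_exists l : (1 < l)%N -> exists O, valring l O.
Proof.
move=> l_gt1; have [|A [PA maxA]] := @Zorn_bigcup F (presubring l).
  move=> G GP Gtot.
  have chain x y : (\bigcup_(X in G) X) x -> (\bigcup_(X in G) X) y ->
      exists2 X, G X & X x /\ X y.
    move=> [X GX Xx] [Y GY Yy].
    by case: (Gtot X Y GX GY) => [XY|YX]; [exists Y|exists X] => //; split; auto.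
  split.
  - by move=> x [X GX Xx]; exists X => //; have [X1 _ _ _] := GP _ GX; apply: X1 Xx.
  - move=> x y Ux Uy; have [X GX [Xx Xy]] := chain _ _ Ux Uy.
    by exists X => //; have [_ XB _ _] := GP _ GX; apply: XB.
  - move=> x y Ux Uy; have [X GX [Xx Xy]] := chain _ _ Ux Uy.
    by exists X => //; have [_ _ XM _] := GP _ GX; apply: XM.
  - by move=> [X GX]; have [] := GP _ GX.
by exists A; apply: maximal_valring.
Qed.

End ValuationRings.

(** * Calculus in a valuation ring *)

Section ValuationTheory.
Variables (F : numFieldType) (l : nat) (O : set F).
Hypotheses (l_prime : prime l) (V : valring l O).
Implicit Types (x y z u : F).

Lemma vr0 : O 0. Proof. by rewrite -(subrr 1); apply: (vrB V); apply: vr1 V. Qed.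
Lemma vrN x : O x -> O (- x).
Proof. by move=> Ox; rewrite -sub0r; apply: (vrB V) => //; apply: vr0. Qed.
Lemma vrD x y : O x -> O y -> O (x + y).
Proof. by move=> Ox Oy; rewrite -[y]opprK; apply: (vrB V) => //; apply: vrN. Qed.
Lemma vrX x n : O x -> O (x ^+ n).
Proof.
by move=> Ox; elim: n => [|n IH]; rewrite ?expr0 ?exprS; [apply: vr1 V|apply: (vrM V)].
Qed.
Lemma vrnat n : O n%:R.
Proof. by elim: n => [|n IH]; [apply: vr0|rewrite mulrS; apply: vrD => //; apply: vr1 V]. Qed.
Lemma vrint (n : int) : O n%:~R.
Proof. by case: n => n; rewrite ?NegzE ?rmorphN; [|apply: vrN]; apply: vrnat. Qed.
Lemma vrsum (I : Type) (r : seq I) (P : pred I) (G : I -> F) :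
  (forall i, P i -> O (G i)) -> O (\sum_(i <- r | P i) G i).
Proof. by move=> OG; elim/big_rec: _ => [|i x Pi]; [apply: vr0|apply: vrD; apply: OG]. Qed.
Lemma vrprod (I : Type) (r : seq I) (P : pred I) (G : I -> F) :
  (forall i, P i -> O (G i)) -> O (\prod_(i <- r | P i) G i).
Proof. by move=> OG; elim/big_rec: _ => [|i x Pi]; [apply: vr1 V|apply: (vrM V); apply: OG]. Qed.

Definition vunit x := [/\ x != 0, O x & O x^-1].
(** The maximal ideal. Zero is listed apart because its conventional inverse 0 lies in [O]. *)
Definition vM x := x = 0 \/ ~ O x^-1.

Lemma vM_O x : vM x -> O x.
Proof. by case=> [->|]; [apply: vr0|case: (vrT V x)]. Qed.

Lemma vMM x y : vM x -> O y -> vM (x * y).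
Proof.
case=> [->|nx] Oy; first by left; rewrite mul0r.
have [->|y0] := eqVneq y 0; first by left; rewrite mulr0.
right=> Oxy; apply: nx; have -> : x^-1 = y * (x * y)^-1.
  by rewrite invfM mulrCA divff// mulr1.
exact: (vrM V).
Qed.

Lemma vMD x y : vM x -> vM y -> vM (x + y).
Proof.
move=> Mx My; have [->|x0] := eqVneq x 0; first by rewrite add0r.
have [->|y0] := eqVneq y 0; first by rewrite addr0.
case: (vrT V (y / x)) => Oxy.
  have -> : x + y = x * (1 + y / x) by field.
  by apply: vMM => //; apply: vrD => //; apply: vr1 V.
have -> : x + y = y * (1 + (y / x)^-1) by field; apply/andP.
by apply: vMM => //; apply: vrD => //; apply: vr1 V.
Qed.

Lemma vMN x : vM x -> vM (- x).
Proof. by move=> Mx; rewrite -mulrN1; apply: vMM => //; apply/vrN/(vr1 V). Qed.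

Lemma vMsum (I : Type) (r : seq I) (P : pred I) (G : I -> F) :
  (forall i, P i -> vM (G i)) -> vM (\sum_(i <- r | P i) G i).
Proof. by move=> OG; elim/big_rec: _ => [|i x Pi]; [left|apply: vMD; apply: OG]. Qed.

Lemma vunitP x : O x -> vunit x \/ vM x.
Proof.
move=> Ox; have [->|x0] := eqVneq x 0; first by right; left.
by case: (pselect (O x^-1)) => h; [left|right; right].
Qed.

Lemma vunit_nM x : vunit x -> ~ vM x.
Proof. by case=> /eqP x0 _ Ox []. Qed.

Lemma vunit1 : vunit 1.
Proof. by split; rewrite ?oner_eq0 ?invr1//; apply: vr1 V. Qed.

Lemma vunitM x y : vunit x -> vunit y -> vunit (x * y).
Proof.
by move=> [x0 Ox Ox'] [y0 Oy Oy']; split; rewrite ?mulf_neq0 ?invfM//; apply: (vrM V).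
Qed.

Lemma vunitV x : vunit x -> vunit x^-1.
Proof. by move=> [x0 Ox Ox']; split; rewrite ?invr_eq0 ?invrK. Qed.

Lemma vunitX x n : vunit x -> vunit (x ^+ n).
Proof.
by move=> ux; elim: n => [|n IH]; rewrite ?expr0 ?exprS; [apply: vunit1|apply: vunitM].
Qed.

Lemma vunitD u x : vunit u -> vM x -> vunit (u + x).
Proof.
move=> uu Mx; have Ou : O u by case: uu.
case: (vunitP (vrD Ou (vM_O Mx))) => // Mux; case: (vunit_nM uu).
by rewrite -(addrK x u); apply/vMD/vMN.
Qed.

(** Integral closedness for pure equations: if y^-1 is in [O], then y = y^(n+1) (y^-1)^n. *)
Lemma vunit_pow x n : (0 < n)%N -> vunit (x ^+ n) -> vunit x.
Proof.
case: n => // n _ [xn0 Oxn Oxn'].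
have x0 : x != 0 by apply: contraNneq xn0 => ->; rewrite exprS mul0r.
suff aux y : y != 0 -> O (y ^+ n.+1) -> O y.
  by split=> //; apply: aux; rewrite ?invr_eq0// exprVn.
move=> y0 Oyn; case: (vrT V y) => // Oy'.
rewrite -(mulfK (expf_neq0 n y0) y) -exprS -exprVn.
by apply: (vrM V) => //; apply: vrX.
Qed.

Lemma vM_l : vM l%:R. Proof. by right; apply: vrl V. Qed.

Lemma vunit_nat n : coprime l n -> vunit n%:R.
Proof.
move=> ln; case: (vunitP (vrnat n)) => // Mn; case: (vunit_nM vunit1).
have l_gt0 := prime_gt0 l_prime.
case: (egcdnP n l_gt0) => kl kn E _; move: E; rewrite (eqP ln) => /(congr1 (fun n => n%:R : F)).
rewrite natrD !natrM => E.
have -> : 1 = l%:R * kl%:R - n%:R * kn%:R :> F by rewrite mulrC E [n%:R * _]mulrC addrC addKr.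
by apply: vMD; [|apply: vMN]; (apply: vMM; last exact: vrnat) => //; apply: vM_l.
Qed.

Lemma vM_int (n : int) : vM n%:~R -> exists n' : int, n = n' * l%:Z.
Proof.
move=> Mn; apply/dvdzP; rewrite /dvdz /= ; apply: contrapT => /negP ndiv.
have /vunit_nat u : coprime l `|n| by rewrite prime_coprime.
apply: (vunit_nM u); rewrite -[`|n|%:R]/((`|n|%N : int)%:~R) abszE.
by case: (leP 0 n) => h; [rewrite ger0_norm|rewrite ltr0_norm// rmorphN; apply: vMN].
Qed.

(** An element of absolute value max(1, |x|) at the place [O]; it stands for the local factor of the
    height. *)
Definition mu x : F := if `[<O x>] then 1 else x.

Lemma mu_neq0 x : mu x != 0.
Proof.
rewrite /mu; case: ifPn; rewrite ?oner_eq0// => /asboolP nOx.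
by apply/eqP => x0; apply: nOx; rewrite x0; apply: vr0.
Qed.

Lemma vr_div_mu x : O (x / mu x).
Proof.
rewrite /mu; case: ifPn => /asboolP Ox; first by rewrite divr1.
rewrite divff; first exact: vr1 V.
by apply/eqP => x0; apply: Ox; rewrite x0; apply: vr0.
Qed.

Lemma vrV_mu x : O (mu x)^-1.
Proof.
rewrite /mu; case: ifPn => /asboolP Ox; first by rewrite invr1; apply: vr1 V.
by case: (vrT V x).
Qed.

Lemma vr_sub_mu x y : O ((x - y) / (mu x * mu y)).
Proof.
have -> : (x - y) / (mu x * mu y) = x / mu x * (mu y)^-1 - y / mu y * (mu x)^-1.
  by field; rewrite !mu_neq0.
by apply: (vrB V); apply: (vrM V); (apply: vr_div_mu || apply: vrV_mu).
Qed.

(* Synthetic division by a root, from the top when the root is integral and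
   from the bottom otherwise. *)
Lemma vr_lead_prod_mu (s : seq F) b :
  (forall i, O (b *: \prod_(a <- s) ('X - a%:P))`_i) -> O (b * \prod_(a <- s) mu a).
Proof.
elim: s b => [|a s IH] b.
  by move=> /(_ 0%N); rewrite !big_nil coefZ coef1 mulr1.
rewrite !big_cons mulrA => Ob; apply: IH => i; move: Ob.
set B := \prod_(_ <- s) _; rewrite scalerAr; set B1 := b *: B => OB.
have -> : ((b * mu a) *: B)`_i = mu a * B1`_i by rewrite !coefZ mulrA [mu a * b]mulrC.
have cB k : (('X - a%:P) * B1)`_k.+1 = B1`_k - a * B1`_k.+1.
  by rewrite mulrBl coefB coefXM coefCM.
rewrite /mu; case: ifPn => /asboolP Oa.
  rewrite mul1r; have [n] := ubnP (size B1 - i).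
  elim: n i => // n IHn i lt_n.
  case: (leqP (size B1) i) => [le|lt]; first by rewrite nth_default //; apply: vr0.
  rewrite -[B1`_i](subrK (a * B1`_i.+1)) -cB.
  by apply: vrD => //; apply: (vrM V) => //; apply: IHn; lia.
have a0 : a != 0 by apply/eqP => a0; apply: Oa; rewrite a0; apply: vr0.
have Oa' : O a^-1 by case: (vrT V a).
elim: i => [|i IHi].
  by have := OB 0%N; rewrite mulrBl coefB coefXM coefCM sub0r => /vrN; rewrite opprK.
have -> : a * B1`_i.+1 = a^-1 * (a * B1`_i) - (('X - a%:P) * B1)`_i.+1.
  by rewrite cB mulKf// opprB addrC subrK.
by apply: (vrB V) => //; apply: (vrM V).
Qed.

Section ValuationOfPi.
Variable pi : F.
Hypotheses (pi_neq0 : pi != 0) (Mpi : vM pi).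

(** x has the value e in units of the value of [pi]. This is a relation and not a function: the
    value group of [O] is arbitrary, and not every value is a multiple of that of [pi]. *)
Definition vval x (e : int) := vunit (x / pi ^ e).

Lemma vvalM x y e f : vval x e -> vval y f -> vval (x * y) (e + f).
Proof.
move=> vx vy; rewrite /vval.
have -> : x * y / pi ^ (e + f) = (x / pi ^ e) * (y / pi ^ f).
  by rewrite expfzDr// invfM mulrACA.
exact: vunitM.
Qed.

Lemma vval_neq0 x e : vval x e -> x != 0.
Proof. by case=> + _ _; apply: contraNneq => ->; rewrite mul0r. Qed.

Lemma vval_O x e f : vval x e -> f <= e -> O (x / pi ^ f).
Proof.
move=> [_ Ox _] fe.
have -> : x / pi ^ f = x / pi ^ e * pi ^ (e - f).
  by rewrite expfzDr// mulrA mulfVK ?expfz_neq0// -invr_expz.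
apply: (vrM V) => //; have -> : e - f = `|e - f|%N by rewrite gez0_abs ?subr_ge0.
by apply: vrX; apply: vM_O.
Qed.

Lemma vval_M x e f : vval x e -> f < e -> vM (x / pi ^ f).
Proof.
move=> vx fe; have := vval_O vx (_ : f + 1 <= e).
rewrite lezD1 => /(_ fe) h.
have -> : x / pi ^ f = pi * (x / pi ^ (f + 1)); last exact: vMM.
by rewrite expfzDr// expr1z; field; rewrite pi_neq0 expfz_neq0.
Qed.

Lemma vval_nO x e : vval x e -> e < 0 -> ~ O x.
Proof.
move=> vx e0 Ox; apply: (vunit_nM vx); rewrite -[x]mulr1 -mulrA mulrC.
apply: vMM => //; have v1 : vval 1 0 by rewrite /vval expr0z divr1; apply: vunit1.
exact: vval_M v1 e0.
Qed.

(** The ultrametric inequality is sharp when the values are pairwise distinct: the term of least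
    value dominates. Zero terms have no value and are exempted throughout. *)
Lemma vval_sum (I : finType) (x : I -> F) (e : I -> int) :
  (forall i, x i != 0 -> vval (x i) (e i)) ->
  (forall i j, x i != 0 -> x j != 0 -> i != j -> e i != e j) ->
  (exists i, x i != 0) ->
  exists i0, [/\ x i0 != 0, forall j, x j != 0 -> e i0 <= e j
               & vval (\sum_i x i) (e i0)].
Proof.
move=> vx inj [i1 xi1]; case: (@arg_minP _ _ I i1 (fun i => x i != 0) e xi1) => i0 xi0 mini0.
exists i0; split=> //; rewrite (bigD1 i0)//= /vval mulrDl.
apply: vunitD; first exact: vx.
rewrite mulr_suml; apply: vMsum => j ji0.
have [->|xj] := eqVneq (x j) 0; first by rewrite mul0r; left.
apply: (vval_M (vx _ xj)); rewrite lt_neqAle mini0// andbT.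
by apply: inj => //; rewrite eq_sym.
Qed.

End ValuationOfPi.

End ValuationTheory.

(** * Evaluation of rational polynomials *)

Section RationalEvaluation.
Variable F : numFieldType.
Implicit Types (f g h : {poly rat}) (x : F).

Definition evalQ f x : F := (map_poly (ratr : rat -> F) f).[x].

Lemma evalQD f g x : evalQ (f + g) x = evalQ f x + evalQ g x.
Proof. by rewrite /evalQ rmorphD hornerD. Qed.
Lemma evalQB f g x : evalQ (f - g) x = evalQ f x - evalQ g x.
Proof. by rewrite /evalQ rmorphB !hornerE. Qed.
Lemma evalQM f g x : evalQ (f * g) x = evalQ f x * evalQ g x.
Proof. by rewrite /evalQ rmorphM hornerM. Qed.
Lemma evalQZ c f x : evalQ (c *: f) x = ratr c * evalQ f x.
Proof. by rewrite /evalQ map_polyZ hornerZ. Qed.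
Lemma evalQXn n x : evalQ 'X^n x = x ^+ n.
Proof. by rewrite /evalQ map_polyXn hornerXn. Qed.
Lemma evalQX x : evalQ 'X x = x.
Proof. by rewrite /evalQ map_polyX hornerX. Qed.
Lemma evalQC c x : evalQ c%:P x = ratr c.
Proof. by rewrite /evalQ map_polyC hornerC. Qed.
Lemma evalQ_exp f n x : evalQ (f ^+ n) x = evalQ f x ^+ n.
Proof. by rewrite /evalQ rmorphXn horner_exp. Qed.
Lemma evalQ_sum (I : Type) (r : seq I) (P : pred I) (G : I -> {poly rat}) x :
  evalQ (\sum_(i <- r | P i) G i) x = \sum_(i <- r | P i) evalQ (G i) x.
Proof. by rewrite /evalQ rmorph_sum horner_sum. Qed.
Lemma evalQ_comp f g x : evalQ (f \Po g) x = evalQ f (evalQ g x).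
Proof. by rewrite /evalQ map_comp_poly horner_comp. Qed.

(* The factor of T coprime to g still vanishes at x; no irreducibility needed. *)
Lemma evalQ_inv (T g : {poly rat}) x : T != 0 -> evalQ T x = 0 ->
  evalQ g x != 0 -> exists h, evalQ h x * evalQ g x = 1.
Proof.
move=> T0 /rootP Tx gx.
pose T' := gdcop g T.
have rT' : evalQ T' x = 0.
  apply/rootP; rewrite /T' gdcop_map root_gdco ?map_poly_eq0//.
  by rewrite Tx /=; apply/negP => /rootP gx0; move: gx; rewrite /evalQ gx0 eqxx.
have cop : coprimep T' g by apply: coprimep_gdco.
case/Bezout_eq1_coprimepP: cop => -[u v] /= uv.
exists v; rewrite -evalQM; have -> : v * g = 1 - u * T' by rewrite -uv addrC addKr.
by rewrite evalQB evalQM rT' mulr0 subr0 -[1]/(1%:P) evalQC rmorph1.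
Qed.

Lemma evalQ_int f x : exists (q : {poly int}) (a : int),
  a != 0 /\ evalQ f x = a%:~R^-1 * (map_poly intr q).[x].
Proof.
have [q [a a0 ->]] := rat_poly_scale f; exists q, a; split=> //.
rewrite evalQZ fmorphV /= ratr_int; congr (_ * _); rewrite /evalQ; congr (_.[_]).
by rewrite -map_poly_comp; apply: eq_map_poly => n /=; rewrite ratr_int.
Qed.

End RationalEvaluation.

(** * Primes unramified in Q(eta), where eta^m = N *)

Section Unramified.
Variables (F : numFieldType) (l : nat) (O : set F).
Hypotheses (l_prime : prime l) (V : valring l O).
Variables (eta : F) (m N : nat).
Hypotheses (m_gt0 : (0 < m)%N) (etam : eta ^+ m = N%:R).
Hypotheses (lN : coprime l N) (lm : coprime l m).

Let ZR : set F := [set x | exists g : {poly int}, x = (map_poly intr g).[eta]].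

Let ZR1 : ZR 1. Proof. by exists 1; rewrite rmorph1 hornerC. Qed.
Let ZReta : ZR eta. Proof. by exists 'X; rewrite map_polyX hornerX. Qed.
Let ZRD x y : ZR x -> ZR y -> ZR (x + y).
Proof. by move=> [f ->] [g ->]; exists (f + g); rewrite rmorphD hornerD. Qed.
Let ZRN x : ZR x -> ZR (- x).
Proof. by move=> [f ->]; exists (- f); rewrite rmorphN hornerN. Qed.
Let ZRM x y : ZR x -> ZR y -> ZR (x * y).
Proof. by move=> [f ->] [g ->]; exists (f * g); rewrite rmorphM hornerM. Qed.
Let ZRnat n : ZR n%:R.
Proof. by exists (n%:Z)%:P; rewrite map_polyC hornerC. Qed.
Let ZR0 : ZR 0. Proof. exact: (ZRnat 0). Qed.
Let ZRX x n : ZR x -> ZR (x ^+ n).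
Proof. by move=> Zx; elim: n => [|n IH]; rewrite ?expr0 ?exprS //; apply: ZRM. Qed.
Let ZRsum (I : Type) (r : seq I) (P : pred I) (G : I -> F) :
  (forall i, P i -> ZR (G i)) -> ZR (\sum_(i <- r | P i) G i).
Proof. by move=> OG; elim/big_rec: _ => [|i x Pi]; [|apply: ZRD; apply: OG]. Qed.

Let frob1 x y : ZR x -> ZR y -> exists2 z, ZR z & (x + y) ^+ l = x ^+ l + y ^+ l + l%:R * z.
Proof.
move=> Zx Zy; have l_gt0 := prime_gt0 l_prime.
pose G i : F := x ^+ (l - i.+1) * y ^+ i.+1 * ('C(l, i.+1) %/ l)%:R.
exists (\sum_(i < l.-1) G i).
  by apply: ZRsum => i _; apply: ZRM; [apply: ZRM; apply: ZRX|apply: ZRnat].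
rewrite exprDn big_ord_recr /= subnn expr0 mul1r binn mulr1n addrAC; congr (_ + _).
rewrite -(big_mkord xpredT (fun i => x ^+ (l - i) * y ^+ i *+ 'C(l, i))) big_ltn//.
rewrite subn0 expr0 mulr1 bin0 mulr1n big_add1 big_mkord mulr_sumr; congr (_ + _).
apply: eq_bigr => i _.
have /divnK dv : (l %| 'C(l, i.+1))%N.
  by apply: prime_dvd_bin => //=; rewrite -ltn_predRL.
by rewrite -[X in _ *+ X]dv -mulr_natr natrM /G; ring.
Qed.

Let frob x y k : ZR x -> ZR y -> exists2 z, ZR z &
  (x + y) ^+ (l ^ k) = x ^+ (l ^ k) + y ^+ (l ^ k) + l%:R * z.
Proof.
move=> Zx Zy; elim: k => [|k [z Zz IH]].
  by exists 0 => //; rewrite expn0 !expr1 mulr0 addr0.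
have Zxk := ZRX (l ^ k) Zx; have Zyk := ZRX (l ^ k) Zy.
rewrite expnSr !exprM IH.
have [z1 Zz1 ->] := frob1 (ZRD Zxk Zyk) (ZRM (ZRnat l) Zz).
have [z2 Zz2 ->] := frob1 Zxk Zyk.
exists (z2 + l%:R ^+ l.-1 * z ^+ l + z1).
  by do 2?[apply: ZRD => //]; apply: ZRM => //; apply: ZRX.
have e : l%:R ^+ l = l%:R * l%:R ^+ l.-1 :> F by rewrite -exprS prednK ?prime_gt0.
by rewrite exprMn e; ring.
Qed.

(** Makes Q = 1 modulo m (l - 1), so that eta^Q is eta times a power of N^(l-1); Fermat's little
    theorem then gives eta^Q = eta modulo l. *)
Let k := totient (m * l.-1).
Let Q := (l ^ k)%N.

Let ml_gt0 : (0 < m * l.-1)%N.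
Proof. by rewrite muln_gt0 m_gt0 -ltnS prednK ?prime_gt1 ?prime_gt0. Qed.

Let Q_mod : Q = 1 %[mod m * l.-1].
Proof.
apply: Euler_exp_totient; rewrite coprimeMr lm /=.
by rewrite coprime_sym; have := coprimenS l.-1; rewrite prednK ?prime_gt0.
Qed.

Let Q_gt1 : (1 < Q)%N.
Proof. by rewrite -(expn0 l) ltn_exp2l ?prime_gt1// totient_gt0. Qed.

Let frob_eta : exists2 z, ZR z & eta ^+ Q = eta + l%:R * z.
Proof.
have /dvdnP[j Qj] : (m * l.-1 %| Q.-1)%N.
  by rewrite -[Q.-1]subn1 -eqn_mod_dvd ?(ltnW Q_gt1)//; apply/eqP.
have : N ^ (totient l * j) = 1 %[mod l].
  rewrite expnM; have := Euler_exp_totient (_ : coprime N l).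
  by rewrite coprime_sym => /(_ lN) E; rewrite -modnXm E modnXm exp1n.
rewrite totient_prime// => /eqP; rewrite eqn_mod_dvd; last first.
  rewrite expn_gt0; case: (N) lN => //; rewrite /coprime gcdn0.
  by move=> /eqP l1; move: l_prime; rewrite l1.
move=> /dvdnP[c]; set A := (_ ^ _)%N => Ac.
have A_gt0 : (0 < A)%N.
  rewrite expn_gt0; case: (N) lN => //; rewrite /coprime gcdn0.
  by move=> /eqP l1; move: l_prime; rewrite l1.
have AE : A = (c * l + 1)%N by rewrite -Ac subnK.
exists (eta * c%:R); first exact: ZRM.
have -> : Q = (m * (l.-1 * j)).+1.
  by rewrite -(prednK (ltnW Q_gt1)) Qj mulnC mulnA.
rewrite exprS exprM etam -natrX -/A AE natrD natrM; ring.
Qed.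

(** The elements of Z[eta] fixed modulo l by the Q-th power map. They form a ring by the binomial
    theorem modulo l, and eta is one of them, so they are all of Z[eta]. *)
Let T x := ZR x /\ exists2 z, ZR z & x ^+ Q = x + l%:R * z.

Let TD x y : T x -> T y -> T (x + y).
Proof.
move=> [Zx [z Zz xz]] [Zy [t Zt yt]]; split; first exact: ZRD.
have [u Zu ->] := frob k Zx Zy; exists (z + t + u); first by do 2?apply: ZRD.
by rewrite -/Q xz yt; ring.
Qed.

Let TN x : T x -> T (- x).
Proof.
move=> [Zx [z Zz xz]]; split; first exact: ZRN.
have [u Zu] := frob k Zx (ZRN Zx); rewrite -/Q subrr expr0n.
rewrite eqn0Ngt (ltnW Q_gt1) /= xz => E; exists (- z - u).
  by apply: ZRD; apply: ZRN.
have -> : (- x) ^+ Q = (x + l%:R * z + (- x) ^+ Q + l%:R * u) - x - l%:R * z - l%:R * u by ring.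
by rewrite -E; ring.
Qed.

Let TM x y : T x -> T y -> T (x * y).
Proof.
move=> [Zx [z Zz xz]] [Zy [t Zt yt]]; split; first exact: ZRM.
exists (x * t + z * y + l%:R * z * t).
  by do 2?apply: ZRD; do 2?apply: ZRM.
by rewrite exprMn xz yt; ring.
Qed.

Let T1 : T 1. Proof. by split=> //; exists 0; rewrite ?expr1n ?mulr0 ?addr0. Qed.

Let TZR x : ZR x -> T x.
Proof.
have T0 : T 0 by rewrite -(subrr 1); apply: TD => //; apply: TN.
have Tn n : T n%:R by elim: n => // n IH; rewrite mulrS; apply: TD.
have Ti (n : int) : T n%:~R.
  by case: n => n; rewrite ?NegzE ?rmorphN; [|apply: TN]; apply: Tn.
have Teta : T eta by split=> //; apply: frob_eta.
move=> [g ->]; elim/poly_ind: g => [|g c IH]; first by rewrite rmorph0 horner0.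
rewrite rmorphD rmorphM /= map_polyX map_polyC hornerD hornerMX hornerC.
by apply: TD; [apply: TM|apply: Ti].
Qed.

Lemma vunit_eta : vunit O eta.
Proof. by apply: (vunit_pow V m_gt0); rewrite etam; apply: (vunit_nat l_prime V). Qed.

Let ZR_O x : ZR x -> O x.
Proof.
move=> [g ->]; rewrite horner_coef; apply: (vrsum V) => i _.
rewrite coef_map; apply: (vrM V); first exact: vrint V _.
by apply: (vrX V); have [] := vunit_eta.
Qed.

(** This is unramifiedness: x^Q = x + l z reads x (1 - x^(Q-1)) = - l z, and the second factor is a
    unit as soon as x is in the maximal ideal. *)
Let ZR_M x : ZR x -> vM O x -> exists y u, [/\ ZR y, vunit O u & x = l%:R * y * u].
Proof.
move=> Zx Mx; have [_ [z Zz xz]] := TZR Zx.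
have uu : vunit O (1 - x ^+ Q.-1).
  apply: (vunitD V (vunit1 V)); apply: (vMN V).
  have [q qE] : exists q, Q.-1 = q.+1 by case: (Q) Q_gt1 => [|[|q]]//; exists q.
  by rewrite qE exprS; apply: (vMM V) => //; apply/(vrX V)/(vM_O V).
exists (- z), (1 - x ^+ Q.-1)^-1; split; first exact: ZRN.
  exact: vunitV.
have u0 : 1 - x ^+ Q.-1 != 0 by case: uu.
apply: (canRL (mulfK u0)); rewrite mulrBr mulr1 -exprS prednK ?(ltnW Q_gt1)// xz; ring.
Qed.

(** Descent on the nonzero integer c = x z: each factor l split off from x is also split off from c,
    whose absolute value decreases. *)
Let unram_int n x z (c : int) : (`|c| <= n)%N -> c != 0 -> ZR x -> O z ->
  x * z = c%:~R -> exists k : nat, vunit O (x / l%:R ^+ k).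
Proof.
elim: n x z c => [|n IH] x z c cn c0 Zx Oz xz.
  by move: cn c0; rewrite leqn0 absz_eq0 => ->.
case: (vunitP (ZR_O Zx)) => [ux|Mx]; first by exists 0%N; rewrite expr0 divr1.
have [y [u [Zy uu xE]]] := ZR_M Zx Mx.
have Mc : vM O (c%:~R : F) by rewrite -xz; apply: (vMM V).
have [c' cE] := vM_int l_prime V Mc.
have l0 : (l%:R : F) != 0 by rewrite pnatr_eq0 -lt0n prime_gt0.
have [j uj] : exists k : nat, vunit O (y / l%:R ^+ k).
  apply: (IH y (u * z) c') => //.
  - have := prime_gt1 l_prime; move: c0 cn; rewrite cE abszM /= mulf_eq0.
    by rewrite -absz_eq0; nia.
  - by move: c0; rewrite cE mulf_eq0 negb_or => /andP[].
  - by apply: (vrM V) => //; case: uu.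
  - apply: (mulfI l0); transitivity (x * z); first by rewrite xE; ring.
    by rewrite xz cE intrM mulrC.
exists j.+1; have -> : x / l%:R ^+ j.+1 = y / l%:R ^+ j * u.
  by rewrite xE exprS; field; rewrite l0 expf_neq0.
exact: (vunitM V).
Qed.

(** The inverse of g(eta) inside Q(eta) provides, once denominators are cleared, the integer
    multiple on which the descent runs. *)
Lemma unramified (g : {poly rat}) : evalQ g eta != 0 ->
  exists j : int, vunit O (evalQ g eta / l%:R ^ j).
Proof.
move=> g0.
have l0 : (l%:R : F) != 0 by rewrite pnatr_eq0 -lt0n prime_gt0.
have Tm0 : ('X^m - (N%:R)%:P : {poly rat}) != 0.
  by rewrite -size_poly_gt0 size_XnsubC.
have Tm : evalQ ('X^m - (N%:R)%:P) eta = 0.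
  by rewrite evalQB evalQXn evalQC etam rmorph_nat subrr.
have [h hg] := evalQ_inv Tm0 Tm g0.
have [q [a [a0 qE]]] := evalQ_int g eta; have [q' [a' [a'0 q'E]]] := evalQ_int h eta.
have aF0 : (a%:~R : F) != 0 by rewrite intr_eq0.
have a'F0 : (a'%:~R : F) != 0 by rewrite intr_eq0.
set x := (map_poly intr q).[eta] in qE; set z := (map_poly intr q').[eta] in q'E.
have Zx : ZR x by exists q. have Zz : ZR z by exists q'.
have xz : x * z = (a * a')%:~R.
  transitivity (a%:~R * a'%:~R * (a'%:~R^-1 * z * (a%:~R^-1 * x))).
    by field; rewrite aF0.
  by rewrite -qE -q'E hg mulr1 intrM.
have [j uj] := unram_int (leqnn _) (mulf_neq0 a0 a'0) Zx (ZR_O Zz) xz.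
have [i ui] : exists i : nat, vunit O (a%:~R / l%:R ^+ i).
  apply: (@unram_int `|a|%N a%:~R 1 a) => //; rewrite ?mulr1//; last exact: vr1 V.
  by exists a%:P; rewrite map_polyC hornerC.
exists (j%:Z - i%:Z).
have -> : evalQ g eta / l%:R ^ (j%:Z - i%:Z) = (x / l%:R ^+ j) / (a%:~R / l%:R ^+ i).
  rewrite qE expfzDr// -invr_expz -!exprnP; field.
  by rewrite aF0 !expf_neq0.
by apply: (vunitM V) => //; apply: vunitV.
Qed.

End Unramified.

(** * Exponent classes modulo d and the ramified places *)

(* The t-th component of f modulo d: f = sum_(t < d) X^t * C_t(X^d). *)
Definition polycomp (K : nzRingType) (d t : nat) (f : {poly K}) : {poly K} :=
  \poly_(s < size f) f`_(t + s * d).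

Lemma coef_polycomp (K : nzRingType) d t (f : {poly K}) s :
  (0 < d)%N -> (polycomp d t f)`_s = f`_(t + s * d).
Proof.
move=> d_gt0; rewrite coef_poly; case: ltnP => // le; rewrite nth_default//.
by rewrite (leq_trans le)// (leq_trans (leq_pmulr s d_gt0))// leq_addl.
Qed.

Lemma polycompE (K : comNzRingType) d (f : {poly K}) : (0 < d)%N ->
  f = \sum_(t < d) 'X^t * (polycomp d t f \Po 'X^d).
Proof.
move=> d_gt0; apply/polyP => i; rewrite coef_sum.
rewrite (bigD1 (Ordinal (ltn_pmod i d_gt0)))//= coefXnM ltnNge leq_mod /=.
have iE : (i - i %% d)%N = (i %/ d * d)%N by rewrite {1}(divn_eq i d) addnK.
rewrite coef_comp_poly_Xn // iE dvdn_mull// mulnK//.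
rewrite coef_polycomp// addnC -divn_eq big1 ?addr0// => t ti.
rewrite coefXnM; case: ltnP => // le_ti; rewrite coef_comp_poly_Xn//; case: ifPn => // dv.
case/negP: ti; apply/eqP/val_inj => /=.
have := dv; rewrite -eqn_mod_dvd// => /eqP ->.
by rewrite modn_small.
Qed.

Section Local.
Variables (F : numFieldType) (l : nat) (O : set F).
Hypotheses (l_prime : prime l) (V : valring l O).
Variables (d m t N : nat) (lam pi : F).
Hypotheses (d_gt0 : (0 < d)%N) (m_gt0 : (0 < m)%N) (pi_neq0 : pi != 0).
Hypotheses (etam : (t%:R * pi ^+ d / l%:R) ^+ m = N%:R).
Hypotheses (lt : coprime l t) (lN : coprime l N) (lm : coprime l m).
Hypothesis lamE : lam = pi \/ lam = pi^-1.
Implicit Types f : {poly rat}.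

(** pi^d is l times the unit eta / t, and l is unramified in Q(eta); hence l has value d in units of
    [pi]. The case [lam] = pi^-1 is the one where l divides the denominator of lam^d. *)
Let eta : F := t%:R * pi ^+ d / l%:R.
Let l_neq0 : (l%:R : F) != 0. Proof. by rewrite pnatr_eq0 -lt0n prime_gt0. Qed.
Let ut := vunit_nat l_prime V lt.
Let t_neq0 : (t%:R : F) != 0. Proof. by case: ut. Qed.
Let ueta : vunit O eta. Proof. exact: (vunit_eta l_prime V m_gt0 etam lN). Qed.
Let eta_neq0 : eta != 0. Proof. by case: ueta. Qed.

Let pidE : pi ^+ d = l%:R * eta / t%:R.
Proof. by rewrite /eta; field; rewrite ?l_neq0 ?t_neq0. Qed.

Let Mpi : vM O pi.
Proof.
have Mpid : vM O (pi ^+ d).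
  rewrite pidE -mulrA; apply: (vMM V (vM_l V)).
  by apply: (vrM V); [case: ueta|case: ut].
right=> Opi; case: Mpid => [/eqP|]; first by rewrite expf_eq0 (negPf pi_neq0) andbF.
by apply; rewrite -exprVn; apply: (vrX V).
Qed.

Let vval_l : vval O pi l%:R d.
Proof.
rewrite /vval -exprnP; have -> : l%:R / pi ^+ d = t%:R / eta.
  by rewrite pidE; field; rewrite ?l_neq0 ?t_neq0 ?eta_neq0.
by apply: (vunitM V) => //; apply: vunitV.
Qed.

Let vval_lX (k : int) : vval O pi (l%:R ^ k) (d%:Z * k).
Proof.
have u (n : nat) : vunit O (l%:R ^+ n / pi ^+ (d * n)).
  have := vunitX V n vval_l; rewrite -exprnP.
  by rewrite expr_div_n exprM.
rewrite /vval; case: k => n.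
  by rewrite -PoszM -!exprnP; apply: u.
rewrite NegzE mulrN -PoszM -!invr_expz -!exprnP -invfM.
by apply: vunitV.
Qed.

Let lamd_eta : exists G, lam ^+ d = evalQ G eta.
Proof.
case: lamE => ->.
  exists ((l%:R / t%:R) *: 'X); rewrite evalQZ evalQX pidE.
  by rewrite rmorphM fmorphV /= !rmorph_nat; ring.
have N_neq0 : (N%:R : F) != 0 by case: (vunit_nat l_prime V lN).
(* pi^-d = t / (l eta), and eta^-1 = eta^(m-1) / N. *)
exists ((t%:R / (l%:R * N%:R)) *: 'X^(m.-1)); rewrite evalQZ evalQXn.
rewrite rmorphM fmorphV /= rmorphM /= !rmorph_nat exprVn pidE -etam -/eta.
rewrite -(prednK m_gt0) exprS /=; field.
by rewrite eta_neq0 expf_neq0 ?eta_neq0 ?l_neq0.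
Qed.

(** lam^d lies in Q(eta), where every value is an integer multiple of that of l, which is d. *)
Let vval_comp f : evalQ f (lam ^+ d) != 0 ->
  exists k : int, vval O pi (evalQ f (lam ^+ d)) (d%:Z * k).
Proof.
case: lamd_eta => G ->; rewrite -evalQ_comp => f0.
have [k uk] := unramified l_prime V m_gt0 etam lN lm f0.
exists k; rewrite /vval.
have -> : evalQ (f \Po G) eta / pi ^ (d%:Z * k) =
    (evalQ (f \Po G) eta / l%:R ^ k) * (l%:R ^ k / pi ^ (d%:Z * k)).
  by field; rewrite !expfz_neq0.
by apply: (vunitM V) => //; apply: vval_lX.
Qed.

Let sgn : int := if pselect (lam = pi) then 1 else -1.
Let sgnE : sgn = 1 \/ sgn = -1.
Proof. by rewrite /sgn; case: pselect; [left|right]. Qed.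
Let lam_pi : lam = pi ^ sgn.
Proof. by rewrite /sgn; case: pselect => // h; case: lamE. Qed.

Let lam_neq0 : lam != 0. Proof. by rewrite lam_pi expfz_neq0. Qed.

Let term f (i : 'I_d) : F := lam ^+ i * evalQ (polycomp d i f) (lam ^+ d).

Let termE f w : w ^+ d = 1 -> evalQ f (w * lam) = \sum_(i < d) w ^+ i * term f i.
Proof.
move=> wd; rewrite {1}(polycompE f d_gt0) evalQ_sum; apply: eq_bigr => i _.
by rewrite evalQM evalQ_comp !evalQXn !exprMn wd mul1r mulrA.
Qed.

Let term_val f : exists k : 'I_d -> int,
  forall i, term f i != 0 -> vval O pi (term f i) (sgn * i%:Z + d%:Z * k i).
Proof.
suff h i : exists k : int, term f i != 0 -> vval O pi (term f i) (sgn * i%:Z + d%:Z * k).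
  by have [k hk] := choice h; exists k.
case: (eqVneq (term f i) 0) => [_|ti]; first by exists 0.
have := ti; rewrite mulf_eq0 negb_or => /andP[_ c0].
have [k vk] := vval_comp c0; exists k => _; apply: (vvalM V) => //.
rewrite /vval lam_pi exprnP exprz_exp divff ?expfz_neq0//.
exact: vunit1 V.
Qed.

(** Modulo d the exponent is i up to the fixed sign, and 0 <= i < d. *)
Let exp_inj (k : 'I_d -> int) (i j : 'I_d) : i != j ->
  sgn * i%:Z + d%:Z * k i != sgn * j%:Z + d%:Z * k j.
Proof.
move=> ij; apply/eqP => E; move/negP: ij; apply; apply/eqP/val_inj => /=.
have := ltn_ord i; have := ltn_ord j; move: E.
case: sgnE => ->; case: (ltgtP (k i) (k j)) => [kij|kij|->]; nia.
Qed.

Let exp_neq0 (k : 'I_d -> int) (i : 'I_d) : (val i != 0)%N -> sgn * i%:Z + d%:Z * k i != 0.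
Proof.
move=> ij; apply/eqP => E; have := ltn_ord i; move: E ij; rewrite /=.
by case: sgnE => ->; case: (ltgtP (k i) 0) => [kij|kij|->]; nia.
Qed.

Let vunit_root1 w i : w ^+ d = 1 -> vunit O (w ^+ i).
Proof.
move=> wd; apply: (vunitX V); apply: (vunit_pow V d_gt0); rewrite wd.
exact: vunit1 V.
Qed.

(** The terms of the two conjugates differ by the units w1^i and w2^i, so both conjugates have the
    same least exponent e. If e >= 0, the term i = 0 cancels in the difference, and the remaining
    exponents are nonnegative and not divisible by d, hence at least 1. If e < 0, the product of the
    [mu] has value 2 e and the difference at least e, so the quotient has at least - e >= 1. *)
Lemma local_sub_dvd f w1 w2 : w1 ^+ d = 1 -> w2 ^+ d = 1 ->
  let a1 := evalQ f (w1 * lam) in let a2 := evalQ f (w2 * lam) in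
  O ((a1 - a2) / (mu O a1 * mu O a2) / pi).
Proof.
move=> w1d w2d a1 a2; have [k vk] := term_val f.
pose e (i : 'I_d) := sgn * i%:Z + d%:Z * k i.
case: (pselect (exists i, term f i != 0)) => [ex|nex]; last first.
  have t0 i : term f i = 0 by apply: contrapT => /eqP ti; apply: nex; exists i.
  rewrite /a1 /a2 !termE// !big1 ?subrr ?mul0r; first exact: vr0 V.
    by move=> i _; rewrite t0 mulr0.
  by move=> i _; rewrite t0 mulr0.
have main w : w ^+ d = 1 -> exists i0, [/\ term f i0 != 0,
    forall j, term f j != 0 -> e i0 <= e j & vval O pi (evalQ f (w * lam)) (e i0)].
  move=> wd; rewrite termE//.
  have wn0 i : w ^+ i != 0 by case: (vunit_root1 i wd).
  have [|||i [ti hi vi]] := vval_sum V pi_neq0 Mpi (x := fun i : 'I_d => w ^+ i * term f i) (e := e).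
  - move=> i; rewrite mulf_eq0 (negPf (wn0 _)) /= => /vk vi.
    rewrite /vval -mulrA; apply: (vunitM V) => //; exact: vunit_root1.
  - by move=> i j _ _; apply: exp_inj.
  - by case: ex => i ti; exists i; rewrite mulf_eq0 (negPf (wn0 _)).
  exists i; split=> //.
    by move: ti; rewrite mulf_eq0 (negPf (wn0 _)).
  by move=> j tj; apply: hi; rewrite mulf_eq0 (negPf (wn0 _)).
have [i1 [ti1 h1 v1]] := main _ w1d; have [i2 [ti2 h2 v2]] := main _ w2d.
have e12 : e i1 = e i2 by apply/le_anti; rewrite h1// h2.
have subE : a1 - a2 = \sum_(i < d) (w1 ^+ i - w2 ^+ i) * term f i.
  by rewrite /a1 /a2 !termE// -sumrB; apply: eq_bigr => i _; rewrite mulrBl.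
have Ow i : O (w1 ^+ i - w2 ^+ i).
  apply: (vrB V); [have [] := vunit_root1 i w1d|have [] := vunit_root1 i w2d]; by [].
have Osub (n : int) : (forall i, term f i != 0 -> w1 ^+ i - w2 ^+ i != 0 -> n <= e i) ->
    O ((a1 - a2) / pi ^ n).
  move=> hn; rewrite subE mulr_suml; apply: (vrsum V) => i _.
  have [->|ti] := eqVneq (term f i) 0; first by rewrite mulr0 mul0r; apply: vr0 V.
  have [->|wi] := eqVneq (w1 ^+ i - w2 ^+ i) 0; first by rewrite !mul0r; apply: vr0 V.
  rewrite -mulrA; apply: (vrM V) => //.
  exact: (vval_O V pi_neq0 Mpi (vk _ ti) (hn _ ti wi)).
case: (leP 0 (e i1)) => e0.
  have Oa1 : O a1 by have := vval_O V pi_neq0 Mpi v1 e0; rewrite expr0z divr1.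
  have Oa2 : O a2.
    by have := vval_O V pi_neq0 Mpi v2; rewrite -e12 => /(_ _ e0); rewrite expr0z divr1.
  rewrite /mu !asboolT// mulr1 divr1 -[pi]expr1z; apply: Osub => i ti wi.
  rewrite -gtz0_ge1 lt_neqAle (le_trans e0)/= ?h1// andbT eq_sym.
  apply: exp_neq0; apply: contraNneq wi => ->.
  by rewrite !expr0 subrr.
have nOa1 : ~ O a1 := vval_nO V pi_neq0 Mpi v1 e0.
have nOa2 : ~ O a2 by apply: (vval_nO V pi_neq0 Mpi v2); rewrite -e12.
have a10 := vval_neq0 v1; have a20 := vval_neq0 v2.
rewrite /mu !asboolF//.
have -> : (a1 - a2) / (a1 * a2) / pi =
  ((a1 - a2) / pi ^ e i1) * (a1 / pi ^ e i1)^-1 * (a2 / pi ^ e i1)^-1 / pi ^ (e i1 + 1).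
  move: (e i1) => E; rewrite expfzDr// expr1z; field.
  by rewrite a10 a20 pi_neq0 expfz_neq0.
apply: (vrM V); last first.
  have v10 : vval O pi 1 0 by rewrite /vval expr0z divr1; apply: vunit1 V.
  have := vval_O V pi_neq0 Mpi v10 (_ : e i1 + 1 <= 0).
  by rewrite lezD1 mul1r; apply.
apply: (vrM V); last by rewrite e12; case: v2.
apply: (vrM V); last by case: v1.
by apply: Osub => i ti _; apply: h1.
Qed.

(* Some nonzero component survives since 1 - w^i is a unit for 0 < i < d. *)
Lemma local_sub_neq0 f w1 w2 : prime d -> coprime l d -> w1 ^+ d = 1 -> w2 ^+ d = 1 ->
  w1 != w2 -> (exists i : 'I_d, val i != 0%N /\ evalQ (polycomp d i f) (lam ^+ d) != 0) ->
  evalQ f (w1 * lam) != evalQ f (w2 * lam).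
Proof.
move=> d_prime ld w1d w2d w12 [i1 [i10 ci1]]; have [k vk] := term_val f.
pose e (i : 'I_d) := sgn * i%:Z + d%:Z * k i.
have uw i : (0 < i < d)%N -> vunit O (w1 ^+ i - w2 ^+ i).
  move=> /andP[i_gt0 i_lt].
  have w20 : w2 != 0 by apply: contra_eq_neq w2d => ->; rewrite expr0n gtn_eqF ?oner_neq0// eq_sym oner_neq0.
  pose w := (w1 / w2) ^+ i.
  have wd : w ^+ d = 1 by rewrite /w exprAC expr_div_n w1d w2d divr1 expr1n.
  have w1' : w != 1.
    apply/negP => /eqP wi1; case/negP: w12; rewrite -subr_eq0.
    have cop : coprime i d by rewrite coprime_sym prime_coprime// gtnNdvd.
    have [u v uv _] := egcdnP d i_gt0; rewrite (eqP cop) in uv.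
    have : (w1 / w2) ^+ (u * i) = w1 / w2.
      by rewrite uv exprD expr1 mulnC exprM expr_div_n w1d w2d divr1 expr1n mul1r.
    rewrite mulnC exprM -/w wi1 expr1n => /(congr1 ( *%R^~ w2)).
    by rewrite mul1r mulfVK// => ->; rewrite subrr.
  have Ow : O w by case: (vunit_root1 1 wd).
  have s0 : \sum_(j < d) w ^+ j = 0.
    have := subrX1 w d; rewrite wd subrr => /esym/eqP; rewrite mulf_eq0 subr_eq0.
    by rewrite (negPf w1') /= => /eqP.
  (* Since 1 + w + ... + w^(d-1) = 0, the number d is the sum of the 1 - w^j, all multiples of w -
     1. As d is a unit at l, so is w - 1. *)
  have [z Oz dz] : exists2 z, O z & d%:R = (w - 1) * z.
    exists (- \sum_(j < d) \sum_(j' < j) w ^+ j').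
      by apply/(vrN V)/(vrsum V) => j _; apply: (vrsum V) => j' _; apply: (vrX V).
    rewrite mulrN mulr_sumr; under eq_bigr => j _ do rewrite -subrX1.
    by rewrite sumrB s0 sub0r opprK sumr_const card_ord.
  have [d0 _ Od] := vunit_nat l_prime V ld.
  have uw1 : vunit O (w - 1).
    split; first by rewrite subr_eq0.
      by apply: (vrB V) => //; apply: vr1 V.
    have -> : (w - 1)^-1 = z / d%:R; last exact: (vrM V).
    have : (w - 1) * z != 0 by rewrite -dz.
    rewrite mulf_eq0 negb_or => /andP[w10 z0].
    by apply: (mulfI w10); rewrite divff// mulrA -dz divff.
  have -> : w1 ^+ i - w2 ^+ i = w2 ^+ i * (w - 1).
    by rewrite mulrBr mulr1 /w -exprMn mulrC mulfVK.
  by apply: (vunitM V) => //; apply: vunit_root1.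
rewrite -subr_eq0 !termE// -sumrB.
pose x (i : 'I_d) := w1 ^+ i * term f i - w2 ^+ i * term f i.
have xE i : x i = (w1 ^+ i - w2 ^+ i) * term f i by rewrite /x mulrBl.
have x_term i : x i != 0 -> val i != 0%N /\ term f i != 0.
  rewrite xE mulf_eq0 negb_or => /andP[wi ti]; split=> //.
  by apply: contraNneq wi => ->; rewrite !expr0 subrr.
have [|||i0 [_ _ /vval_neq0]//] := vval_sum V pi_neq0 Mpi (x := x) (e := e).
- move=> i /x_term [i0 ti]; rewrite xE /vval -mulrA; apply: (vunitM V); last exact: vk.
  by apply: uw; rewrite lt0n i0 ltn_ord.
- by move=> i j _ _; apply: exp_inj.
- exists i1; rewrite xE !mulf_neq0 ?expf_neq0//.
  by case: (uw i1) => //; rewrite lt0n i10 ltn_ord.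
Qed.

End Local.

(** * Conjugates and products over the roots of X^D - r *)

(* Multiplication by f on Q[X]/(P) is diagonalised by the Vandermonde matrix of
   the roots of P, with eigenvalues f(lam k). *)
Lemma conj_charpoly (F : numFieldType) (D : nat) (P f : {poly rat}) (lam : 'I_D -> F) :
  size P = D.+1 -> injective lam -> (forall k, evalQ P (lam k) = 0) ->
  exists chi : {poly rat},
    map_poly ratr chi = \prod_(k < D) ('X - (evalQ f (lam k))%:P).
Proof.
move=> sP inj Plam; have P0 : P != 0 by rewrite -size_poly_gt0 sP.
pose A : 'M[rat]_D := \matrix_(i, j) (('X^i * f) %% P)`_j.
pose a : 'rV[F]_D := \row_k lam k.
pose Vm := Vandermonde D a.
pose Dg : 'M[F]_D := diag_mx (\row_k evalQ f (lam k)).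
have AV : map_mx ratr A *m Vm = Vm *m Dg.
  apply/matrixP => i k; rewrite mul_mx_diag !mxE -evalQXn -evalQM.
  rewrite (divp_eq ('X^i * f) P) evalQD evalQM Plam mulr0 add0r.
  rewrite [in RHS]/evalQ (@horner_coef_wide _ D) ?size_map_poly; last first.
    by rewrite -ltnS -sP ltn_modp.
  by apply: eq_bigr => j _; rewrite !mxE coef_map.
have dV : \det Vm != 0.
  rewrite det_Vandermonde; apply/prodf_neq0 => i _; apply/prodf_neq0 => j ij.
  rewrite !mxE subr_eq0; apply/eqP => /inj ji; by rewrite ji ltnn in ij.
exists (char_poly A); rewrite map_char_poly.
have -> : char_poly (map_mx ratr A) = char_poly Dg.
  have cV : \det (map_mx polyC Vm) != 0 by rewrite det_map_mx polyC_eq0.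
  apply: (mulIf cV); rewrite /char_poly -det_mulmx [RHS]mulrC -det_mulmx; congr (\det _).
  rewrite /char_poly_mx mulmxBl mulmxBr -!map_mxM AV; congr (_ - _).
  by rewrite scalar_mxC.
rewrite char_poly_trig ?diag_mx_is_trig//.
by apply: eq_bigr => k _; rewrite !mxE eqxx mulr1n.
Qed.

Lemma conj_norm (F : numFieldType) (D : nat) (P f : {poly rat}) (lam : 'I_D -> F) :
  size P = D.+1 -> injective lam -> (forall k, evalQ P (lam k) = 0) ->
  exists x : rat, ratr x = \prod_(k < D) evalQ f (lam k).
Proof.
move=> sP inj Plam; have [chi chiE] := conj_charpoly f sP inj Plam.
exists ((-1) ^+ D * chi.[0]); have := congr1 (horner^~ 0) chiE.
rewrite /= horner_prod -[0 in LHS](rmorph0 (ratr : rat -> F)) horner_map /= => E.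
rewrite rmorphM /= E rmorph_sign.
have -> : (-1) ^+ D = \prod_(k < D) (-1 : F) by rewrite prodr_const card_ord.
rewrite -big_split /=; apply: eq_bigr => k _.
by rewrite hornerXsubC sub0r mulN1r opprK.
Qed.

Lemma roots_XnsubC (C : numClosedFieldType) (D : nat) (r : C) : (0 < D)%N -> r != 0 ->
  exists lam : 'I_D -> C, [/\ injective lam, forall k, lam k ^+ D = r
    & forall z, z ^+ D = r -> exists k, z = lam k].
Proof.
move=> D_gt0 r0; have [rs] := closed_field_poly_normal ('X^D - r%:P).
rewrite lead_coefXnsubC// scale1r => E.
have srs : size rs = D.
  by apply/eq_add_S; rewrite -(size_XnsubC r D_gt0) E size_prod_XsubC.
have urs : uniq rs.
  rewrite -separable_prod_XsubC -E unlock.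
  apply/Bezout_coprimepP; exists (D%:R, - 'X) => /=.
  rewrite derivB derivXn derivC subr0.
  have XD : 'X^D = 'X * 'X^(D.-1) :> {poly C} by rewrite -exprS prednK.
  have -> : D%:R * ('X^D - r%:P) + - 'X * ('X^(D.-1) *+ D) = (- (D%:R * r))%:P :> {poly C}.
    by rewrite XD polyCN polyCM polyC_natr -mulr_natr; ring.
  by rewrite polyC_eqp1 oppr_eq0 mulf_neq0// pnatr_eq0 -lt0n.
have rsP z : (z \in rs) = (z ^+ D == r).
  by rewrite -root_prod_XsubC -E rootE hornerD hornerN hornerC hornerXn subr_eq0.
exists (fun k => rs`_k); split.
- move=> i j /eqP; rewrite nth_uniq ?srs ?ltn_ord// => /eqP; exact: val_inj.
- by move=> k; apply/eqP; rewrite -rsP mem_nth ?srs.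
- move=> z zD; have zrs : z \in rs by rewrite rsP zD.
  by move: (zrs); rewrite -index_mem srs => h; exists (Ordinal h); rewrite nth_index.
Qed.

Lemma prod_roots_mul (C : numClosedFieldType) (D : nat) (r w : C) (lam : 'I_D -> C)
    (T : comNzRingType) (G : C -> T) : (0 < D)%N ->
  injective lam -> (forall k, lam k ^+ D = r) ->
  (forall z, z ^+ D = r -> exists k, z = lam k) -> w ^+ D = 1 ->
  \prod_k G (w * lam k) = \prod_k G (lam k).
Proof.
move=> D_gt0 inj lamr surj wD.
have w0 : w != 0.
  apply: contra_eq_neq wD => ->; rewrite expr0n gtn_eqF// eq_sym; exact: oner_neq0.
have /choice[h hE] k : exists j, w * lam k = lam j.
  by apply: surj; rewrite exprMn wD lamr mul1r.
have injh : injective h.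
  by move=> i j hij; apply/inj/(mulfI w0); rewrite !hE hij.
by rewrite [RHS](reindex_inj injh) /=; apply: eq_bigr => k _; rewrite hE.
Qed.

(** Every index lies in d - 1 of the pairs. *)
Lemma prod_pairs (T : comNzRingType) (G : nat -> T) (d : nat) :
  \prod_(i < d) \prod_(j < d | (i < j)%N) (G i * G j) = (\prod_(i < d) G i) ^+ d.-1.
Proof.
elim: d => [|d IH]; first by rewrite !big_ord0.
rewrite big_ord_recr /= [X in _ * X]big1 ?mulr1; last first.
  by move=> j; rewrite ltnNge -ltnS ltn_ord.
transitivity (\prod_(i < d) ((\prod_(j < d | (i < j)%N) (G i * G j)) * (G i * G d))).
  by apply: eq_bigr => i _; rewrite big_mkcond big_ord_recr /= -big_mkcond /= ltn_ord.
rewrite big_split /= IH big_split /= prodr_const card_ord big_ord_recr /=.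
by rewrite exprMn mulrA -exprSr; case: d {IH} => [|d]; rewrite ?big_ord0 ?expr1n.
Qed.

(** * Relative discriminants *)

(** The s-th power sum of the f(w^j X) for a primitive d-th root of unity w: summing over j
    annihilates every component of f^s except the 0-th, which is multiplied by d. In this form it
    visibly has rational coefficients. *)
Definition psum (d s : nat) (f : {poly rat}) : {poly rat} :=
  d%:R *: (polycomp d 0 (f ^+ s) \Po 'X^d).

(* disc of the relative conjugates f(w^j X), j < d, as the determinant of the
   matrix of their power sums. *)
Definition reldisc (d : nat) (f : {poly rat}) : {poly rat} :=
  \det (\matrix_(i < d, j < d) psum d (i + j) f).

Lemma evalQ_psum (F : numFieldType) d s f (w x : F) : (0 < d)%N -> d.-primitive_root w ->
  evalQ (psum d s f) x = \sum_(j < d) evalQ f (w ^+ j * x) ^+ s.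
Proof.
move=> d_gt0 wd; set g := f ^+ s.
pose T (t : 'I_d) : F := x ^+ t * evalQ (polycomp d t g) (x ^+ d).
have E (j : 'I_d) : evalQ f (w ^+ j * x) ^+ s = \sum_(t < d) (w ^+ t) ^+ j * T t.
  rewrite -evalQ_exp -/g {1}(polycompE g d_gt0) evalQ_sum; apply: eq_bigr => t _.
  rewrite evalQM evalQ_comp !evalQXn !exprMn.
  have -> : (w ^+ j) ^+ d = 1 by rewrite exprAC (prim_expr_order wd) expr1n.
  by rewrite mul1r exprAC mulrA.
rewrite (eq_bigr _ (fun j _ => E j)) exchange_big /= (bigD1 (Ordinal d_gt0))//= [X in _ + X]big1 ?addr0; last first.
  move=> t t0; rewrite -mulr_suml.
  have wt : w ^+ t != 1.
    rewrite -(prim_order_dvd wd) gtnNdvd// lt0n.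
    by apply: contraNneq t0 => h; apply/eqP/val_inj.
  have := subrX1 (w ^+ t) d; rewrite exprAC (prim_expr_order wd) expr1n subrr.
  by move=> /esym/eqP; rewrite mulf_eq0 subr_eq0 (negPf wt) /= => /eqP ->; rewrite mul0r.
rewrite -mulr_suml; under eq_bigr do rewrite expr0 expr1n.
by rewrite sumr_const card_ord evalQZ evalQ_comp evalQXn rmorph_nat /T /= expr0 mul1r.
Qed.

Lemma evalQ_reldisc (F : numFieldType) d f (w x : F) : (0 < d)%N -> d.-primitive_root w ->
  evalQ (reldisc d f) x =
  (\det (Vandermonde d (\row_(j < d) evalQ f (w ^+ j * x)))) ^+ 2.
Proof.
move=> d_gt0 wd.
rewrite /reldisc /evalQ -det_map_mx -[_.[_]]/(horner_eval x _) -det_map_mx.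
rewrite expr2 -[X in _ = _ * X]det_tr -det_mulmx; congr (\det _).
apply/matrixP => i j; rewrite !mxE -[LHS]/(evalQ _ x) (evalQ_psum _ _ _ d_gt0 wd).
by apply: eq_bigr => k _; rewrite !mxE exprD.
Qed.

Lemma evalQ_reldiscE (F : numFieldType) d f (w x : F) : (0 < d)%N -> d.-primitive_root w ->
  evalQ (reldisc d f) x = (\prod_(i < d) \prod_(j < d | (i < j)%N)
     (evalQ f (w ^+ j * x) - evalQ f (w ^+ i * x))) ^+ 2.
Proof.
move=> d_gt0 wd; rewrite (evalQ_reldisc _ _ d_gt0 wd) det_Vandermonde.
by congr (_ ^+ 2); apply: eq_bigr => i _; apply: eq_bigr => j _; rewrite !mxE.
Qed.

Section LocalDisc.
Variables (F : numFieldType) (l : nat) (O : set F).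
Hypotheses (l_prime : prime l) (V : valring l O).
Variables (d : nat) (w x : F) (f : {poly rat}).
Hypotheses (d_gt0 : (0 < d)%N) (wd : d.-primitive_root w).
Let y j := evalQ f (w ^+ j * x).

(** In the squared product each conjugate occurs 2 (d - 1) times and there are d (d - 1) factors, so
    these powers of the [mu] and of c can be distributed over the single differences. *)
Let discE (c : F) : c != 0 ->
  evalQ (reldisc d f) x / (\prod_(j < d) mu O (y j)) ^+ (2 * d.-1) / c ^+ (d * d.-1) =
  (\prod_(i < d) \prod_(j < d | (i < j)%N) ((y j - y i) / (mu O (y j) * mu O (y i)) / c)) ^+ 2.
Proof.
move=> c0; rewrite (evalQ_reldiscE _ _ d_gt0 wd) mulnC !exprM.
have -> : c ^+ d = \prod_(i < d) c by rewrite prodr_const card_ord.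
rewrite -(prod_pairs (fun=> c)) -(prod_pairs (fun j => mu O (y j))) -!exprVn.
have -> : \prod_(i < d) \prod_(j < d | (i < j)%N) (c * c) =
  (\prod_(i < d) \prod_(j < d | (i < j)%N) c) ^+ 2.
  rewrite -prodrXl; apply: eq_bigr => i _; rewrite -prodrXl.
  by apply: eq_bigr => j _; rewrite expr2.
rewrite -[_^-1 in X in _ * _ * X]exprVn -!exprMn; congr (_ ^+ 2).
rewrite -!prodfV -!big_split /=; apply: eq_bigr => i _.
rewrite -!prodfV -!big_split /=; apply: eq_bigr => j _.
by rewrite [mu O (y i) * _]mulrC.
Qed.

Lemma vr_reldisc : O (evalQ (reldisc d f) x / (\prod_(j < d) mu O (y j)) ^+ (2 * d.-1)).
Proof.
have := discE (oner_neq0 _); rewrite expr1n divr1 => ->.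
apply: (vrX V); apply: (vrprod V) => i _; apply: (vrprod V) => j _.
by rewrite divr1; apply: (vr_sub_mu V).
Qed.

(** Each of the d (d - 1) differences gains a factor pi, and pi^d is l times a unit, so the
    discriminant gains l^(d-1). *)
Lemma vr_reldisc_ramified m t N pi : (0 < m)%N -> pi != 0 ->
  (t%:R * pi ^+ d / l%:R) ^+ m = N%:R -> coprime l t -> coprime l N -> coprime l m ->
  (x = pi \/ x = pi^-1) ->
  O (evalQ (reldisc d f) x / (\prod_(j < d) mu O (y j)) ^+ (2 * d.-1) / l%:R ^+ d.-1).
Proof.
move=> m_gt0 pi0 etam lt lN lm xE.
have ueta := vunit_eta l_prime V m_gt0 etam lN.
have ut := vunit_nat l_prime V lt; have t0 : (t%:R : F) != 0 by case: ut.
have l0 : (l%:R : F) != 0 by rewrite pnatr_eq0 -lt0n prime_gt0.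
have u : vunit O (pi ^+ d / l%:R).
  have -> : pi ^+ d / l%:R = (t%:R * pi ^+ d / l%:R) / t%:R by field; rewrite t0.
  by apply: (vunitM V) => //; apply: vunitV.
set A := (X in O (X / _)); have := discE pi0; rewrite -/A => AE.
have -> : A / l%:R ^+ d.-1 = A / pi ^+ (d * d.-1) * (pi ^+ d / l%:R) ^+ d.-1.
  by rewrite exprM expr_div_n; field; rewrite !expf_neq0.
apply: (vrM V); last by case: (vunitX V d.-1 u).
rewrite AE; apply: (vrX V); apply: (vrprod V) => i _; apply: (vrprod V) => j _.
apply: (local_sub_dvd l_prime V d_gt0 m_gt0 pi0 etam lt lN lm xE).
  by rewrite -exprM mulnC exprM (prim_expr_order wd) expr1n.
by rewrite -exprM mulnC exprM (prim_expr_order wd) expr1n.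
Qed.

End LocalDisc.

(** The substitute for the product formula. By Bezout the inverse of the denominator is an integral
    combination of x and 1, so a prime l dividing the denominator would put 1/l in the ring above
    l. *)
Lemma ratr_integral_ge1 (F : numFieldType) (x : rat) : x != 0 ->
  (forall l, prime l -> exists2 O : set F, valring l O & O (ratr x)) -> 1 <= `|x|.
Proof.
move=> x0 xint.
have dx : denq x = 1.
  apply/eqP/negPn/negP => d1.
  have d_gt1 : (1 < `|denq x|)%N.
    by rewrite ltn_neqAle absz_gt0 denq_neq0 andbT eq_sym -(eqr_nat int) natz absz_denq.
  have l_prime := pdiv_prime d_gt1; set l := pdiv _ in l_prime.
  have [A V Ox] := xint _ l_prime.
  have /dvdnP[e eE] : (l %| `|denq x|)%N := pdiv_dvd _.
  apply: (vrl V).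
  have [u [v uv]] := Bezoutz (numq x) (denq x).
  have cnd : gcdz (numq x) (denq x) = 1 by apply/eqP; rewrite -[_ == _]/(coprimez _ _) coprimezE coprime_num_den.
  rewrite cnd in uv.
  have dF : ((denq x)%:~R : F) != 0 by rewrite intr_eq0 denq_neq0.
  have Ode : A ((denq x)%:~R^-1 : F).
    have -> : ((denq x)%:~R^-1 : F) = u%:~R * ratr x + v%:~R.
      have -> : ratr x = (numq x)%:~R / (denq x)%:~R :> F by [].
      apply: (mulfI dF); rewrite divff//.
      transitivity ((u * numq x + v * denq x)%:~R : F); first by rewrite uv.
      by rewrite intrD !intrM; field.
    by apply: (vrD V); [apply: (vrM V) => //|]; apply: (vrint V).
  have -> : (l%:R^-1 : F) = e%:R * (denq x)%:~R^-1.
    have -> : ((denq x)%:~R : F) = (e * l)%:R by rewrite -eE -absz_denq.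
    rewrite natrM invfM mulrA divff ?mul1r// pnatr_eq0.
    by apply: contraTneq d_gt1 => e0; rewrite eE e0.
  by apply: (vrM V) => //; apply: (vrnat V).
have -> : x = (numq x)%:~R by rewrite -{1}[x]divq_num_den dx divr1.
rewrite -intr_norm -[1]/(1%:~R) ler_int -gtz0_ge1 normr_gt0 numq_eq0//.
Qed.

Lemma prim_root_exists (C : numClosedFieldType) d : (0 < d)%N ->
  exists w : C, d.-primitive_root w.
Proof.
move=> d_gt0; have [lam [inj lam1 _]] := roots_XnsubC d_gt0 (oner_neq0 C).
have := @has_prim_root C d [seq lam k | k <- enum 'I_d] d_gt0.
rewrite (map_inj_uniq inj) enum_uniq size_map size_enum_ord leqnn => /(_ _ isT isT).
case/(_ _)/hasP => [|w _ wd]; last by exists w.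
by apply/allP => _ /mapP[k _ ->]; rewrite unity_rootE lam1.
Qed.

(** * Estimates at the archimedean place *)

Section ComplexNorm.
Variable R : realType.
Local Notation nm := (@Normc.normc R).
Implicit Types z : R[i].

Lemma nmE z : `|z| = ((nm z)%:C)%C. Proof. by []. Qed.
Lemma nm_ge0 z : 0 <= nm z. Proof. by have := normr_ge0 z; rewrite nmE ler0c. Qed.
Lemma nm1 : nm 1 = 1. Proof. exact: Normc.normc1. Qed.
Lemma nmX z n : nm (z ^+ n) = nm z ^+ n.
Proof. by elim: n => [|n IH]; rewrite ?expr0 ?nm1// !exprS Normc.normcM IH. Qed.
Lemma nm_prod (I : Type) (s : seq I) (P : pred I) (G : I -> R[i]) :
  nm (\prod_(i <- s | P i) G i) = \prod_(i <- s | P i) nm (G i).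
Proof. exact: (big_morph _ (@Normc.normcM R) nm1). Qed.
Lemma nm_sum (I : Type) (s : seq I) (P : pred I) (G : I -> R[i]) :
  nm (\sum_(i <- s | P i) G i) <= \sum_(i <- s | P i) nm (G i).
Proof.
elim/big_rec2: _ => [|i x y _ IH]; first by rewrite Normc.normc0.
by apply: le_trans (le_normcD _ _) _; rewrite lerD2l.
Qed.

Lemma nm_ratr (x : rat) : nm (ratr x) = ratr `|x|.
Proof.
by apply: (@complexI R); rewrite -nmE -ratr_norm fmorph_rat.
Qed.

Lemma nm_Vandermonde d (y : nat -> R[i]) :
  nm (\det (Vandermonde d (\row_(j < d) y j))) <=
  d`!%:R * (\prod_(j < d) Num.max 1 (nm (y j))) ^+ d.-1.
Proof.
apply: le_trans (nm_sum _ _ _) _.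
rewrite -card_Sn mulr_natl -sumr_const; apply: ler_sum => s _.
rewrite Normc.normcM nmX.
have -> : nm (-1) = 1 by rewrite normcN nm1.
rewrite expr1n mul1r nm_prod -prodrXl [X in _ <= X](reindex_perm s) /=.
apply: ler_prod => i _; rewrite nm_ge0 /= !mxE nmX.
have m1 : 1 <= Num.max 1 (nm (y (s i))) by rewrite le_max lexx.
apply: (@le_trans _ _ (Num.max 1 (nm (y (s i))) ^+ i)).
  apply: lerXn2r; rewrite ?nnegrE ?nm_ge0//; first exact: le_trans m1.
  by rewrite le_max lexx orbT.
by apply: ler_weXn2l => //; rewrite -ltnS (leq_trans (ltn_ord i))// leqSpred.
Qed.
End ComplexNorm.

(** What the analysis at a ramified place asks of pi: pi^d is l / t times an m-th root of an integer
    prime to l. The integers t and N are hidden so that the condition can be imposed on every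
    conjugate. *)
Definition ramdata (F : numFieldType) (l d m : nat) (pi : F) :=
  exists t N, [/\ (t%:R * pi ^+ d / l%:R) ^+ m = N%:R, coprime l t, coprime l N & coprime l m].

(** * The discriminant inequality over all places *)

Section Core.
Variables (R : realType) (d m : nat) (r : R[i]) (lam : 'I_(d * m) -> R[i]).
Variables (f : {poly rat}) (p q : nat).
Hypotheses (d_prime : prime d) (m_gt0 : (0 < m)%N) (r_neq0 : r != 0).
Hypotheses (lam_inj : injective lam) (lamD : forall k, lam k ^+ (d * m) = r).
Hypothesis lam_surj : forall z, z ^+ (d * m) = r -> exists k, z = lam k.
Hypothesis r_rat : exists x : rat, r = ratr x.
Hypotheses (p_prime : prime p) (q_prime : prime q) (pq : p != q) (pd : coprime p d).
Hypothesis ram_p : forall k, ramdata p d m (lam k).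
Hypothesis ram_q : forall k, ramdata q d m (lam k)^-1.
Variable i1 : 'I_d.
Hypotheses (i1_neq0 : val i1 != 0%N).
Hypothesis comp_neq0 : forall k, evalQ (polycomp d i1 f) (lam k ^+ d) != 0.

Local Notation nm := (@Normc.normc R).
Let d_gt0 : (0 < d)%N := prime_gt0 d_prime.
Let D_gt0 : (0 < d * m)%N. Proof. by rewrite muln_gt0 d_gt0. Qed.
Let lam_neq0 k : lam k != 0.
Proof.
by apply: contraNneq r_neq0 => l0; rewrite -(lamD k) l0 expr0n gtn_eqF.
Qed.

(** Distinctness is read off at a single place, above p. It yields the nonvanishing of the
    discriminants as well as d different conjugates for the bound on the degree. *)
Lemma rel_conj_neq w1 w2 k : w1 ^+ d = 1 -> w2 ^+ d = 1 -> w1 != w2 ->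
  evalQ f (w1 * lam k) != evalQ f (w2 * lam k).
Proof.
move=> w1d w2d w12; have [A V] := valring_exists R[i] (prime_gt1 p_prime).
have [t [N [etam lt lN lm]]] := ram_p k.
have xE : lam k = lam k \/ lam k = (lam k)^-1 by left.
apply: (local_sub_neq0 p_prime V d_gt0 m_gt0 (lam_neq0 k) etam lt lN lm xE) => //.
by exists i1.
Qed.

Lemma reldisc_neq0 k : evalQ (reldisc d f) (lam k) != 0.
Proof.
have [w wd] := prim_root_exists R[i] d_gt0.
rewrite (evalQ_reldiscE _ _ d_gt0 wd) expf_neq0//.
apply/prodf_neq0 => i _; apply/prodf_neq0 => j ij; rewrite subr_eq0.
apply: rel_conj_neq.
- by rewrite exprAC (prim_expr_order wd) expr1n.
- by rewrite exprAC (prim_expr_order wd) expr1n.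
- by rewrite (eq_prim_root_expr wd) !modn_small// gtn_eqF.
Qed.

Let a k := evalQ f (lam k).

(** The nonzero rational [X] is integral at every prime, so |X| >= 1; the archimedean size of the
    discriminants bounds it from above. The factor [b] turns the characteristic polynomial of a into
    an integral one and so controls the denominators of the conjugates. *)
Lemma core_ineq (b : int) : b != 0 ->
  (forall i, exists n : int, (b%:~R *: \prod_k ('X - (a k)%:P))`_i = n%:~R) ->
  ((p * q) ^ (d * m * d.-1))%:R <=
  d`!%:R ^+ (2 * (d * m)) *
  (nm b%:~R * \prod_k Num.max 1 (nm (a k))) ^+ (2 * d * d.-1).
Proof.
move=> b_neq0 bint; have [w wd] := prim_root_exists R[i] d_gt0.
have [r' r'E] := r_rat.
have wD j : (w ^+ j) ^+ (d * m) = 1.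
  by rewrite exprAC exprM (prim_expr_order wd) !expr1n.
have reidx (T : comNzRingType) (G : R[i] -> T) :
    \prod_k \prod_(j < d) G (evalQ f (w ^+ j * lam k)) = (\prod_k G (a k)) ^+ d.
  rewrite exchange_big /= -[X in _ = _ ^+ X](card_ord d) -prodr_const.
  apply: eq_bigr => j _.
  exact: (prod_roots_mul (fun z => G (evalQ f z)) D_gt0 lam_inj lamD lam_surj (wD j)).
(* A relative discriminant involves each of its d conjugates 2 (d - 1) times, and by [reidx] each
   [a k] is met d times. *)
pose n1 := (2 * d * d.-1)%N.
(* [reldisc] is a polynomial in X^d, so this product over d m roots is the d-th power of the product
   over the m values of lam^d. All exponents in the inequality carry this extra factor d. *)
pose De := \prod_k evalQ (reldisc d f) (lam k).
have [x xE] : exists x : rat, ratr x = De.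
  apply: (@conj_norm _ _ ('X^(d * m) - r'%:P)); rewrite ?size_XnsubC//.
  by move=> k; rewrite evalQB evalQXn evalQC lamD r'E subrr.
pose X : rat := b%:~R ^+ n1 * x / ((p * q) ^ (d * m * d.-1))%:R.
have pq_neq0 : ((p * q) ^ (d * m * d.-1))%:R != 0 :> rat.
  by rewrite pnatr_eq0 -lt0n expn_gt0 muln_gt0 !prime_gt0.
have De_neq0 : De != 0 by apply/prodf_neq0 => k _; apply: reldisc_neq0.
have x_neq0 : x != 0 by move: De_neq0; rewrite -xE fmorph_eq0.
have X_neq0 : X != 0 by rewrite !mulf_neq0 ?invr_eq0 ?expf_neq0 ?intr_eq0.
have XE : ratr X = b%:~R ^+ n1 * De / (p%:R ^+ (d * m * d.-1) * q%:R ^+ (d * m * d.-1)) :> R[i].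
  rewrite /X rmorphM fmorphV rmorphM /= xE rmorphXn /= ratr_int natrX natrM exprMn.
  by rewrite rmorphM !rmorphXn /= !rmorph_nat.
have X_ge1 : 1 <= `|X|.
  apply: (@ratr_integral_ge1 R[i]) => // l l_prime.
  have [A V] := valring_exists R[i] (prime_gt1 l_prime); exists A => //.
  pose M k := \prod_(j < d) mu A (evalQ f (w ^+ j * lam k)).
  have M_neq0 k : M k != 0 by apply/prodf_neq0 => j _; apply: (mu_neq0 V).
  (* Gauss's lemma at the place [A]. *)
  have bM : A (b%:~R * \prod_k mu A (a k)).
    have := @vr_lead_prod_mu _ _ _ l_prime V [seq a k | k <- index_enum 'I_(d * m)] b%:~R.
    rewrite !big_map; apply=> i.
    by have [n ->] := bint i; apply: (vrint V).
  have DM : b%:~R ^+ n1 * De = (b%:~R * \prod_k mu A (a k)) ^+ n1 *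
      \prod_k (evalQ (reldisc d f) (lam k) / M k ^+ (2 * d.-1)).
    rewrite exprMn -mulrA; congr (_ * _).
    have -> : (\prod_k mu A (a k)) ^+ n1 = \prod_k M k ^+ (2 * d.-1).
      by rewrite prodrXl /M reidx -exprM; congr (_ ^+ _); rewrite /n1; lia.
    rewrite -big_split /=; apply: eq_bigr => k _.
    by rewrite mulrC divfK// expf_neq0.
  have unit_other l' n : prime l' -> l' != l -> A (l'%:R ^+ n)^-1.
    move=> pl' ll'; have /(vunitX V n) [] // : vunit A (l'%:R : R[i]).
    by apply: (vunit_nat l_prime V); rewrite prime_coprime// dvdn_prime2// eq_sym.
  have ram e : (forall k, A (evalQ (reldisc d f) (lam k) / M k ^+ (2 * d.-1) / e)) ->
      A (b%:~R ^+ n1 * De / e ^+ (d * m)).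
    move=> h; rewrite DM -mulrA; apply: (vrM V); first exact: (vrX V).
    rewrite -[X in _ ^+ X](card_ord (d * m)) -prodr_const -prodf_div.
    by apply: (vrprod V) => k _; apply: h.
  have pw (l' : nat) : l'%:R ^+ (d * m * d.-1) = (l'%:R ^+ d.-1) ^+ (d * m) :> R[i].
    by rewrite -exprM mulnC.
  rewrite XE.
  have [lp|lp] := eqVneq p l.
    rewrite invfM mulrA; apply: (vrM V); last by apply: unit_other; rewrite // -lp eq_sym.
    rewrite pw; apply: ram => k; have [t [N [etam lt lN lm]]] := ram_p k.
    rewrite lp in etam lt lN lm *.
    exact: (vr_reldisc_ramified l_prime V f d_gt0 wd m_gt0 (lam_neq0 k) etam lt lN lm (or_introl erefl)).
  have [lq|lq] := eqVneq q l.
    rewrite invfM mulrCA; apply: (vrM V); first exact: unit_other.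
    rewrite pw; apply: ram => k; have [t [N [etam lt lN lm]]] := ram_q k.
    rewrite lq in etam lt lN lm *.
    have xE' : lam k = (lam k)^-1 \/ lam k = (lam k)^-1^-1 by right; rewrite invrK.
    have li0 : (lam k)^-1 != 0 by rewrite invr_eq0.
    exact: (vr_reldisc_ramified l_prime V f d_gt0 wd m_gt0 li0 etam lt lN lm xE').
  rewrite invfM mulrA; apply: (vrM V); last exact: unit_other.
  apply: (vrM V); last exact: unit_other.
  have := ram 1; rewrite expr1n divr1; apply=> k; rewrite divr1.
  exact: (vr_reldisc V (lam k) f d_gt0 wd).
have archX : nm (ratr X) * ((p * q) ^ (d * m * d.-1))%:R = nm b%:~R ^+ n1 * nm De.
  have -> : ((p * q) ^ (d * m * d.-1))%:R = nm (ratr ((p * q) ^ (d * m * d.-1))%:R).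
    by rewrite nm_ratr normr_nat rmorph_nat.
  rewrite -Normc.normcM -rmorphM /= /X divfK// rmorphM /= Normc.normcM xE.
  by rewrite rmorphXn /= ratr_int nmX.
have De_le : nm De <= d`!%:R ^+ (2 * (d * m)) * (\prod_k Num.max 1 (nm (a k))) ^+ n1.
  rewrite /De nm_prod.
  have -> : (\prod_k Num.max 1 (nm (a k))) ^+ n1 =
      \prod_k (\prod_(j < d) Num.max 1 (nm (evalQ f (w ^+ j * lam k)))) ^+ (2 * d.-1).
    rewrite prodrXl (reidx _ (fun z => Num.max 1 (nm z))) -exprM.
    by congr (_ ^+ _); rewrite /n1; lia.
  rewrite exprM -[X in _ ^+ X](card_ord (d * m)) -prodr_const -big_split /=.
  apply: ler_prod => k _; rewrite nm_ge0 /=.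
  rewrite (evalQ_reldisc _ _ d_gt0 wd) nmX [(2 * d.-1)%N]mulnC exprM -exprMn.
  apply: lerXn2r; rewrite ?nnegrE ?nm_ge0//; last first.
    exact: (nm_Vandermonde d (fun j => evalQ f (w ^+ j * lam k))).
  rewrite mulr_ge0// exprn_ge0// prodr_ge0// => j _; by rewrite le_max ler01.
apply: (@le_trans _ _ (nm (ratr X) * ((p * q) ^ (d * m * d.-1))%:R)).
  rewrite ler_peMl// nm_ratr -[1](rmorph1 (ratr : rat -> R)) ler_rat//.
rewrite archX exprMn mulrCA; apply: ler_wpM2l => //.
by rewrite exprn_ge0// nm_ge0.
Qed.

End Core.

(** * Minimal polynomials, degrees and Mahler measures *)

Section MinimalPolynomials.
Variable R : realType.
Local Notation C := R[i].
Local Notation nm := (@Normc.normc R).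
Implicit Types (a x z : C) (P Q : {poly int}) (f g T : {poly rat}).
Local Notation pQ P := (map_poly (intr : int -> rat) P).
Local Notation pC P := (map_poly (intr : int -> C) P).

Lemma evalQ_intr P a : evalQ (pQ P) a = (pC P).[a].
Proof.
rewrite /evalQ -map_poly_comp; congr (_.[_]).
by apply: eq_map_poly => n /=; rewrite ratr_int.
Qed.

Lemma size_pQ P : size (pQ P) = size P.
Proof. by apply: size_map_inj_poly => //; apply: intr_inj. Qed.
Lemma size_pC P : size (pC P) = size P.
Proof. by apply: size_map_inj_poly => //; apply: intr_inj. Qed.
Lemma lead_coef_pC P : lead_coef (pC P) = (lead_coef P)%:~R.
Proof. by apply: lead_coef_map_inj => //; apply: intr_inj. Qed.

Lemma irredp_dvd_root f g a : irreducible_poly f -> evalQ f a = 0 -> evalQ g a = 0 -> f %| g.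
Proof.
move=> irf fa ga; apply/negPn; rewrite -(irreducible_poly_coprime _ irf).
apply/negP => /Bezout_eq1_coprimepP[[u v] /= /(congr1 (fun h => evalQ h a))].
rewrite /= evalQD !evalQM fa ga !mulr0 addr0 -[1]/(1%:P) evalQC rmorph1 => /esym/eqP.
by rewrite oner_eq0.
Qed.

Lemma eqp_irredp f g : f %= g -> irreducible_poly f -> irreducible_poly g.
Proof.
move=> fg [sf irf]; split; first by rewrite -(eqp_size fg).
move=> h sh hg; apply: (eqp_trans _ fg); apply: irf => //; by rewrite (eqp_dvdr _ fg).
Qed.

Lemma is_minpolyZ_exists a T : T != 0 -> evalQ T a = 0 -> exists P, is_minpolyZ a P.
Proof.
move=> T0 Ta.
pose S n := `[< exists g, [/\ g != 0, evalQ g a = 0 & size g = n] >].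
have exS : exists n, S n by exists (size T); apply/asboolP; exists T.
case: (ex_minnP exS) => n /asboolP[g [g0 ga sg]] min_n.
have irg : irreducible_poly g.
  apply/(subfx_irreducibleP (iota := ratr : {rmorphism rat -> C}) (z := a)) => //.
    by apply/rootP.
  by move=> h /rootP ha h0; rewrite sg; apply: min_n; apply/asboolP; exists h.
have [q [c c0 gE]] := rat_poly_scale g.
have q0 : q != 0 by apply: contraNneq g0 => q0; rewrite gE q0 rmorph0 scaler0.
have zq0 : zcontents q != 0 by rewrite zcontents_eq0.
have eqg : g %= pQ (zprimitive q).
  rewrite gE {1}[q]zpolyEprim map_polyZ /= scalerA eqp_scale// mulf_neq0//.
    by rewrite invr_eq0 intr_eq0.
  by rewrite intr_eq0.
have irP := eqp_irredp eqg irg.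
exists (zprimitive q); split=> //; first by rewrite zcontents_primitive q0.
rewrite rootE -evalQ_intr.
have /dvdpP[h ->] : g %| pQ (zprimitive q) by rewrite (eqp_dvdl _ eqg).
by rewrite evalQM ga mulr0.
Qed.

Lemma is_minpolyZ_uniq a P Q : is_minpolyZ a P -> is_minpolyZ a Q -> P = Q.
Proof.
move=> [cP irP /rootP rP] [cQ irQ /rootP rQ].
have PQ : pQ P %| pQ Q by apply: (irredp_dvd_root irP (a := a)); rewrite evalQ_intr.
have QP : pQ Q %| pQ P by apply: (irredp_dvd_root irQ (a := a)); rewrite evalQ_intr.
have sPQ : size P = size Q.
  by rewrite -size_pQ -[RHS]size_pQ; apply: eqp_size; rewrite /eqp PQ QP.
move: PQ; rewrite dvdp_rat_int => /dvdpP_int[r QE].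
have PE : zprimitive P = P by rewrite [RHS]zpolyEprim cP scale1r.
rewrite PE in QE.
have P0 : P != 0 by rewrite -zcontents_eq0 cP.
have Q0 : Q != 0 by rewrite -zcontents_eq0 cQ.
have r0 : r != 0 by apply: contraNneq Q0 => r0; rewrite QE r0 mulr0.
have sr : size r = 1%N.
  have := size_mul P0 r0; rewrite -QE sPQ; have := size_poly_gt0 Q.
  by rewrite Q0; case: (size Q) => // k _; rewrite addSn /= -[in X in X -> _](addn1 k) => /addnI.
move/eqP/size_poly1P: sr => [c c0 rE].
have : zcontents Q = c by rewrite QE rE mulrC mul_polyC zcontentsZ cP mulr1.
by rewrite cQ QE rE => <-; rewrite mulr1.
Qed.

Lemma minpolyZE a P : is_minpolyZ a P -> minpolyZ a = P.
Proof.
move=> mP; apply: (is_minpolyZ_uniq (a := a)) => //.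
by have := @xgetPex _ 0 [set P | is_minpolyZ a P]; apply; exists P.
Qed.

Lemma adjoinQ1E a T x : T != 0 -> evalQ T a = 0 ->
  (adjoinQ [set a] x <-> exists g, x = evalQ g a).
Proof.
move=> T0 Ta; split=> [adx|[g ->] A cA Aa]; last first.
  have a_in : a \in A by apply: Aa.
  have [A1 AB AV] := cA.
  have A0 : 0 \in A by rewrite -(subrr 1) AB.
  have AD y z : y \in A -> z \in A -> y + z \in A.
    by move=> Ay Az; rewrite -[z]opprK -[- z]sub0r !AB.
  have AM y z : y \in A -> z \in A -> y * z \in A.
    by move=> Ay Az; rewrite -[z]invrK -[z^-1]mul1r !AV.
  have An n : n%:R \in A by elim: n => // n IH; rewrite mulrS AD.
  have Ai (n : int) : n%:~R \in A.
    by case: n => n; [exact: An|rewrite NegzE rmorphN -sub0r AB// An].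
  have Ar (c : rat) : ratr c \in A.
    have -> : ratr c = (numq c)%:~R / (denq c)%:~R :> C by [].
    exact: (AV _ _ (Ai _) (Ai _)).
  elim/poly_ind: g => [|g c IH].
    by rewrite /evalQ rmorph0 horner0.
  by rewrite evalQD evalQM evalQX evalQC; apply: AD => //; apply: AM.
suff /asboolP : x \in [pred y | `[< exists g, y = evalQ g a >]] by [].
apply: adx; last first.
  by move=> _ ->; apply/asboolP; exists 'X; rewrite evalQX.
split.
- by apply/asboolP; exists 1%:P; rewrite evalQC rmorph1.
- move=> _ _ /asboolP[g ->] /asboolP[g' ->]; apply/asboolP.
  by exists (g - g'); rewrite evalQB.
- move=> _ _ /asboolP[g ->] /asboolP[g' ->]; apply/asboolP.
  have [g'0|g'0] := eqVneq (evalQ g' a) 0.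
    by exists 0; rewrite g'0 invr0 mulr0 /evalQ rmorph0 horner0.
  have [h' hg] := evalQ_inv T0 Ta g'0; exists (g * h'); rewrite evalQM; congr (_ * _).
  by apply: (mulIf g'0); rewrite hg mulVf.
Qed.

(** [Qdim] chooses the length of some basis, so this length must be unique. Expressing each basis in
    the other gives rational matrices with M M' = 1, which forces n <= n'. *)
Lemma is_Qbasis_uniq n n' (b : 'I_n -> C) (b' : 'I_n' -> C) (K : set C) :
  is_Qbasis b K -> is_Qbasis b' K -> (n <= n')%N.
Proof.
move=> [bK bfree] [b'K b'free].
have Kb i : K (b i).
  apply/bK; exists (fun j => (i == j)%:R); rewrite (bigD1 i)//= eqxx rmorph1 mul1r.
  by rewrite big1 ?addr0// => j ji; rewrite eq_sym (negPf ji) rmorph0 mul0r.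
have Kb' i : K (b' i).
  apply/b'K; exists (fun j => (i == j)%:R); rewrite (bigD1 i)//= eqxx rmorph1 mul1r.
  by rewrite big1 ?addr0// => j ji; rewrite eq_sym (negPf ji) rmorph0 mul0r.
have /choice[M hM] i : exists c : 'I_n' -> rat, b i = \sum_j ratr (c j) * b' j by apply/b'K.
have /choice[M' hM'] i : exists c : 'I_n -> rat, b' i = \sum_j ratr (c j) * b j by apply/bK.
apply: (@mulmx1_min rat n n' (\matrix_(i, j) M i j) (\matrix_(i, j) M' i j)).
apply/matrixP => i k; rewrite !mxE; apply/eqP; rewrite -subr_eq0; apply/eqP.
apply: (bfree (fun k => \sum_j (\matrix_(i, j) M i j) i j * (\matrix_(i, j) M' i j) j k - (i == k)%:R)).
under eq_bigr do rewrite rmorphB mulrBl.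
rewrite sumrB; apply/eqP; rewrite subr_eq0; apply/eqP.
rewrite [RHS](bigD1 i)//= eqxx rmorph1 mul1r [X in _ = _ + X]big1 ?addr0; last first.
  by move=> j ji; rewrite eq_sym (negPf ji) rmorph0 mul0r.
rewrite [RHS]hM; under eq_bigr do rewrite rmorph_sum mulr_suml.
rewrite exchange_big /=; apply: eq_bigr => j _; rewrite hM' mulr_sumr.
by apply: eq_bigr => k' _; rewrite !mxE rmorphM mulrA.
Qed.

Lemma algdegE a P : is_minpolyZ a P -> algdeg a = (size P).-1.
Proof.
move=> [cP irP /rootP rP]; set n := (size P).-1.
have Pa : evalQ (pQ P) a = 0 by rewrite evalQ_intr.
have P0 : pQ P != 0 by apply: irredp_neq0.
have sP : size P = n.+1.
  by rewrite /n prednK// -size_pQ size_poly_gt0.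
have bas : is_Qbasis (fun i : 'I_n => a ^+ i) (adjoinQ [set a]).
  split=> [x|c c0 i].
    rewrite (adjoinQ1E x P0 Pa); split=> [[g ->]|[c ->]]; last first.
      exists (\sum_(i < n) c i *: 'X^i); rewrite evalQ_sum; apply: eq_bigr => i _.
      by rewrite evalQZ evalQXn.
    exists (fun i => (g %% pQ P)`_i).
    rewrite {1}(divp_eq g (pQ P)) evalQD evalQM Pa mulr0 add0r.
    rewrite /evalQ (@horner_coef_wide _ n); last first.
      by rewrite size_map_poly -ltnS -sP -size_pQ ltn_modp.
    by apply: eq_bigr => i _; rewrite coef_map.
  pose g := \poly_(i < n) (if insub i is Some j then c j else 0).
  have ga : evalQ g a = 0.
    rewrite -[RHS]c0 /evalQ (@horner_coef_wide _ n) ?size_map_poly ?size_poly//.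
    by apply: eq_bigr => j _; rewrite coef_map coef_poly ltn_ord /= valK.
  have /dvdp_leq le : pQ P %| g by apply: (irredp_dvd_root irP Pa ga).
  have [g0|/le] := eqVneq g 0.
    by have := congr1 (fun h : {poly rat} => h`_i) g0; rewrite coef_poly ltn_ord coef0 valK.
  by rewrite size_pQ sP leqNgt ltnS size_poly.
rewrite /algdeg /Qdim; case: xgetP => [k kE [b' bas']|/(_ n)]; last first.
  by case; exists (fun i : 'I_n => a ^+ i).
apply/eqP; rewrite eqn_leq (is_Qbasis_uniq bas bas') andbT.
exact: is_Qbasis_uniq bas' bas.
Qed.

(** [mahler_measure] runs over a chosen list of roots, known only through the product of its linear
    factors. That product determines the list up to order. *)
Lemma prod_XsubC_big (s t : seq C) (G : C -> R) e :
  \prod_(z <- s) ('X - z%:P) = (\prod_(z <- t) ('X - z%:P)) ^+ e ->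
  \prod_(z <- s) G z = (\prod_(z <- t) G z) ^+ e.
Proof.
have [u [u1 u2]] : exists u : seq C,
    \prod_(z <- u) ('X - z%:P) = (\prod_(z <- t) ('X - z%:P)) ^+ e /\
    \prod_(z <- u) G z = (\prod_(z <- t) G z) ^+ e.
  elim: e => [|e [u [u1 u2]]]; first by exists [::]; rewrite !big_nil.
  by exists (t ++ u); rewrite !big_cat /= u1 u2 !exprS.
by rewrite -u1 -u2 => /prod_XsubC_eq; apply: perm_big.
Qed.

Lemma mahler_ge1 P : P != 0 -> 1 <= mahler_measure (pC P).
Proof.
move=> P0; rewrite /mahler_measure.
apply: mulr_ege1.
  rewrite lead_coef_pC -[(lead_coef P)%:~R](ratr_int (R[i])) nm_ratr -intr_norm ratr_int.
  by rewrite -[1]/(1%:~R) ler_int -gtz0_ge1 normr_gt0 lead_coef_eq0.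
by elim/big_ind: _ => // [x y|z _]; [apply: mulr_ege1|rewrite le_max lexx].
Qed.

Lemma irredp_power f g : irreducible_poly f -> g != 0 ->
  (forall z : C, evalQ g z = 0 -> evalQ f z = 0) ->
  exists e c, c != 0 /\ g = c *: f ^+ e.
Proof.
move=> irf; have [n] := ubnP (size g); elim: n g => // n IH g; rewrite ltnS => sg g0 gf.
have [s1|s1] := eqVneq (size (map_poly (ratr : rat -> C) g)) 1%N.
  move: s1; rewrite size_map_poly => /eqP/size_poly1P[c c0 ->].
  by exists 0%N, c; rewrite expr0 -alg_polyC.
have [z /rootP gz] := closed_rootP _ s1.
have /dvdpP[h gE] := irredp_dvd_root irf (gf _ gz) gz.
have h0 : h != 0 by apply: contraNneq g0 => h0; rewrite gE h0 mul0r.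
have f0 := irredp_neq0 irf.
have [e [c [c0 hE]]] : exists e c, c != 0 /\ h = c *: f ^+ e.
  apply: IH => //.
    have [sf _] := irf; rewrite (leq_trans _ sg)// gE size_mul//.
    by move: sf; case: (size f) => [|[|k]]// _; rewrite !addnS /= ltnS leq_addr.
  by move=> y hy; apply: gf; rewrite gE evalQM hy mul0r.
by exists e.+1, c; split=> //; rewrite gE hE -scalerAl exprSr.
Qed.

(* The characteristic polynomial of a = f(lam k0) is a power of its minimal
   polynomial. *)
Lemma conj_minpoly (D : nat) (r : rat) (lam : 'I_D -> C) f k0 P :
  (0 < D)%N -> irreducible_poly ('X^D - r%:P) -> injective lam ->
  (forall k, lam k ^+ D = ratr r) -> is_minpolyZ (evalQ f (lam k0)) P ->
  exists e, [/\ D = ((size P).-1 * e)%N,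
    forall k, (pC P).[evalQ f (lam k)] = 0,
    pC (P ^+ e) = (lead_coef P ^+ e)%:~R *: \prod_k ('X - (evalQ f (lam k))%:P)
  & nm (lead_coef P ^+ e)%:~R * \prod_k Num.max 1 (nm (evalQ f (lam k))) =
    mahler_measure (pC P) ^+ e].
Proof.
move=> D_gt0 irT inj lamr [cP irP /rootP rP].
have sT : size ('X^D - r%:P : {poly rat}) = D.+1 by rewrite size_XnsubC.
have Tlam k : evalQ ('X^D - r%:P) (lam k) = 0.
  by rewrite evalQB evalQXn evalQC lamr subrr.
have Pk k : evalQ (pQ P) (evalQ f (lam k)) = 0.
  have /dvdpP[h hE] : 'X^D - r%:P %| pQ P \Po f.
    by apply: (irredp_dvd_root irT (Tlam k0)); rewrite evalQ_comp evalQ_intr.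
  by rewrite -evalQ_comp hE evalQM Tlam mulr0.
have [chi chiE] := conj_charpoly f sT inj Tlam.
have chi_monic : chi \is monic.
  have := monic_prod_XsubC (index_enum 'I_D) xpredT (fun k => evalQ f (lam k)).
  by rewrite -chiE map_monic.
have chi0 := monic_neq0 chi_monic.
have [e [c [c0 chiP]]] : exists e c, c != 0 /\ chi = c *: (pQ P) ^+ e.
  apply: irredp_power => // z.
  rewrite {1}/evalQ chiE horner_prod => /eqP/prodf_eq0[k _].
  by rewrite hornerXsubC subr_eq0 => /eqP ->; apply: Pk.
have P0 : P != 0 by rewrite -zcontents_eq0 cP.
have schi : size chi = D.+1.
  rewrite -(size_map_poly (ratr : {rmorphism rat -> C})) chiE size_prod_XsubC.
  by rewrite /index_enum -enumT size_enum_ord.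
have mapP : map_poly (ratr : rat -> C) (pQ P) = pC P.
  by rewrite -map_poly_comp; apply: eq_map_poly => n /=; rewrite ratr_int.
have chiC : \prod_k ('X - (evalQ f (lam k))%:P) = ratr c *: pC P ^+ e.
  by rewrite -chiE chiP map_polyZ rmorphXn /= mapP.
have lead1 : ratr c * (lead_coef P)%:~R ^+ e = 1 :> C.
  have := congr1 lead_coef chiC; rewrite lead_coefZ lead_coef_exp lead_coef_pC => <-.
  by rewrite (monicP (monic_prod_XsubC _ _ _)).
have le0 : ((lead_coef P)%:~R ^+ e : C) != 0.
  by rewrite expf_neq0// intr_eq0 lead_coef_eq0.
have PeE : pC (P ^+ e) = (lead_coef P ^+ e)%:~R *: \prod_k ('X - (evalQ f (lam k))%:P).
  by rewrite rmorphXn /= chiC scalerA rmorphXn /= mulrC lead1 scale1r.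
exists e; split=> //.
- move: schi; rewrite chiP size_scale// => /(congr1 predn) /=.
  by rewrite size_exp size_pQ => <-.
- by move=> k; rewrite -evalQ_intr.
- rewrite /mahler_measure.
  case: closed_field_poly_normal => rs /= PE; rewrite lead_coef_pC in PE *.
  rewrite exprMn rmorphXn nmX; congr (_ * _).
  have -> : \prod_k Num.max 1 (nm (evalQ f (lam k))) =
      \prod_(z <- [seq evalQ f (lam k) | k <- index_enum 'I_D]) Num.max 1 (nm z).
    by rewrite big_map.
  apply: prod_XsubC_big; rewrite big_map.
  move: PeE; rewrite !rmorphXn /= PE exprZn => /(scalerI le0) <- //.
Qed.
End MinimalPolynomials.

(** * The lower bound for heights and Northcott's theorem *)

Section HeightBounds.
Variable R : realType.
Local Notation C := R[i].
Local Notation nm := (@Normc.normc R).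
Local Notation pC P := (map_poly (intr : int -> C) P).
Implicit Types (a z : C) (P : {poly int}) (f : {poly rat}).

Lemma algdeg_gt0 a P : is_minpolyZ a P -> (0 < algdeg a)%N.
Proof.
move=> mP; rewrite (algdegE mP); case: mP => _ [+ _] _.
by rewrite size_pQ; case: (size P) => [|[|n]].
Qed.

Lemma is_minpolyZ_neq0 a P : is_minpolyZ a P -> P != 0.
Proof. by case=> cP _ _; rewrite -zcontents_eq0 cP. Qed.

Lemma ln_mahler a P : is_minpolyZ a P ->
  ln (mahler_measure (pC P)) = (algdeg a)%:R * weil_height a.
Proof.
move=> mP; rewrite /weil_height (minpolyZE mP) mulrCA divff ?mulr1//.
by rewrite pnatr_eq0 -lt0n (algdeg_gt0 mP).
Qed.

Lemma weil_height_ge0 a P : is_minpolyZ a P -> 0 <= weil_height a.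
Proof.
move=> mP; rewrite /weil_height (minpolyZE mP) divr_ge0// ln_ge0//.
exact/mahler_ge1/(is_minpolyZ_neq0 mP).
Qed.

Lemma fact_le_exp d : (d`! <= d ^ d)%N.
Proof.
elim: d => // d IH; rewrite factS expnS leq_mul2l /= (leq_trans IH)//.
by case: d {IH} => // d; rewrite leq_exp2r.
Qed.

(** The logarithm of the discriminant inequality with b = lead(P)^e, for which b times the product
    over the conjugates is M(P)^e. As d m = deg(a) e, the degree cancels. Then log d! <= d log d,
    divided by d (d - 1), leaves log d / (d - 1). The degree is at least d because the d relative
    conjugates are distinct roots of P. *)
Lemma height_lower (d m : nat) (r : rat) (lam : 'I_(d * m) -> C) f p q (i1 : 'I_d) k0 P :
  prime d -> (0 < m)%N -> r != 0 -> irreducible_poly ('X^(d * m) - r%:P) ->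
  injective lam -> (forall k, lam k ^+ (d * m) = ratr r) ->
  (forall z, z ^+ (d * m) = ratr r -> exists k, z = lam k) ->
  prime p -> prime q -> p != q -> coprime p d ->
  (forall k, ramdata p d m (lam k)) -> (forall k, ramdata q d m (lam k)^-1) ->
  val i1 != 0%N -> polycomp d i1 f != 0 -> (size f <= d * m)%N ->
  is_minpolyZ (evalQ f (lam k0)) P ->
  (d <= algdeg (evalQ f (lam k0)) <= d * m)%N /\
  ln (p * q)%:R / (2 * d%:R) - ln d%:R / d.-1%:R <= weil_height (evalQ f (lam k0)).
Proof.
move=> d_prime m_gt0 r0 irT inj lamr surj p_prime q_prime pq pd ram_p ram_q i10 ci sf mP.
set a := evalQ f (lam k0) in mP *.
have d_gt0 := prime_gt0 d_prime; have d_gt1 := prime_gt1 d_prime.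
have D_gt0 : (0 < d * m)%N by rewrite muln_gt0 d_gt0.
(* Since f has degree below d m, so has its component composed with X^d; being nonzero, it cannot
   vanish at a root of the irreducible X^(d m) - r. *)
have comp_neq0 k : evalQ (polycomp d i1 f) (lam k ^+ d) != 0.
  rewrite -[lam k ^+ d]evalQXn -evalQ_comp; apply/eqP => c0.
  have Tlam : evalQ ('X^(d * m) - r%:P) (lam k) = 0.
    by rewrite evalQB evalQXn evalQC lamr subrr.
  have := irredp_dvd_root irT Tlam c0.
  have h0 : polycomp d i1 f \Po 'X^d != 0.
    by rewrite comp_poly_eq0// size_polyXn.
  move=> /(dvdp_leq h0); rewrite size_XnsubC// leqNgt ltnS => /negP; apply.
  apply/leq_sizeP => j Dj; rewrite coef_comp_poly_Xn//; case: ifP => // dj.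
  rewrite coef_polycomp// nth_default// divnK//.
  by rewrite (leq_trans sf)// (leq_trans Dj)// leq_addl.
have r_neq0 : (ratr r : C) != 0 by rewrite fmorph_eq0.
have [e [DE Pk PeE mE]] := conj_minpoly D_gt0 irT inj lamr mP.
have nE := algdegE mP.
have P0 := is_minpolyZ_neq0 mP.
have n_gt0 := algdeg_gt0 mP.
have e_gt0 : (0 < e)%N by case: e DE {PeE mE} => //; rewrite muln0 => h; rewrite h in D_gt0.
have b0 : lead_coef P ^+ e != 0 by rewrite expf_neq0// lead_coef_eq0.
split.
  apply/andP; split; last by rewrite [leqRHS]DE -nE leq_pmulr.
  rewrite nE.
  have [w wd] := prim_root_exists C d_gt0.
  pose s := [seq evalQ f (w ^+ j * lam k0) | j : 'I_d].
  have : (size s < size (pC P))%N.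
    apply: max_poly_roots.
    - by rewrite -size_poly_gt0 size_pC size_poly_gt0.
    - apply/allP => _ /mapP[j _ ->]; rewrite rootE.
      have [k ->] : exists k, w ^+ j * lam k0 = lam k.
        by apply: surj; rewrite exprMn lamr exprAC exprM (prim_expr_order wd) !expr1n mul1r.
      by rewrite Pk.
    - rewrite map_inj_uniq ?enum_uniq// => i j /eqP; apply: contraTeq => ij.
      apply: (rel_conj_neq d_prime m_gt0 r_neq0 lamr p_prime pd ram_p i10 comp_neq0).
      + by rewrite exprAC (prim_expr_order wd) expr1n.
      + by rewrite exprAC (prim_expr_order wd) expr1n.
      + by rewrite (eq_prim_root_expr wd) !modn_small.
  rewrite size_map size_enum_ord size_pC => h.
  by rewrite -ltnS prednK// (leq_ltn_trans _ h).
have bint i : exists n : int,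
    ((lead_coef P ^+ e)%:~R *: \prod_k ('X - (evalQ f (lam k))%:P))`_i = n%:~R.
  by rewrite -PeE coef_map; exists (P ^+ e)`_i.
have r_rat : exists x : rat, ratr r = ratr x :> C by exists r.
have := core_ineq d_prime m_gt0 r_neq0 inj lamr surj r_rat p_prime q_prime pq pd
  ram_p ram_q i10 comp_neq0 b0 bint.
rewrite mE -exprM.
set M := mahler_measure _; have M1 : 1 <= M by apply: mahler_ge1.
have M0 : 0 < M by apply: lt_le_trans M1.
have lnM' : ln M = (algdeg a)%:R * weil_height a := ln_mahler mP.
have df0 : 0 < (d`!%:R : R) by rewrite ltr0n fact_gt0.
have pq0 : 0 < ((p * q)%:R : R) by rewrite ltr0n muln_gt0 !prime_gt0.
rewrite natrX -ler_ln ?posrE ?mulr_gt0 ?exprn_gt0//.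
rewrite lnM ?posrE ?exprn_gt0// !lnXn// lnM' => main.
have d1_gt0 : 0 < (d.-1%:R : R) by rewrite ltr0n -ltnS prednK.
have dR_gt0 : 0 < (d%:R : R) by rewrite ltr0n.
have DR_gt0 : 0 < ((d * m)%:R : R) by rewrite ltr0n.
have lf : ln (d`!%:R : R) <= d%:R * ln d%:R.
  rewrite mulr_natl -lnXn// ler_ln ?posrE ?exprn_gt0// -natrX ler_nat.
  exact: fact_le_exp.
have main2 : d.-1%:R * ln (p * q)%:R <= 2 * ln d`!%:R + 2 * d%:R * d.-1%:R * weil_height a.
  rewrite -(ler_pM2l DR_gt0); move: main.
  rewrite -[ln _ *+ (d * m * d.-1)]mulr_natl -[ln _ *+ (2 * (d * m))]mulr_natl.
  rewrite -[_ *+ (e * _)]mulr_natl !natrM.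
  have -> : (d%:R * m%:R : R) = (algdeg a)%:R * e%:R by rewrite -!natrM nE -DE.
  move=> main; apply: le_trans (le_trans main _); rewrite le_eqVlt; apply/orP; left; apply/eqP.
    ring.
  ring.
rewrite -(ler_pM2l (_ : 0 < 2 * d%:R * d.-1%:R)); last by rewrite !mulr_gt0.
have -> : 2 * d%:R * d.-1%:R * (ln (p * q)%:R / (2 * d%:R) - ln d%:R / d.-1%:R) =
   d.-1%:R * ln (p * q)%:R - 2 * d%:R * ln d%:R :> R.
  by field; rewrite !gt_eqF.
lra.
Qed.

Lemma coef_prod_XsubC_le (s : seq C) i :
  nm (\prod_(z <- s) ('X - z%:P))`_i <= 2 ^+ size s * \prod_(z <- s) Num.max 1 (nm z).
Proof.
elim: s i => [|z s IH] i.
  by rewrite !big_nil expr0 mul1r coef1; case: eqP => _; rewrite ?nm1 ?Normc.normc0.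
rewrite !big_cons mulrBl coefB coefXM coefCM /= exprS.
set B := 2 ^+ size s * _ in IH; set p := \prod_(_ <- s) _ in IH *.
have B0 : 0 <= B := le_trans (nm_ge0 _) (IH 0%N).
have mx1 : 1 <= Num.max 1 (nm z) by rewrite le_max lexx.
have mxz : nm z <= Num.max 1 (nm z) by rewrite le_max lexx orbT.
have t1 : nm (if i == 0%N then 0 else p`_i.-1) <= Num.max 1 (nm z) * B.
  case: eqP => _; first by rewrite Normc.normc0 mulr_ge0// (le_trans ler01).
  by apply: le_trans (IH _) _; rewrite ler_peMl.
have t2 : nm (- (z * p`_i)) <= Num.max 1 (nm z) * B.
  by rewrite normcN Normc.normcM ler_pM ?nm_ge0.
apply: le_trans (le_normcD _ _) _; apply: le_trans (lerD t1 t2) _.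
by rewrite le_eqVlt; apply/orP; left; apply/eqP; rewrite /B; ring.
Qed.

Lemma northcott_finite (g B : R) (D : nat) :
  finite_set [set a : C | [/\ exists P, is_minpolyZ a P, (algdeg a <= D)%N & wheight g a < B]].
Proof.
(* log M(P) is [wheight g a] times deg^(1-g), and deg^(1-g) <= D^|1-g| whatever the sign of 1 - g. A
   coefficient of P is at most 2^deg M(P). *)
pose Mx := 2 ^+ D * expR (B * D%:R `^ `|1 - g|).
pose K := (Num.truncn Mx).+1.
pose poly_of (F : {ffun 'I_D.+1 -> 'I_(K + K).+1}) : {poly int} :=
  \poly_(i < D.+1) ((F (inord i))%:Z - K%:Z).
pose rts F := if poly_of F == 0 then set0 else [set z | root (pC (poly_of F)) z].
apply: (@sub_finite_set _ _ (\bigcup_(F in setT) rts F)); last first.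
  apply: bigcup_finite; first exact: finite_finset.
  move=> F _; rewrite /rts; case: ifPn => [_|F0]; first exact: finite_set0.
  have [rs rsE] := closed_field_poly_normal (pC (poly_of F)).
  apply: (@sub_finite_set _ _ [set` rs]); last exact: finite_seq.
  move=> z /=; rewrite rsE rootZ ?root_prod_XsubC//.
  by rewrite lead_coef_eq0 -size_poly_gt0 size_pC size_poly_gt0.
move=> a /= [[P mP] nD hB].
have n_gt0 := algdeg_gt0 mP; have P0 := is_minpolyZ_neq0 mP.
have n1 : 1 <= ((algdeg a)%:R : R) by rewrite ler1n.
have n0 : 0 < ((algdeg a)%:R : R) by rewrite ltr0n.
have h0 := weil_height_ge0 mP.
have B0 : 0 <= B by apply: ltW; apply: le_lt_trans hB; rewrite mulr_ge0// powR_ge0.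
have lnM_le : ln (mahler_measure (pC P)) <= B * D%:R `^ `|1 - g|.
  rewrite (ln_mahler mP).
  have -> : (algdeg a)%:R * weil_height a = wheight g a * (algdeg a)%:R `^ (1 - g).
    rewrite /wheight mulrAC -powRD; last by rewrite (gt_eqF n0) implybT.
    by rewrite addrC subrK powRr1 // ltW.
  apply: ler_pM; [by rewrite /wheight mulr_ge0 ?powR_ge0|exact: powR_ge0|exact: ltW|].
  apply: (@le_trans _ _ ((algdeg a)%:R `^ `|1 - g|)).
    by apply: ler_powR => //; apply: ler_norm.
  by apply: ge0_ler_powR; rewrite ?nnegrE ?normr_ge0 ?ler0n ?ler_nat.
have sP : size P = (algdeg a).+1 by rewrite (algdegE mP) prednK// size_poly_gt0.
have cP i : (absz (P`_i)%R <= K)%N.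
  rewrite -ltnS -(ltr_nat R) (@le_lt_trans _ _ Mx)//; last first.
    by rewrite (lt_trans (real_truncnS_gt _)) ?num_real// ltr_nat.
  have -> : ((absz (P`_i)%R)%:R : R) = nm (pC P)`_i.
    rewrite coef_map /= -[(P`_i)%:~R](ratr_int C) nm_ratr -intr_norm ratr_int -abszE.
    by [].
  have [rs rsE] := closed_field_poly_normal (pC P).
  have srs : size rs = algdeg a.
    have := congr1 (fun p : {poly C} => size p) rsE.
    rewrite size_scale ?size_prod_XsubC ?size_pC ?sP => [[]//|].
    by rewrite lead_coef_eq0 -size_poly_gt0 size_pC size_poly_gt0.
  have M_le : mahler_measure (pC P) <= expR (B * D%:R `^ `|1 - g|).
    rewrite -[X in X <= _]lnK ?ler_expR// posrE.
    exact: lt_le_trans ltr01 (mahler_ge1 _ P0).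
  apply: (@le_trans _ _ (2 ^+ algdeg a * mahler_measure (pC P))).
    have -> : mahler_measure (pC P) = nm (lead_coef (pC P)) * \prod_(z <- rs) Num.max 1 (nm z).
      rewrite /mahler_measure; case: closed_field_poly_normal => rs' /= rs'E.
      congr (_ * _); rewrite -[RHS]expr1; apply: prod_XsubC_big; rewrite expr1.
      move: rs'E; rewrite {1}rsE => /scalerI -> //.
      by rewrite lead_coef_eq0 -size_poly_gt0 size_pC size_poly_gt0.
    rewrite {1}rsE coefZ Normc.normcM mulrCA ler_wpM2l ?nm_ge0// -srs.
    exact: coef_prod_XsubC_le.
  apply: ler_pM; [by rewrite exprn_ge0|exact: le_trans ler01 (mahler_ge1 _ P0)| |exact: M_le].
  by apply: ler_weXn2l => //; rewrite ler1n.
pose F : {ffun 'I_D.+1 -> 'I_(K + K).+1} := [ffun i : 'I_D.+1 => inord (absz ((P`_i)%R + K%:Z)%R)].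
have PF : poly_of F = P.
  apply/polyP => i; rewrite coef_poly; case: ltnP => iD; last first.
    by rewrite nth_default// sP (leq_trans _ iD).
  rewrite ffunE inordK inordK//; have := cP i; lia.
exists F => //; rewrite /rts PF (negPf P0) /=; by case: mP.
Qed.

End HeightBounds.

(** * Irreducibility of X^D - r and heights of radicals *)

Lemma logn_prodn (l n : nat) (G : nat -> nat) : (forall j, (j < n)%N -> (0 < G j)%N) ->
  logn l (\prod_(j < n) G j) = (\sum_(j < n) logn l (G j))%N.
Proof.
elim: n => [|n IH] G0; first by rewrite !big_ord0 logn1.
rewrite !big_ord_recr /= lognM ?IH ?G0//; first by move=> j jn; apply: G0; rewrite ltnW.
by apply: prodn_gt0 => j; apply: G0; exact: ltnW (ltn_ord j).
Qed.

Lemma coprime_prodn (l n : nat) (G : nat -> nat) :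
  (forall j, (j < n)%N -> coprime l (G j)) -> coprime l (\prod_(j < n) G j).
Proof.
elim: n => [|n IH] G0; first by rewrite big_ord0 coprimen1.
by rewrite big_ord_recr /= coprimeMr G0// IH// => j jn; apply: G0; rewrite ltnW.
Qed.

(* A rational factor of degree k has a constant term of absolute value x with
   x^D = r^k, as all roots have absolute value r^(1/D). *)
Lemma irred_XnsubC (R : realType) (D : nat) (r : rat) : (0 < D)%N -> 0 < r ->
  (forall (x : rat) k, 0 < x -> x ^+ D = r ^+ k -> (D %| k)%N) ->
  irreducible_poly ('X^D - r%:P).
Proof.
move=> D_gt0 r_gt0 xk; pose C := R[i].
split=> [|h sh hT]; first by rewrite size_XnsubC.
have T0 : ('X^D - r%:P : {poly rat}) != 0 by rewrite -size_poly_gt0 size_XnsubC.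
have h0 : h != 0 by apply: contraTneq hT => ->; rewrite dvd0p.
pose hC := map_poly (ratr : rat -> C) h.
have [rs rsE] := closed_field_poly_normal hC.
have lc0 : lead_coef h != 0 by rewrite lead_coef_eq0.
have lcE : lead_coef hC = ratr (lead_coef h) by rewrite lead_coef_map.
have srs : size h = (size rs).+1.
  by rewrite -(size_map_poly (ratr : {rmorphism rat -> C})) -/hC rsE size_scale ?size_prod_XsubC// lcE fmorph_eq0.
have nz z : z \in rs -> Normc.normc z ^+ D = ratr r.
  move=> zrs; have hz : evalQ h z = 0.
    by apply/rootP; rewrite -/hC rsE rootZ ?root_prod_XsubC// lcE fmorph_eq0.
  have : evalQ ('X^D - r%:P) z = 0 by case/dvdpP: hT => h' ->; rewrite evalQM hz mulr0.
  rewrite evalQB evalQXn evalQC => /eqP; rewrite subr_eq0 => /eqP zD.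
  by rewrite -nmX zD nm_ratr gtr0_norm.
pose x := `|h.[0] / lead_coef h|.
have xE : ratr x = \prod_(z <- rs) Normc.normc z :> R.
  rewrite /x -nm_ratr fmorph_div /= -lcE.
  have -> : ratr h.[0] = hC.[0] :> C by rewrite -horner_map rmorph0.
  rewrite {1}rsE hornerZ mulrAC divff ?mul1r; last by rewrite lcE fmorph_eq0.
  rewrite horner_prod nm_prod; apply: eq_bigr => z _.
  by rewrite hornerXsubC sub0r normcN.
have xD : x ^+ D = r ^+ size rs.
  apply: (fmorph_inj (ratr : {rmorphism rat -> R})); rewrite !rmorphXn /= xE.
  rewrite -prodrXl (eq_big_seq (fun=> ratr r : R)); last by move=> z /nz.
  by rewrite big_const_seq count_predT -Monoid.iteropE.
have x_gt0 : 0 < x.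
  rewrite lt_neqAle normr_ge0 andbT eq_sym; apply/eqP => x0.
  have := expf_neq0 (size rs) (lt0r_neq0 r_gt0).
  by rewrite -xD x0 expr0n gtn_eqF// eqxx.
have /dvdnP[j jE] := xk _ _ x_gt0 xD.
rewrite -(dvdp_size_eqp hT) size_XnsubC// srs.
have := dvdp_leq T0 hT; rewrite size_XnsubC// srs ltnS jE => le.
case: j jE le => [|j] jE le; first by rewrite srs jE mul0n in sh.
by rewrite eqSS eqn_leq le mulSn leq_addr.
Qed.

Lemma ramdataI (F : numFieldType) (l d m A' B' : nat) (x : F) : prime l -> (0 < m)%N ->
  x ^+ (d * m) = (l ^ m * A')%:R / B'%:R -> coprime l A' -> coprime l B' -> coprime l m ->
  ramdata l d m x.
Proof.
(* For t = B', the m-th power of B' x^d / l is B'^m A' / B', an integer prime to l. *)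
move=> l_prime m_gt0 xE lA lB lm; exists B', (B' ^ m.-1 * A')%N; split=> //; last first.
  by rewrite coprimeMr lA coprimeXr.
have B0 : (B'%:R : F) != 0.
  rewrite pnatr_eq0; apply: contraTneq lB => ->; rewrite /coprime gcdn0.
  by rewrite gtn_eqF// prime_gt1.
have l0 : (l%:R : F) != 0 by rewrite pnatr_eq0 -lt0n prime_gt0.
rewrite expr_div_n exprMn -exprM xE -{1}(prednK m_gt0) exprS !natrM !natrX; field.
by rewrite B0 expf_neq0.
Qed.

(* Height of a radical: the minimal polynomial is B X^N - A, with all roots in
   the unit disk. *)
Lemma radical_height (R : realType) (x : R[i]) (N A B : nat) :
  (0 < N)%N -> (0 < A <= B)%N -> coprime A B -> x ^+ N = A%:R / B%:R ->
  irreducible_poly ('X^N - (A%:R / B%:R)%:P : {poly rat}) ->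
  [/\ algdeg x = N & weil_height x = ln B%:R / N%:R].
Proof.
move=> N_gt0 /andP[A_gt0 AB] cAB xN irT.
have B_gt0 : (0 < B)%N := leq_trans A_gt0 AB.
pose P : {poly int} := B%:Z *: 'X^N - A%:Z%:P.
have sP : size P = N.+1.
  have B0 : B%:Z != 0 :> int by rewrite -lt0n.
  rewrite /P size_polyDl ?size_scale ?size_polyXn//.
  by rewrite size_polyN (leq_ltn_trans (size_polyC_leq1 _))// ltnS.
have lP : lead_coef P = B%:Z.
  rewrite lead_coefE sP /= /P coefB coefZ coefXn eqxx coefC gtn_eqF//.
  by rewrite subr0 mulr1.
have P0' : P`_0 = - A%:Z.
  by rewrite /P coefB coefZ coefXn coefC eqxx (ltn_eqF N_gt0) mulr0 sub0r.
have BQ0 : (B%:R : rat) != 0 by rewrite pnatr_eq0 -lt0n.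
have mP : is_minpolyZ x P.
  split.
  - have : P \is a polyOver (dvdz (zcontents P)) by rewrite -dvdz_contents dvdzz.
    move=> /polyOverP h.
    have cA : (zcontents P %| P`_0)%Z := h 0%N; have cB : (zcontents P %| P`_N)%Z := h N.
    have PN : P`_N = B%:Z by rewrite -lP lead_coefE sP.
    rewrite P0' dvdzE abszN /= in cA; rewrite PN dvdzE /= in cB.
    have : (`|zcontents P| %| 1)%N by rewrite -(eqP cAB) dvdn_gcd cA cB.
    rewrite dvdn1 => /eqP c1.
    have := sgz_contents P; rewrite lP [RHS]gtr0_sgz ?ltz_nat//.
    by move: c1; case: (zcontents P) => [[|[|k]]|[|k]].
  - have -> : map_poly (intr : int -> rat) P = B%:R *: ('X^N - (A%:R / B%:R)%:P).
      rewrite /P rmorphB /= map_polyZ map_polyXn map_polyC /= scalerBr.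
      by congr (_ - _); rewrite -mul_polyC -polyCM mulrCA divff ?mulr1.
    by apply: eqp_irredp irT; rewrite eqp_sym eqp_scale.
  - rewrite rootE /P rmorphB /= map_polyZ map_polyXn map_polyC /= hornerD hornerN hornerZ.
    rewrite hornerXn hornerC xN mulrCA divff ?mulr1 ?subrr//.
    by rewrite pnatr_eq0 -lt0n.
have dx : algdeg x = N by rewrite (algdegE mP) sP.
split=> //; rewrite /weil_height (minpolyZE mP) dx; congr (ln _ / _).
rewrite /mahler_measure.
case: closed_field_poly_normal => rs /= rsE.
have lC0 : lead_coef (map_poly (intr : int -> R[i]) P) != 0.
  by rewrite lead_coef_pC lP intr_eq0 -lt0n.
have -> : Normc.normc (lead_coef (map_poly (intr : int -> R[i]) P)) = B%:R.
  by rewrite lead_coef_pC lP -[_%:~R](ratr_int R[i]) nm_ratr -intr_norm ratr_int.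
rewrite big_seq big1 ?mulr1// => z zrs; apply/max_idPl.
have zN : z ^+ N = A%:R / B%:R.
  have /rootP : root (map_poly (intr : int -> R[i]) P) z.
    by rewrite rsE rootZ// root_prod_XsubC.
  rewrite /P rmorphB /= map_polyZ map_polyXn map_polyC /= hornerD hornerN hornerZ.
  rewrite hornerXn hornerC => /eqP; rewrite subr_eq0 => /eqP zN.
  have BC : (B%:R : R[i]) != 0 by rewrite pnatr_eq0 -lt0n.
  by apply: (mulfI BC); rewrite [RHS]mulrCA divff// mulr1; exact: zN.
rewrite leNgt; apply/negP => z1; 
have : 1 < Normc.normc z ^+ N by rewrite exprn_egt1// -lt0n.
rewrite -nmX zN.
have -> : (A%:R / B%:R : R[i]) = ratr (A%:R / B%:R) by rewrite fmorph_div /= !rmorph_nat.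
rewrite nm_ratr normf_div !normr_nat fmorph_div /= !rmorph_nat ltNge => /negP; apply.
by rewrite ler_pdivrMr ?ltr0n// mul1r ler_nat.
Qed.

(** * The tower of the fields K_n *)

Section Tower.
Variables (R : realType) (p q d : nat -> nat).
Hypotheses (p_prime : forall i, prime (p i)) (q_prime : forall i, prime (q i)).
Hypotheses (d_prime : forall i, prime (d i)).
Hypotheses (p_incr : forall i j, (i < j)%N -> (p i < p j)%N).
Hypotheses (q_incr : forall i j, (i < j)%N -> (q i < q j)%N).
Hypotheses (d_incr : forall i j, (i < j)%N -> (d i < d j)%N).
Hypotheses (qp : forall i, (q i < p i.+1)%N) (pq : forall i, (p i < q i < 2 * p i)%N).
Local Notation C := R[i].

Definition alR i : R := ((p i)%:R / (q i)%:R) `^ ((d i)%:R^-1).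
Definition al i : C := ((alR i)%:C)%C.
Definition Dn n := (\prod_(j < n) d j)%N.
Definition An n := (\prod_(j < n) p j ^ (Dn n %/ d j))%N.
Definition Bn n := (\prod_(j < n) q j ^ (Dn n %/ d j))%N.
Definition rn n : rat := (An n)%:R / (Bn n)%:R.
Definition beR n : R := \prod_(j < n) alR j.
Definition be n : C := ((beR n)%:C)%C.

Let p_gt0 i : (0 < p i)%N. Proof. exact: prime_gt0. Qed.
Let q_gt0 i : (0 < q i)%N. Proof. exact: prime_gt0. Qed.
Let d_gt0 i : (0 < d i)%N. Proof. exact: prime_gt0. Qed.
Let ratio_gt0 i : 0 < ((p i)%:R / (q i)%:R : R).
Proof. by rewrite divr_gt0 ?ltr0n. Qed.

Lemma alR_gt0 i : 0 < alR i. Proof. exact: powR_gt0. Qed.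

Lemma alR_pow i : alR i ^+ d i = (p i)%:R / (q i)%:R.
Proof.
rewrite -powR_mulrn ?powR_ge0// -powRrM mulVf ?pnatr_eq0 -?lt0n//.
by rewrite powRr1// ltW.
Qed.

Lemma alR_lt1 i : alR i < 1.
Proof.
rewrite ltNge; apply/negP => h; have := exprn_ege1 (d i) h.
rewrite alR_pow leNgt ltr_pdivrMr ?ltr0n// mul1r ltr_nat.
by case/andP: (pq i) => ->.
Qed.

Lemma Dn_gt0 n : (0 < Dn n)%N. Proof. exact: prodn_gt0. Qed.
Lemma DnS n : Dn n.+1 = (d n * Dn n)%N. Proof. by rewrite /Dn big_ord_recr /= mulnC. Qed.

Lemma dvd_Dn n j : (j < n)%N -> (d j %| Dn n)%N.
Proof. by move=> jn; rewrite /Dn (bigD1 (Ordinal jn))//= dvdn_mulr. Qed.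

Lemma coprime_Dn n j : (n <= j)%N -> coprime (Dn n) (d j).
Proof.
move=> nj; rewrite coprime_sym; apply: coprime_prodn => i ni.
by rewrite prime_coprime// dvdn_prime2// gtn_eqF// d_incr// (leq_trans ni).
Qed.

Lemma beR_gt0 n : 0 < beR n.
Proof. by apply: prodr_gt0 => i _; apply: alR_gt0. Qed.

Lemma beRS n : beR n.+1 = beR n * alR n. Proof. by rewrite /beR big_ord_recr. Qed.

Lemma beR_le1 n : beR n <= 1.
Proof.
elim: n => [|n IH]; first by rewrite /beR big_ord0.
by rewrite beRS mulr_ile1 ?(ltW (beR_gt0 n)) ?(ltW (alR_gt0 n)) ?(ltW (alR_lt1 n)).
Qed.

Lemma beR_lt1 n : beR n.+1 < 1.
Proof.
rewrite beRS; apply: le_lt_trans (alR_lt1 n).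
by rewrite ler_piMl ?beR_le1// ltW// alR_gt0.
Qed.

Lemma beR_pow n : beR n ^+ Dn n = (An n)%:R / (Bn n)%:R.
Proof.
rewrite /beR -prodrXl /An /Bn !natr_prod -prodf_div; apply: eq_bigr => j _.
rewrite -{1}(divnK (dvd_Dn (ltn_ord j))) mulnC exprM alR_pow expr_div_n.
by rewrite !natrX.
Qed.

Lemma rn_gt0 n : 0 < rn n.
Proof. by rewrite divr_gt0// ltr0n prodn_gt0// => j; rewrite expn_gt0 ?p_gt0 ?q_gt0. Qed.

Lemma be_pow n : be n ^+ Dn n = ratr (rn n).
Proof.
rewrite /be -rmorphXn /= beR_pow fmorph_div /= !rmorph_nat.
by rewrite /rn fmorph_div /= !rmorph_nat.
Qed.

Lemma pq_neq i j : p i != q j.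
Proof.
case: (leqP i j) => ij.
  have := pq j; move: ij; rewrite leq_eqVlt => /orP[/eqP ->|/p_incr]; lia.
have := qp j; move: ij; rewrite leq_eqVlt => /orP[/eqP <-|/p_incr]; lia.
Qed.

Lemma p_inj i j : i != j -> p i != p j.
Proof. by case: (ltngtP i j) => // /p_incr h _; lia. Qed.
Lemma q_inj i j : i != j -> q i != q j.
Proof. by case: (ltngtP i j) => // /q_incr h _; lia. Qed.

(** The exponent of p_j in beta^D is D / d_j. Comparing p_j-adic valuations, D times an integer
    equals k D / d_j, so d_j divides k; the d_j are distinct primes. *)
Lemma pow_rn_dvd n (x : rat) k : 0 < x -> x ^+ Dn n = rn n ^+ k -> (Dn n %| k)%N.
Proof.
move=> x_gt0 xE; pose a := `|numq x|%N; pose b := `|denq x|%N.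
have a_gt0 : (0 < a)%N by rewrite absz_gt0 numq_eq0 gt_eqF.
have b_gt0 : (0 < b)%N by rewrite absz_gt0 denq_neq0.
have xab : x = a%:R / b%:R.
  rewrite -[LHS]divq_num_den; congr (_ / _).
    by rewrite -[in LHS](gez0_abs (_ : 0 <= numq x)) // numq_ge0 ltW.
  by rewrite -[in LHS]absz_denq.
have A_gt0 : (0 < An n)%N by apply: prodn_gt0 => j; rewrite expn_gt0 p_gt0.
have B_gt0 : (0 < Bn n)%N by apply: prodn_gt0 => j; rewrite expn_gt0 q_gt0.
have E : (a ^ Dn n * Bn n ^ k = b ^ Dn n * An n ^ k)%N.
  apply/eqP; rewrite -(eqr_nat rat) !natrM !natrX.
  move: xE; rewrite xab /rn !expr_div_n => /eqP.
  by rewrite eqr_div ?expf_neq0 ?pnatr_eq0 -?lt0n// => /eqP ->; rewrite mulrC.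
have dk j : (j < n)%N -> (d j %| k)%N.
  move=> jn; have := congr1 (logn (p j)) E.
  rewrite !lognM ?expn_gt0 ?a_gt0 ?b_gt0 ?A_gt0 ?B_gt0// !lognX.
  have -> : logn (p j) (Bn n) = 0%N.
    rewrite /Bn (@logn_prodn _ _ (fun i => q i ^ (Dn n %/ d i))%N) => [|i _]; last first.
      by rewrite expn_gt0 q_gt0.
    rewrite big1// => i _; by rewrite lognX logn_prime// (negPf (pq_neq _ _)) muln0.
  have -> : logn (p j) (An n) = (Dn n %/ d j)%N.
    rewrite /An (@logn_prodn _ _ (fun i => p i ^ (Dn n %/ d i))%N) => [|i _]; last first.
      by rewrite expn_gt0 p_gt0.
    rewrite (bigD1 (Ordinal jn))//= lognX logn_prime// eqxx muln1 big1 ?addn0// => i ij.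
    rewrite lognX logn_prime// eq_sym (negPf (p_inj _)) ?muln0//.
  rewrite -[in X in X -> _](divnK (dvd_Dn jn)) muln0 addn0.
  set e := (Dn n %/ d j)%N; have e_gt0 : (0 < e)%N by rewrite divn_gt0// dvdn_leq ?Dn_gt0 ?dvd_Dn.
  rewrite mulnK// => /eqP; rewrite -!mulnA [(k * e)%N]mulnC -mulnDr eqn_pmul2l// => /eqP h.
  have : (d j %| d j * logn (p j) b + k)%N by rewrite -h dvdn_mulr.
  by rewrite dvdn_addr// dvdn_mulr.
have : forall n', (n' <= n)%N -> (Dn n' %| k)%N.
  elim=> [|n' IH] n'n; first by rewrite /Dn big_ord0 dvd1n.
  rewrite DnS Gauss_dvd ?dk ?IH// 1?ltnW//.
  by rewrite coprime_sym coprime_Dn.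
exact.
Qed.

Lemma irred_rn n : irreducible_poly ('X^(Dn n) - (rn n)%:P).
Proof. by apply: (@irred_XnsubC R) (@pow_rn_dvd n); [apply: Dn_gt0|apply: rn_gt0]. Qed.

Definition Kn n : set C := [set x | exists g, x = evalQ g (be n)].

Lemma be_root n : evalQ ('X^(Dn n) - (rn n)%:P) (be n) = 0.
Proof. by rewrite evalQB evalQXn evalQC be_pow subrr. Qed.

Let T0 n : ('X^(Dn n) - (rn n)%:P : {poly rat}) != 0.
Proof. by rewrite -size_poly_gt0 size_XnsubC ?Dn_gt0. Qed.

Lemma KnC n c : Kn n (ratr c). Proof. by exists c%:P; rewrite evalQC. Qed.
Lemma KnB n x y : Kn n x -> Kn n y -> Kn n (x - y).
Proof. by move=> [g ->] [h ->]; exists (g - h); rewrite evalQB. Qed.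
Lemma KnM n x y : Kn n x -> Kn n y -> Kn n (x * y).
Proof. by move=> [g ->] [h ->]; exists (g * h); rewrite evalQM. Qed.
Lemma KnX n x k : Kn n x -> Kn n (x ^+ k).
Proof. by move=> [g ->]; exists (g ^+ k); rewrite evalQ_exp. Qed.
Lemma KnV n x : Kn n x -> Kn n x^-1.
Proof.
move=> [g ->]; have [->|g0] := eqVneq (evalQ g (be n)) 0.
  by exists 0; rewrite invr0 /evalQ rmorph0 horner0.
have [h hg] := evalQ_inv (T0 n) (be_root n) g0; exists h.
by apply: (mulIf g0); rewrite hg mulVf.
Qed.
Lemma Kn_be n : Kn n (be n). Proof. by exists 'X; rewrite evalQX. Qed.
Lemma Kn_evalQ n g x : Kn n x -> Kn n (evalQ g x).
Proof. by move=> [h ->]; exists (g \Po h); rewrite evalQ_comp. Qed.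

Lemma beS n : be n.+1 = be n * al n.
Proof. by rewrite /be beRS rmorphM. Qed.
Lemma al_pow n : al n ^+ d n = ratr ((p n)%:R / (q n)%:R).
Proof. by rewrite /al -rmorphXn /= alR_pow !fmorph_div /= !rmorph_nat. Qed.
Let al_neq0 n : al n != 0.
Proof. by rewrite /al fmorph_eq0 gt_eqF// alR_gt0. Qed.

(** The powers of [al n] with the coprime exponents D_n and d_n both lie in the field: the first is
    beta_(n+1)^(D_n) / r_n, the second is rational. *)
Lemma Kn_al n : Kn n.+1 (al n).
Proof.
have KaD : Kn n.+1 (al n ^+ Dn n).
  have -> : al n ^+ Dn n = be n.+1 ^+ Dn n / ratr (rn n).
    by rewrite beS exprMn be_pow mulrAC divff ?mul1r// fmorph_eq0 gt_eqF// rn_gt0.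
  by apply: KnM; [apply/KnX/Kn_be|apply/KnV/KnC].
have [u v uv _] := egcdnP (d n) (Dn_gt0 n).
rewrite (eqP (coprime_Dn (leqnn n))) in uv.
have -> : al n = (al n ^+ Dn n) ^+ u / ratr ((p n)%:R / (q n)%:R) ^+ v.
  rewrite -exprM mulnC uv exprD expr1 mulnC exprM al_pow mulrAC divff ?mul1r//.
  by rewrite expf_neq0// -al_pow expf_neq0.
by apply: KnM; [apply/KnX|apply/KnV/KnX/KnC].
Qed.

Lemma Kn_mono n m x : (n <= m)%N -> Kn n x -> Kn m x.
Proof.
move=> nm; elim: m nm => [|m IH]; first by rewrite leqn0 => /eqP ->.
rewrite leq_eqVlt => /orP[/eqP ->//|]; rewrite ltnS => /IH h /h [g ->].
apply: Kn_evalQ; have -> : be m = be m.+1 / al m by rewrite beS mulfK.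
by apply: KnM; [apply: Kn_be|apply/KnV/Kn_al].
Qed.

(** [adjoinQ] is tested on the union of the K_n, a subfield because the K_n increase. *)
Lemma rootfield_Kn a : rootfield p q d a -> exists n, Kn n a.
Proof.
move=> La; suff /asboolP : a \in [pred y | `[< exists n, Kn n y >]] by [].
apply: La; last by move=> _ [i _ <-]; apply/asboolP; exists i.+1; apply: Kn_al.
split.
- by apply/asboolP; exists 0%N; rewrite -(rmorph1 (ratr : rat -> C)); apply: KnC.
- move=> x y /asboolP[n Kx] /asboolP[m Ky]; apply/asboolP; exists (maxn n m).
  by apply: KnB; [apply: Kn_mono Kx; apply: leq_maxl|apply: Kn_mono Ky; apply: leq_maxr].
- move=> x y /asboolP[n Kx] /asboolP[m Ky]; apply/asboolP; exists (maxn n m).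
  apply: KnM; first by apply: Kn_mono Kx; apply: leq_maxl.
  by apply/KnV; apply: Kn_mono Ky; apply: leq_maxr.
Qed.

Lemma rootfield_al i : rootfield p q d (al i).
Proof. by move=> A _; apply; exists i. Qed.

Lemma rootfield_be n : rootfield p q d (be n).
Proof.
move=> A [A1 AB AV] Agen; elim: n => [|n IH].
  by rewrite /be /beR big_ord0 rmorph1.
have aA : al n \in A by apply: Agen; exists n.
by rewrite beS -[al n]invrK; apply: (AV _ _ IH); rewrite -[_^-1]mul1r; apply: (AV _ _ A1).
Qed.

Lemma Kn_conj n D : D = Dn n -> exists (lam : 'I_D -> C) k0,
  [/\ injective lam, forall k, lam k ^+ D = ratr (rn n),
      forall z, z ^+ D = ratr (rn n) -> exists k, z = lam k & lam k0 = be n].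
Proof.
move=> ->; have r0 : (ratr (rn n) : C) != 0 by rewrite fmorph_eq0 gt_eqF// rn_gt0.
have [lam [inj lamr surj]] := roots_XnsubC (Dn_gt0 n) r0.
by have [k0 k0E] := surj _ (be_pow n); exists lam, k0.
Qed.

Lemma Kn_minpoly n a : Kn n a -> exists P, is_minpolyZ a P.
Proof.
move=> [f ->]; have [lam [k0 [inj lamr surj <-]]] := Kn_conj (erefl (Dn n)).
have Tlam k : evalQ ('X^(Dn n) - (rn n)%:P) (lam k) = 0.
  by rewrite evalQB evalQXn evalQC lamr subrr.
have [chi chiE] := conj_charpoly f (size_XnsubC _ (Dn_gt0 n)) inj Tlam.
apply: (@is_minpolyZ_exists _ _ chi).
  rewrite -(map_poly_eq0 (ratr : {rmorphism rat -> C})) chiE.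
  exact: monic_neq0 (monic_prod_XsubC _ _ _).
by rewrite /evalQ chiE horner_prod (bigD1 k0)//= hornerXsubC subrr mul0r.
Qed.

Lemma Kn_algdeg n a : Kn n a -> (algdeg a <= Dn n)%N.
Proof.
move=> Ka; have [P mP] := Kn_minpoly Ka; case: Ka mP => f ->.
have [lam [k0 [inj lamr surj <-]]] := Kn_conj (erefl (Dn n)) => mP.
have [e [DE _ _ _]] := conj_minpoly (Dn_gt0 n) (@irred_rn n) inj lamr mP.
rewrite (algdegE mP) [leqRHS]DE; case: e DE => [|e _]; last by rewrite mulnS leq_addr.
by rewrite muln0 => D0; have := Dn_gt0 n; rewrite D0.
Qed.

Lemma coprime_l_An l n k : prime l -> (forall j, (j < n)%N -> p j != l) ->
  coprime l (\prod_(j < n) p j ^ (Dn k %/ d j)).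
Proof.
move=> l_prime pl; apply: (@coprime_prodn l n (fun j => p j ^ (Dn k %/ d j))%N) => j jn.
by rewrite coprimeXr// prime_coprime// dvdn_prime2// eq_sym pl.
Qed.

Lemma coprime_l_Bn l n k : prime l -> (forall j, (j < n)%N -> q j != l) ->
  coprime l (\prod_(j < n) q j ^ (Dn k %/ d j)).
Proof.
move=> l_prime pl; apply: (@coprime_prodn l n (fun j => q j ^ (Dn k %/ d j))%N) => j jn.
by rewrite coprimeXr// prime_coprime// dvdn_prime2// eq_sym pl.
Qed.

(** If all components of nonzero index vanished, a would be a polynomial in beta_(n+1)^(d_n) =
    beta_n^(d_n) p_n / q_n and lie in K_n. The hypothesis d_n < p_n makes p_n and q_n prime to d_n
    and to D_n. *)
Lemma Kn_lower n a : (d n < p n)%N -> Kn n.+1 a -> ~ Kn n a ->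
  (d n <= algdeg a <= Dn n.+1)%N /\
  ln (p n * q n)%:R / (2 * (d n)%:R) - ln (d n)%:R / (d n).-1%:R <= weil_height a.
Proof.
move=> dp Ka nKa; have [P mP] := Kn_minpoly Ka; case: Ka => f aE.
pose g := f %% ('X^(Dn n.+1) - (rn n.+1)%:P).
have {}aE : a = evalQ g (be n.+1).
  rewrite aE {1}(divp_eq f ('X^(Dn n.+1) - (rn n.+1)%:P)) evalQD evalQM be_root.
  by rewrite mulr0 add0r.
have sg : (size g <= d n * Dn n)%N.
  by rewrite -DnS -ltnS -(size_XnsubC (rn n.+1) (Dn_gt0 n.+1)) ltn_modp.
have [i1 [i10 ci1]] : exists i1 : 'I_(d n), val i1 != 0%N /\ polycomp (d n) i1 g != 0.
  apply: contrapT => nex; apply: nKa.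
  have c0 (i : 'I_(d n)) : val i != 0%N -> polycomp (d n) i g = 0.
    by move=> i0; apply: contrapT => /eqP ci; apply: nex; exists i.
  rewrite aE (polycompE g (d_gt0 n)) evalQ_sum (bigD1 (Ordinal (d_gt0 n)))//= big1 ?addr0.
    rewrite evalQM evalQ_comp !evalQXn expr0 mul1r beS exprMn al_pow.
    by apply/Kn_evalQ/KnM; [apply/KnX/Kn_be|apply: KnC].
  move=> i i0; rewrite c0 ?comp_poly0 ?mulr0; first by rewrite /evalQ rmorph0 horner0.
  by apply: contraNneq i0 => i0; apply/eqP/val_inj.
have [lam [k0 [inj lamr surj k0E]]] := Kn_conj (esym (DnS n)).
rewrite -k0E in aE; rewrite aE in mP *.
have AE : An n.+1 = (p n ^ Dn n * \prod_(j < n) p j ^ (Dn n.+1 %/ d j))%N.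
  by rewrite /An big_ord_recr /= {2}DnS mulKn ?d_gt0// mulnC.
have BE : Bn n.+1 = (q n ^ Dn n * \prod_(j < n) q j ^ (Dn n.+1 %/ d j))%N.
  by rewrite /Bn big_ord_recr /= {2}DnS mulKn ?d_gt0// mulnC.
have cpD l : prime l -> (d n < l)%N -> coprime l (Dn n).
  move=> l_prime dl; apply: coprime_prodn => j jn.
  by rewrite prime_coprime// dvdn_prime2// gtn_eqF// (ltn_trans (d_incr jn)).
have dq : (d n < q n)%N by case/andP: (pq n) => h _; apply: ltn_trans h.
have lamE k : lam k ^+ (d n * Dn n) = (An n.+1)%:R / (Bn n.+1)%:R.
  by rewrite lamr /rn fmorph_div /= !rmorph_nat.
have nle j : (j < n)%N -> (j != n) by move=> jn; rewrite ltn_eqF.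
rewrite DnS; apply: (height_lower (r := rn n.+1) (P := P) (i1 := i1) (lam := lam)) => //.
- exact: Dn_gt0.
- by rewrite gt_eqF// rn_gt0.
- rewrite -DnS; exact: irred_rn.
- exact: pq_neq.
- by rewrite prime_coprime// dvdn_prime2// gtn_eqF.
- move=> k; apply: (ramdataI (p_prime n) (Dn_gt0 n)
    (A' := \prod_(j < n) p j ^ (Dn n.+1 %/ d j)) (B' := Bn n.+1)).
  + by rewrite lamE AE.
  + by apply: coprime_l_An => // j jn; apply/p_inj/nle.
  + by apply: coprime_l_Bn => // j jn; rewrite eq_sym pq_neq.
  + exact: cpD.
(* q_n divides the denominator of beta^D, so the inverse root takes the role of pi and [An], [Bn]
   change places. *)
- move=> k; apply: (ramdataI (q_prime n) (Dn_gt0 n)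
    (A' := \prod_(j < n) q j ^ (Dn n.+1 %/ d j)) (B' := An n.+1)).
  + by rewrite exprVn lamE invf_div BE.
  + by apply: coprime_l_Bn => // j jn; apply/q_inj/nle.
  + by apply: coprime_l_An => // j jn; rewrite pq_neq.
  + exact: cpD.
Qed.

Lemma be_height n : algdeg (be n) = Dn n /\
  weil_height (be n) = \sum_(j < n) ln (q j)%:R / (d j)%:R.
Proof.
have A_gt0 : (0 < An n)%N by apply: prodn_gt0 => j; rewrite expn_gt0 p_gt0.
have B_gt0 : (0 < Bn n)%N by apply: prodn_gt0 => j; rewrite expn_gt0 q_gt0.
have AB : (An n <= Bn n)%N.
  apply: leq_prod => j _; case: (Dn n %/ d j)%N => // e.
  by rewrite leq_exp2r//; case/andP: (pq j) => /ltnW.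
have cAB : coprime (An n) (Bn n).
  apply: (@coprime_prodn _ n (fun j => q j ^ (Dn n %/ d j))%N) => j _.
  rewrite coprimeXr// coprime_sym.
  by apply: coprime_l_An => // i _; apply: pq_neq.
have xN : be n ^+ Dn n = (An n)%:R / (Bn n)%:R.
  by rewrite be_pow /rn fmorph_div /= !rmorph_nat.
have AAB : (0 < An n <= Bn n)%N by rewrite A_gt0.
have [-> ->] := radical_height (Dn_gt0 n) AAB cAB xN (@irred_rn n).
split=> //.
have -> : ln ((Bn n)%:R : R) = \sum_(j < n) (Dn n %/ d j)%:R * ln (q j)%:R.
  rewrite /Bn natr_prod; move: (Dn n) => D.
  have gen m : ln (\prod_(j < m) ((q j ^ (D %/ d j))%:R : R)) = \sum_(j < m) (D %/ d j)%:R * ln (q j)%:R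
       /\ 0 < \prod_(j < m) ((q j ^ (D %/ d j))%:R : R).
    elim: m => [|m [IH IH0]]; first by rewrite !big_ord0 ln1.
    have qm : 0 < ((q m ^ (D %/ d m))%:R : R) by rewrite ltr0n expn_gt0 q_gt0.
    rewrite !big_ord_recr /= mulr_gt0// lnM ?posrE// IH natrX lnXn ?ltr0n//.
    by rewrite mulr_natl.
  by case: (gen n).
rewrite mulr_suml; apply: eq_bigr => j _; rewrite mulrAC mulrC; congr (_ * _).
have -> : ((Dn n)%:R : R) = (Dn n %/ d j)%:R * (d j)%:R by rewrite -natrM divnK ?dvd_Dn.
rewrite invfM mulrA divff ?mul1r// pnatr_eq0 -lt0n divn_gt0 ?d_gt0//.
by rewrite dvdn_leq ?Dn_gt0 ?dvd_Dn.
Qed.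

Lemma be_not_unity n A : ~ roots_of_unity A (be n.+1).
Proof.
move=> [_ [k k_gt0]]; rewrite unity_rootE /be -rmorphXn /= -(rmorph1 (real_complex R)).
move=> /eqP/(@complexI R) E; move: k_gt0 E; case: k => // k _ E.
have : beR n.+1 ^+ k.+1 < 1.
  rewrite exprSr; apply: le_lt_trans (beR_lt1 n); rewrite ler_piMl ?(ltW (beR_gt0 _))//.
  by rewrite exprn_ile1// ?beR_le1// ltW// beR_gt0.
by rewrite E ltxx.
Qed.

End Tower.

(** * Growth estimates and counting functions *)

Section Analysis.
Variable R : realType.
Implicit Types (x s M : R).

Lemma ln_ltr_powR x s : 0 < x -> 0 < s -> s * ln x < x `^ s.
Proof. by move=> x0 s0; rewrite -ln_powR; apply: ln_sublinear; apply: powR_gt0. Qed.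

(** The square is what f = 1 / log costs: an error of size log x / x^s has to stay below a multiple
    of 1 / log x. *)
Lemma eventually_powR s M : 0 < s -> exists X : R, forall x, X <= x ->
  [/\ 1 <= ln x, M <= ln x & M * ln x ^+ 2 <= x `^ s].
Proof.
(* x^s = x^(2t) (x^t)^2, where x^t >= t log x yields the square of the logarithm, and x^(2t) >= 2 t
   log x exceeds the required constant once log x >= c. *)
move=> s0; pose t := s / 4; have t0 : 0 < t by rewrite divr_gt0.
pose M' := Num.max M 0; have M'0 : 0 <= M' by rewrite le_max lexx orbT.
have MM' : M <= M' by rewrite le_max lexx.
pose c := M' / (t ^+ 2 * (2 * t)).
have c0 : 0 <= c by rewrite divr_ge0// !mulr_ge0// ?exprn_ge0// ltW.
exists (expR (1 + M' + c)) => x Xx.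
have x0 : 0 < x := lt_le_trans (expR_gt0 _) Xx.
have lnx : 1 + M' + c <= ln x by rewrite -ler_expR lnK.
have l1 : 1 <= ln x by lra.
split=> //; first by lra.
have h1 := ltW (ln_ltr_powR x0 t0).
have h2 : (2 * t) * ln x <= x `^ (2 * t) by rewrite ltW// ln_ltr_powR// mulr_gt0.
have -> : x `^ s = x `^ (2 * t) * x `^ t ^+ 2.
  rewrite -powR_mulrn ?powR_ge0// -powRrM -powRD; last by rewrite (gt_eqF x0) implybT.
  by congr (_ `^ _); rewrite /t; field.
have h3 : M' / t ^+ 2 <= x `^ (2 * t).
  apply: le_trans h2; have -> : M' / t ^+ 2 = (2 * t) * c by rewrite /c; field; rewrite gt_eqF.
  by rewrite ler_wpM2l// ?mulr_ge0 ?(ltW t0)//; lra.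
apply: (@le_trans _ _ (M' * ln x ^+ 2)); first by rewrite ler_wpM2r// exprn_ge0// (le_trans ler01).
have -> : M' * ln x ^+ 2 = M' / t ^+ 2 * (t * ln x) ^+ 2 by field; rewrite gt_eqF.
apply: ler_pM => //; first by rewrite divr_ge0// exprn_ge0// ltW.
  by rewrite exprn_ge0// mulr_ge0 ?(ltW t0)// (le_trans ler01).
by apply: lerXn2r; rewrite ?nnegrE ?powR_ge0// mulr_ge0 ?(ltW t0)// (le_trans ler01).
Qed.

Lemma Ncount_lty (g : R) (A : set R[i]) (C : R) :
  finite_set [set a | A a /\ wheight g a < C] -> (Ncount g A C < +oo)%E.
Proof. by move=> fA; rewrite /Ncount /counting asboolT// ltry. Qed.

Lemma Ncount_infinite (g : R) (A : set R[i]) (C : R) :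
  ~ finite_set [set a | A a /\ wheight g a < C] -> Ncount g A C = +oo%E.
Proof. by move=> fA; rewrite /Ncount /counting asboolF. Qed.

Lemma has_N_has_B (g : R) (A : set R[i]) : has_N g A -> has_B g A.
Proof.
move=> hN; exists 1; rewrite ?ltr01//; apply: Ncount_lty.
have : finite_set [set a | A a /\ wheight g a < 1].
  by apply: contrapT => /Ncount_infinite h; have := hN 1 ltr01; rewrite h.
by apply: sub_finite_set => a /= [[Aa _] ha].
Qed.

Lemma wheight_shift (g g' : R) (a : R[i]) : (0 < algdeg a)%N ->
  wheight g' a = (algdeg a)%:R `^ (g' - g) * wheight g a.
Proof.
move=> n0; rewrite /wheight mulrA -powRD ?subrK//.
by rewrite pnatr_eq0 -lt0n n0 implybT.
Qed.
End Analysis.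

(** * Weighted heights in L *)

Section Main.
Variables (R : realType) (g c : R) (p q d : nat -> nat) (f : R -> R).
Hypotheses (g_lt1 : g < 1) (c_gt0 : 0 < c).
Hypotheses (p_prime : forall i, prime (p i)) (q_prime : forall i, prime (q i)).
Hypotheses (d_prime : forall i, prime (d i)).
Hypotheses (p_incr : forall i j, (i < j)%N -> (p i < p j)%N).
Hypotheses (q_incr : forall i j, (i < j)%N -> (q i < q j)%N).
Hypotheses (d_incr : forall i j, (i < j)%N -> (d i < d j)%N).
Hypotheses (qp : forall i, (q i < p i.+1)%N) (pq : forall i, (p i < q i < 2 * p i)%N).
Hypothesis f_cases : [\/ f = (fun x : R => ln x), f = (fun _ : R => c)
               | f = (fun x : R => 1 / ln x)].
Hypothesis hyp_nonneg : 0 <= g -> forall i,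
     let E := expR (f (d i)%:R * (d i)%:R `^ (1 - g)) in
     E <= (p i)%:R <= 2 * E.
Hypothesis hyp_neg : g < 0 -> forall i,
     let E := expR (f (d i)%:R * (\prod_(j < i) (d j)%:R) `^ (- g) *
                    (d i)%:R `^ (1 - g)) in
     E <= (p i)%:R <= 2 * E.
Hypothesis hyp_lim : g < 0 ->
     (i.+1%:R * ln (d i)%:R / (d i)%:R `^ (- g) : R) @[i --> \oo] --> (0 : R).

Local Notation C := R[i].
Let L : set C := rootfield p q d.
Local Notation K := (@Kn R p q d).
Local Notation x_ i := ((d i)%:R : R).
Local Notation D := (Dn d).

Let d_ge i : (i < d i)%N.
Proof. by elim: i => [|i IH]; [apply: prime_gt0|apply: leq_ltn_trans IH (d_incr _)]. Qed.
Let x_ge2 i : 2 <= x_ i. Proof. by rewrite (ler_nat R 2) prime_gt1. Qed.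
Let x_gt0 i : 0 < x_ i. Proof. by apply: lt_le_trans (x_ge2 i). Qed.
Let x_ge1 i : 1 <= x_ i. Proof. by apply: le_trans (x_ge2 i); lra. Qed.
Let l2 : 0 < ln 2 :> R. Proof. by rewrite ln_gt0// ltr1n. Qed.
Let l2x i : ln 2 <= ln (x_ i). Proof. by rewrite ler_ln ?posrE. Qed.
Let lx_gt0 i : 0 < ln (x_ i). Proof. exact: lt_le_trans (l2x i). Qed.
Let p_gt0 i : 0 < ((p i)%:R : R). Proof. by rewrite ltr0n prime_gt0. Qed.
Let q_gt0 i : 0 < ((q i)%:R : R). Proof. by rewrite ltr0n prime_gt0. Qed.

Let d_ev (X : R) : exists i0, forall i, (i0 <= i)%N -> X <= x_ i.
Proof.
exists (Num.truncn X).+1 => i le_i.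
apply: ltW; apply: lt_le_trans (real_truncnS_gt (num_real X)) _.
by rewrite ler_nat (leq_trans le_i)// ltnW.
Qed.

(** Together with [f_up]: in all three cases f(x) lies between multiples of 1 / log x and log x. For
    exponents other than g nothing more about f matters. *)
Let f_low : exists2 k : R, 0 < k & forall i, k <= f (x_ i) * ln (x_ i).
Proof.
case: f_cases => ->.
- exists (ln 2 ^+ 2); rewrite ?exprn_gt0// => i; rewrite expr2.
  by apply: ler_pM; rewrite ?(ltW l2).
- exists (c * ln 2); rewrite ?mulr_gt0// => i.
  by rewrite ler_wpM2l// ltW.
- by exists 1 => // i; rewrite mul1r mulVf// gt_eqF.
Qed.

Let f_up : exists2 k : R, 0 < k & forall i j, (j <= i)%N -> f (x_ j) <= k * ln (x_ i).
Proof.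
have mono i j : (j <= i)%N -> ln (x_ j) <= ln (x_ i).
  move=> ji; rewrite ler_ln ?posrE// ler_nat.
  by move: ji; rewrite leq_eqVlt => /orP[/eqP->//|/d_incr/ltnW].
case: f_cases => ->.
- by exists 1 => // i j ji; rewrite mul1r mono.
- exists (c / ln 2); rewrite ?divr_gt0// => i j ji.
  by rewrite mulrAC ler_pdivlMr// ler_wpM2l// ltW.
- exists (1 / ln 2 ^+ 2); rewrite ?divr_gt0 ?exprn_gt0// => i j ji.
  apply: (@le_trans _ _ (ln 2)^-1); first by rewrite mul1r lef_pV2 ?posrE.
  have -> : (ln 2)^-1 = 1 / ln 2 ^+ 2 * ln 2 :> R by field; rewrite gt_eqF.
  by rewrite ler_wpM2l// divr_ge0// exprn_ge0// ltW.
Qed.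

Let f_gt0 i : 0 < f (x_ i).
Proof. by have [k k0 /(_ i) h] := f_low; rewrite -(pmulr_lgt0 _ (lx_gt0 i)); apply: lt_le_trans h. Qed.

Let D_gt0 n : 0 < ((D n)%:R : R). Proof. by rewrite ltr0n; apply: Dn_gt0. Qed.
Let D_ge1 n : 1 <= ((D n)%:R : R). Proof. by rewrite ler1n; apply: Dn_gt0. Qed.

Let D_dvd i j : (j <= i)%N -> (D j %| D i)%N.
Proof.
elim: i => [|i IH]; first by rewrite leqn0 => /eqP ->.
by rewrite leq_eqVlt => /orP[/eqP->//|/IH h]; rewrite [D i.+1]DnS dvdn_mull.
Qed.

(** [E] is the prescribed exponent of p_i. For g < 0 the factors (d_1 ... d_(i-1))^(-g) d_i^(1-g)
    merge into D^(-g) d_i, where D already includes d_i. The lower bound f(d_i) d_i^(1-g) holds for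
    both signs. *)
Let ln_p i : exists2 E, f (x_ i) * x_ i `^ (1 - g) <= E &
  [/\ E <= ln (p i)%:R, ln (p i)%:R <= ln 2 + E,
      0 <= g -> E = f (x_ i) * x_ i `^ (1 - g)
    & g < 0 -> E = f (x_ i) * (D i.+1)%:R `^ (- g) * x_ i].
Proof.
have lnE (E : R) : expR E <= (p i)%:R <= 2 * expR E -> E <= ln (p i)%:R /\ ln (p i)%:R <= ln 2 + E.
  move=> /andP[h1 h2]; split; first by rewrite -ler_expR lnK ?posrE.
  by rewrite -[in leRHS](expRK E) -lnM ?posrE ?expR_gt0// ler_ln ?posrE ?mulr_gt0 ?expR_gt0.
case: (leP 0 g) => g0.
  have [h1 h2] := lnE _ (hyp_nonneg g0 i).
  by exists (f (x_ i) * x_ i `^ (1 - g)) => //; split=> // /(le_lt_trans g0); rewrite ltxx.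
have [h1 h2] := lnE _ (hyp_neg g0 i); rewrite -natr_prod -/(D i) in h1 h2.
exists (f (x_ i) * (D i)%:R `^ (- g) * x_ i `^ (1 - g)).
  rewrite ler_wpM2r ?powR_ge0// ler_peMr ?(ltW (f_gt0 i))//.
  by rewrite -[leLHS](powRr0 (D i)%:R); apply: ler_powR => //; lra.
split=> // _.
rewrite DnS natrM powRM ?(ltW (x_gt0 _)) ?(ltW (D_gt0 _))//.
rewrite [1 - g]addrC powRD ?powRr1 ?(ltW (x_gt0 _)) ?(gt_eqF (x_gt0 _)) ?implybT//; ring.
Qed.

Let ln_q i : ln (q i)%:R <= ln 2 + ln (p i)%:R :> R.
Proof.
rewrite -lnM ?posrE// ler_ln ?posrE ?mulr_gt0// -(natrM R 2) ler_nat.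
by case/andP: (pq i) => _ /ltnW.
Qed.

(* [dl] is 1 - max(g, 0). *)
Let lower : exists2 dl : R, 0 < dl <= 1 - g & forall i a, (d i < p i)%N ->
  K i.+1 a -> ~ K i a -> (d i <= algdeg a)%N /\
  f (x_ i) - 2 * ln (x_ i) / x_ i `^ dl <= wheight g a.
Proof.
exists (if 0 <= g then 1 - g else 1).
  case: ifPn => g0; first by rewrite subr_gt0 g_lt1 lexx.
  by rewrite ltr01 /= lerBrDr gerDl ltW// ltNge.

move=> i a dp Ka nKa.
have [/andP[n1 n2] hh] : (d i <= algdeg a <= D i.+1)%N /\
    ln (p i * q i)%:R / (2 * x_ i) - ln (x_ i) / (d i).-1%:R <= weil_height a.
  exact: Kn_lower.
have [P mP] : exists P, is_minpolyZ a P by eapply (@Kn_minpoly R p q d); eassumption.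
split=> //; have h0 := weil_height_ge0 mP.
have [E fE [pE _ E0 E1]] := ln_p i.
have hE : E / x_ i - 2 * ln (x_ i) / x_ i <= weil_height a.
  apply: le_trans hh; apply: lerB.
    rewrite natrM lnM ?posrE// ler_pdivrMr//.
    have -> : (ln (p i)%:R + ln (q i)%:R) / (2 * x_ i) * x_ i = (ln (p i)%:R + ln (q i)%:R) / 2 :> R.
      by field; rewrite gt_eqF.
    have : ln (p i)%:R <= ln (q i)%:R :> R.
      by rewrite ler_ln ?posrE// ler_nat; case/andP: (pq i) => /ltnW.
    by lra.
  (* As d >= 2, log d / (d - 1) <= 2 log d / d. *)
  have d1 : 0 < ((d i).-1%:R : R) by rewrite ltr0n -ltnS prednK ?prime_gt0 ?prime_gt1.
  have dE : x_ i = (d i).-1%:R + 1 by rewrite natr1 prednK ?prime_gt0.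
  rewrite ler_pdivrMr// mulrAC ler_pdivlMr// -mulrA mulrCA ler_pM2l//.
  by have h := x_ge2 i; rewrite dE in h *; lra.
(* The weight deg^g is at least d^g for g >= 0, from the lower bound on the degree, and at least D^g
   for g < 0, from the upper one. In the second case D^(-g) in the exponent of p_i compensates
   it. *)
case: ifPn => g0.
  apply: (@le_trans _ _ (x_ i `^ g * weil_height a)); last first.
    by rewrite ler_wpM2r// ge0_ler_powR ?nnegrE ?ler_nat ?(ltW (x_gt0 i)).
  apply: le_trans (ler_wpM2l (powR_ge0 _ _) hE).
  rewrite (E0 g0) powRB ?(gt_eqF (x_gt0 i)) ?implybT// powRr1 ?(ltW (x_gt0 i))//.
  have xg0 : x_ i `^ g != 0 by rewrite gt_eqF// powR_gt0.
  rewrite le_eqVlt; apply/orP; left; apply/eqP; field.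
  by rewrite xg0 gt_eqF.
rewrite -ltNge in g0; set W : R := (D i.+1)%:R `^ (- g).
have W1 : 1 <= W by rewrite -[leLHS](powRr0 (D i.+1)%:R); apply: ler_powR => //; lra.
have W0 : 0 < W by apply: lt_le_trans W1.
apply: (@le_trans _ _ (W^-1 * weil_height a)); last first.
  have e (z : R) : z `^ g = (z `^ (- g))^-1 by rewrite -powRN opprK.
  have n0 : 0 < ((algdeg a)%:R : R) by rewrite ltr0n (leq_trans _ n1) ?prime_gt0.
  rewrite ler_wpM2r// e lef_pV2 ?posrE ?powR_gt0//.
  by rewrite ge0_ler_powR ?nnegrE ?ler_nat ?oppr_ge0 ?(ltW g0).
apply: le_trans (ler_wpM2l _ hE); last by rewrite invr_ge0 ltW.
rewrite (E1 g0) powRr1 ?(ltW (x_gt0 i))// mulrBr; apply: lerB.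
  rewrite le_eqVlt; apply/orP; left; apply/eqP; rewrite -/W; field.
  by rewrite !gt_eqF.
rewrite ler_piMl ?invf_le1 ?divr_ge0 ?mulr_ge0 ?(ltW (lx_gt0 i)) ?(ltW (x_gt0 i))//.
Qed.

Let p_gt_d : exists i0, forall i, (i0 <= i)%N -> (d i < p i)%N.
Proof.
have [k k0 fk] := f_low; have g1 : 0 < 1 - g by rewrite subr_gt0.
have [X hX] := eventually_powR (2 / k) g1; have [i0 hi0] := d_ev X.
exists i0 => i /hi0/hX [l1 _ h]; rewrite -(ltr_nat R) -ltr_ln ?posrE//.
have [E fE [pE _ _ _]] := ln_p i; apply: lt_le_trans (le_trans fE pE).
have h2 : 2 * ln (x_ i) ^+ 2 <= k * x_ i `^ (1 - g).
  by move: h; rewrite mulrAC ler_pdivrMr// [X in _ <= X -> _]mulrC.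
rewrite -(ltr_pM2r (lx_gt0 i)).
apply: (@lt_le_trans _ _ (2 * ln (x_ i) ^+ 2)).
  by rewrite expr2 ltr_pMl ?mulr_gt0// ltr1n.
apply: le_trans h2 _; rewrite mulrAC; apply: ler_wpM2r; rewrite ?powR_ge0//.
Qed.

(** Every element of L below B already lies in K_i0: otherwise it would be new at some later level.
    In K_i0 the degree is at most D_i0, and Northcott's theorem applies. *)
Let fin_from_lower (g' B : R) :
  (exists i0, forall i a, (i0 <= i)%N -> K i.+1 a -> ~ K i a -> B <= wheight g' a) ->
  finite_set [set a | L a /\ wheight g' a < B].
Proof.
move=> [i0 h].
apply: sub_finite_set (northcott_finite g' B (D i0)) => a /= [La ha].
have [n Kna] : exists n, K n a by apply: rootfield_Kn.
have Ki0 : K i0 a.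
  apply: contrapT => nK; suff : ~ K (i0 + n)%N a.
    by apply; eapply Kn_mono; try eassumption; rewrite leq_addl.
  elim: n {Kna} => [|n IH]; first by rewrite addn0.
  move=> Ka; have := h (i0 + n)%N a (leq_addr _ _); rewrite -addnS => /(_ Ka IH).
  by rewrite leNgt ha.
by split=> //; [eapply (@Kn_minpoly R p q d); eassumption|eapply (@Kn_algdeg R p q d); eassumption].
Qed.

(** The degrees of the y i are at least d_i > i, hence unbounded, so no finite set contains a tail
    of the sequence. *)
Let inf_from_upper (y : nat -> C) (g' B : R) :
  (forall i, [/\ L (y i), ~ roots_of_unity L (y i) & (d i <= algdeg (y i))%N]) ->
  (exists i0, forall i, (i0 <= i)%N -> wheight g' (y i) < B) ->
  ~ finite_set [set a | (L `\` roots_of_unity L) a /\ wheight g' a < B].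
Proof.
move=> hy [i0 h] /finite_seqP[s sE].
pose i := (i0 + \max_(z <- s) algdeg z)%N.
have ys : y i \in s.
  have : [set a | (L `\` roots_of_unity L) a /\ wheight g' a < B] (y i).
    by have [h1 h2 _] := hy i; split=> //; apply: h; rewrite leq_addr.
  by rewrite sE.
have [_ _ di] := hy i; have := d_ge i; rewrite ltnNge => /negP; apply.
apply: leq_trans di (leq_trans _ (leq_addl _ _)).
by rewrite (big_rem _ ys) /= leq_maxl.
Qed.

(** [e] collects what exceeds f(d_i). For g >= 0 it is the cost 2 log 2 of the factors 2 in the
    bounds for p_i and q_i. For g < 0 the earlier radicals are added, a number of terms linear in i,
    each of order at most log d_i / d_i^(-g); the limit hypothesis makes their sum vanish. *)
Let upper : exists (y : nat -> C) (e : nat -> R),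
  [/\ forall i, [/\ L (y i), ~ roots_of_unity L (y i) & (d i <= algdeg (y i))%N],
      forall i, wheight g (y i) <= f (x_ i) + e i
    & forall t : R, 0 < t -> exists i0, forall i, (i0 <= i)%N -> e i < t].
Proof.
case: (leP 0 g) => g0.
  exists (@al R p q d), (fun i => 2 * ln 2 / x_ i `^ (1 - g)).
  have hal i : [/\ ~ roots_of_unity L (al R p q d i), algdeg (al R p q d i) = d i
      & weil_height (al R p q d i) = ln (q i)%:R / x_ i].
    (* A single radical is a product of length 1 for the sequences shifted by i, so its height is an
       instance of the formula for these products. *)
    have shift (u : nat -> nat) : (forall i j, (i < j)%N -> (u i < u j)%N) ->
        forall k j, (k < j)%N -> (u (k + i) < u (j + i))%N.
      by move=> hu k j kj; apply: hu; rewrite ltn_add2r.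
    have b1 : be R (fun j => p (j + i)) (fun j => q (j + i)) (fun j => d (j + i)) 1 = al R p q d i.
      by rewrite /be /beR big_ord1.
    have pr (u : nat -> nat) : (forall j, prime (u j)) -> forall j, prime (u (j + i)%N) by move=> h j.
    have [E1 E2] := @be_height R _ _ _ (pr _ p_prime) (pr _ q_prime) (pr _ d_prime)
      (shift _ p_incr) (shift _ d_incr) (fun j => qp (j + i)) (fun j => pq (j + i)) 1%N.
    rewrite b1 in E1 E2; split.
    - rewrite -b1; apply: be_not_unity.
      + exact: pr p_prime.
      + exact: pr q_prime.
      + exact: pr d_prime.
      + by move=> j; apply: pq.
    - by rewrite E1 /Dn big_ord1.
    - by rewrite E2 big_ord1.
  split.
  - move=> i; have [h1 h2 _] := hal i; split=> //; last by rewrite h2.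
    exact: rootfield_al.
  - move=> i; have [_ h2 h3] := hal i; rewrite /wheight h2 h3.
    have [E _ [_ pE E0 _]] := ln_p i; have qE := ln_q i; rewrite (E0 g0) in pE.
    have -> : f (x_ i) + 2 * ln 2 / x_ i `^ (1 - g) =
       x_ i `^ g * ((2 * ln 2 + f (x_ i) * x_ i `^ (1 - g)) / x_ i).
      rewrite powRB ?(gt_eqF (x_gt0 i)) ?implybT// powRr1 ?(ltW (x_gt0 i))//.
      have xg0 : x_ i `^ g != 0 by rewrite gt_eqF// powR_gt0.
      by field; rewrite xg0 gt_eqF.
    rewrite ler_wpM2l ?powR_ge0// ler_wpM2r ?invr_ge0 ?(ltW (x_gt0 i))//; lra.
  - move=> t t0; have g1 : 0 < 1 - g by rewrite subr_gt0.
    have [X hX] := eventually_powR (4 * ln 2 / t) g1; have [i0 hi0] := d_ev X.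
    exists i0 => i /hi0/hX [l1 _ h]; rewrite ltr_pdivrMr ?powR_gt0//.
    have h' : 4 * ln 2 / t <= x_ i `^ (1 - g).
      apply: le_trans h; rewrite ler_peMr ?divr_ge0 ?mulr_ge0 ?(ltW l2) ?(ltW t0)//.
      by rewrite exprn_ege1.
    rewrite ler_pdivrMr// [X in _ <= X]mulrC in h'; apply: lt_le_trans h'.
    by rewrite ltr_pM2r// ltr_nat.
have [k k0 fk] := f_up.
(* In units of log d_i / d_i^(-g), each of the i + 1 radicals costs 2 for the factors 2 and k for f;
   only f(d_i), from the last one, is kept exactly. *)
exists (fun i => be R p q d i.+1),
  (fun i => (2 + k) * (i.+1%:R * ln (x_ i) / x_ i `^ (- g))).
have hbe i := @be_height R p q d p_prime q_prime d_prime p_incr d_incr qp pq i.+1.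
split.
- move=> i; have [h1 _] := hbe i; split.
  + exact: rootfield_be.
  + exact: be_not_unity.
  + by rewrite h1 DnS leq_pmulr// Dn_gt0.
- move=> i; have [h1 h2] := hbe i; rewrite /wheight h1 h2.
  set G := - g; have G0 : 0 < G by rewrite /G; lra.
  pose W j : R := (D j.+1)%:R `^ G.
  have W0 j : 0 < W j by apply: powR_gt0.
  have xG0 : 0 < x_ i `^ G by apply: powR_gt0.
  have -> : (D i.+1)%:R `^ g = (W i)^-1 by rewrite /W -powRN opprK.
  have term j : ln (q j)%:R / x_ j <= 2 * ln 2 / x_ j + f (x_ j) * W j.
    have [E _ [_ pE _ E1]] := ln_p j; have qE := ln_q j; rewrite (E1 g0) in pE.
    have -> : 2 * ln 2 / x_ j + f (x_ j) * W j = (2 * ln 2 + f (x_ j) * W j * x_ j) / x_ j.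
      by field; rewrite gt_eqF.
    rewrite ler_wpM2r ?invr_ge0 ?(ltW (x_gt0 j))//; rewrite /W /G; lra.
  have Wi : x_ i `^ G <= W i.
    rewrite /W ge0_ler_powR ?nnegrE ?(ltW G0) ?(ltW (x_gt0 i)) ?(ltW (D_gt0 _))//.
    by rewrite ler_nat DnS leq_pmulr// Dn_gt0.
  have small j : (j <= i)%N -> 2 * ln 2 / x_ j / W i <= 2 * (ln (x_ i) / x_ i `^ G).
    move=> ji; rewrite -!mulrA ler_pM2l ?ltr0n// mulrA; apply: ler_pM.
    - by rewrite divr_ge0 ?(ltW l2) ?(ltW (x_gt0 j)).
    - by rewrite invr_ge0 ltW.
    - by rewrite ler_pdivrMr//; apply: le_trans (l2x i) _; rewrite ler_peMr ?(ltW (lx_gt0 i)).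
    - by rewrite lef_pV2 ?posrE.
  (* For j < i, D_(j+1) divides D_i, so D_(j+1) d_i <= D_(i+1): the weight of an earlier radical
     loses at least d_i^(-g). *)
  have fsmall j : (j < i)%N -> f (x_ j) * W j / W i <= k * (ln (x_ i) / x_ i `^ G).
    move=> ji; rewrite mulrA -mulrA; apply: ler_pM.
    - exact: ltW.
    - by rewrite divr_ge0 ?ltW.
    - exact: fk (ltnW ji).
    - rewrite ler_pdivrMr// mulrC ler_pdivlMr// /W -powRM ?(ltW (D_gt0 _)) ?(ltW (x_gt0 i))//.
      rewrite ge0_ler_powR ?nnegrE ?(ltW G0) ?mulr_ge0 ?(ltW (D_gt0 _)) ?(ltW (x_gt0 i))//.
      rewrite -natrM ler_nat [D i.+1]DnS mulnC leq_mul2l dvdn_leq ?orbT ?Dn_gt0//.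
      exact: D_dvd.
  rewrite big_ord_recr /= mulrDr mulr_sumr.
  set u := ln (x_ i) / x_ i `^ G in small fsmall *.
  have u0 : 0 <= u by rewrite divr_ge0 ?ltW.
  have -> : f (x_ i) + (2 + k) * (i.+1%:R * ln (x_ i) / x_ i `^ G) =
     i%:R * (2 * u + k * u) + (2 * u + f (x_ i)) + k * u.
    by rewrite -[_ * _ / _]mulrA -/u -natr1; ring.
  rewrite -[leLHS]addr0; apply: lerD; last by rewrite mulr_ge0// ltW.
  apply: lerD.
    rewrite -[X in X%:R * _](card_ord i) mulr_natl -sumr_const; apply: ler_sum => j _.
    rewrite mulrC; apply: le_trans (ler_wpM2r _ (term j)) _; first by rewrite invr_ge0 ltW.
    by rewrite mulrDl; apply: lerD; [apply: small; apply: ltnW|apply: fsmall].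
  rewrite mulrC; apply: le_trans (ler_wpM2r _ (term i)) _; first by rewrite invr_ge0 ltW.
  by rewrite mulrDl mulfK ?gt_eqF// lerD2r small.
- move=> t t0; have t1 : 0 < t / (2 + k) by rewrite divr_gt0//; lra.
  have /cvgr0Pnorm_lt/(_ _ t1)[N _ hN] := hyp_lim g0; exists N => i Ni.
  have := hN i Ni; move=> /(le_lt_trans (ler_norm _)).
  by rewrite ltr_pdivlMr 1?mulrC//; lra.
Qed.

Let K_gt0 i a : K i a -> (0 < algdeg a)%N.
Proof.
move=> Ka; have [P mP] : exists P, is_minpolyZ a P by eapply (@Kn_minpoly R p q d); eassumption.
exact: algdeg_gt0 mP.
Qed.

(** A bound common to the three cases. It is weak, but enough for every g' > g, where the degree
    contributes a positive power of d_i. The halved constant absorbs the error term of [lower]. *)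
Let low_ev : exists2 k : R, 0 < k & exists i0, forall i a, (i0 <= i)%N -> K i.+1 a -> ~ K i a ->
  (d i <= algdeg a)%N /\ k / ln (x_ i) <= wheight g a.
Proof.
have [k k0 fk] := f_low; have [dl /andP[dl0 _] lo] := lower; have [i0 hi0] := p_gt_d.
have [X hX] := eventually_powR (4 / k) dl0; have [i1 hi1] := d_ev X.
exists (k / 2); rewrite ?divr_gt0//; exists (maxn i0 i1) => i a.
rewrite geq_max => /andP[/hi0 dp /hi1/hX [l1 _ h]] Ka nKa.
have [n1 hh] := lo _ _ dp Ka nKa; split=> //; apply: le_trans hh.
have xd0 : 0 < x_ i `^ dl by apply: powR_gt0.
have e1 : 2 * ln (x_ i) / x_ i `^ dl <= k / 2 / ln (x_ i).
  rewrite ler_pdivlMr// mulrAC ler_pdivrMr//.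
  by move: h; rewrite mulrAC ler_pdivrMr//; lra.
have e2 : k / ln (x_ i) <= f (x_ i) by rewrite ler_pdivrMr.
have -> : k / 2 / ln (x_ i) = k / ln (x_ i) - k / 2 / ln (x_ i) by field; rewrite gt_eqF.
by lra.
Qed.

Lemma has_N_gt g' : g < g' -> has_N g' L.
Proof.
move=> gg B B0; apply/Ncount_lty/fin_from_lower.
have [k k0 [i0 h0]] := low_ev; have dg : 0 < g' - g by lra.
have [X hX] := eventually_powR (B / k) dg; have [i1 hi1] := d_ev X.
exists (maxn i0 i1) => i a; rewrite geq_max => /andP[ii0 /hi1/hX [l1 _ h]] Ka nKa.
have [n1 hh] := h0 _ _ ii0 Ka nKa; have n0 := K_gt0 Ka.
rewrite (wheight_shift g g' n0).
have kl : 0 < k / ln (x_ i) by rewrite divr_gt0.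
apply: (@le_trans _ _ (x_ i `^ (g' - g) * (k / ln (x_ i)))).
  rewrite mulrA ler_pdivlMr//; rewrite mulrAC ler_pdivrMr// in h.
  apply: le_trans h; rewrite ler_wpM2l ?(ltW B0)// expr2 ler_peMr ?(ltW (lx_gt0 i))//.
by apply: ler_pM; rewrite ?powR_ge0 ?(ltW kl)// ge0_ler_powR ?nnegrE ?ler_nat ?(ltW dg) ?(ltW (x_gt0 i)).
Qed.

(** At g the elements of [upper] have weighted height at most a multiple of log d_i; passing to g'
    divides it by deg^(g-g') >= d_i^(g-g'). *)
Lemma not_has_B_lt g' : g' < g -> ~ has_B g' L.
Proof.
move=> gg [B B0]; rewrite Ncount_infinite//.
have [y [e [hy hu he]]] := upper; apply: (inf_from_upper hy).
have [k k0 fk] := f_up; have dg : 0 < g - g' by lra.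
have [X hX] := eventually_powR (2 * (k + 1) / B) dg; have [i1 hi1] := d_ev X.
have [i0 hi0] := he 1 ltr01.
exists (maxn i0 i1) => i; rewrite geq_max => /andP[/hi0 e1 /hi1/hX [l1 _ h]].
have [_ _ n1] := hy i.
have n0 : (0 < algdeg (y i))%N by apply: leq_trans n1; apply: prime_gt0.
rewrite (wheight_shift g g' n0) -opprB powRN.
have N0 : 0 < (algdeg (y i))%:R `^ (g - g') :> R by rewrite powR_gt0// ltr0n.
rewrite mulrC ltr_pdivrMr//.
have Nx : x_ i `^ (g - g') <= (algdeg (y i))%:R `^ (g - g').
  by rewrite ge0_ler_powR ?nnegrE ?ler_nat ?(ltW dg) ?(ltW (x_gt0 i)).
have hb : 2 * (k + 1) * ln (x_ i) ^+ 2 <= B * x_ i `^ (g - g').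
  by move: h; rewrite mulrAC ler_pdivrMr//; lra.
apply: le_lt_trans (hu i) _.
apply: lt_le_trans (ler_wpM2l (ltW B0) Nx); apply: lt_le_trans hb.
have := fk i i (leqnn i); have : ln (x_ i) <= ln (x_ i) ^+ 2.
  by rewrite expr2 ler_peMr ?(ltW (lx_gt0 i)).
by nra.
Qed.

(** * The exponent g itself, for each choice of f *)

Lemma has_N_log : f = (fun x => ln x) -> has_N g L.
Proof.
move=> fE B B0; apply/Ncount_lty/fin_from_lower.
have [dl /andP[dl0 _] lo] := lower; have [i0 hi0] := p_gt_d.
have [X hX] := eventually_powR (B + 2) dl0; have [i1 hi1] := d_ev X.
exists (maxn i0 i1) => i a; rewrite geq_max => /andP[/hi0 dp /hi1/hX [l1 lB h]] Ka nKa.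
have [_ hh] := lo _ _ dp Ka nKa; apply: le_trans hh; rewrite fE.
have : 2 * ln (x_ i) / x_ i `^ dl <= 1.
  rewrite ler_pdivrMr ?powR_gt0// mul1r; apply: le_trans h; rewrite expr2 mulrA.
  by rewrite ler_pM// ?mulr_ge0 ?(ltW (lx_gt0 i))//; nra.
by lra.
Qed.

Lemma finite_const B : f = (fun=> c) -> B < c -> finite_set [set a | L a /\ wheight g a < B].
Proof.
move=> fE Bc; apply/fin_from_lower.
have [dl /andP[dl0 _] lo] := lower; have [i0 hi0] := p_gt_d.
have [X hX] := eventually_powR (2 / (c - B)) dl0; have [i1 hi1] := d_ev X.
exists (maxn i0 i1) => i a; rewrite geq_max => /andP[/hi0 dp /hi1/hX [l1 lB h]] Ka nKa.
have [_ hh] := lo _ _ dp Ka nKa; apply: le_trans hh; rewrite fE.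
have : 2 * ln (x_ i) / x_ i `^ dl <= c - B.
  have cB : 0 < c - B by lra.
  rewrite ler_pdivrMr ?powR_gt0//; rewrite mulrAC ler_pdivrMr// in h.
  rewrite [leRHS]mulrC; apply: (le_trans _ h); rewrite ler_wpM2l// expr2.
  by rewrite ler_peMr ?(ltW (lx_gt0 i)).
by lra.
Qed.

Lemma infinite_const B : f = (fun=> c) -> c < B ->
  ~ finite_set [set a | (L `\` roots_of_unity L) a /\ wheight g a < B].
Proof.
move=> fE cB; have [y [e [hy hu he]]] := upper; apply: (inf_from_upper hy).
have Bc : 0 < B - c by lra.
have [i0 hi0] := he _ Bc; exists i0 => i /hi0 ei.
by apply: le_lt_trans (hu i) _; rewrite fE; lra.
Qed.

Lemma infinite_invlog B : f = (fun x => 1 / ln x) -> 0 < B ->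
  ~ finite_set [set a | (L `\` roots_of_unity L) a /\ wheight g a < B].
Proof.
move=> fE B0; have [y [e [hy hu he]]] := upper; apply: (inf_from_upper hy).
have B2 : 0 < B / 2 by rewrite divr_gt0.
have [i0 hi0] := he _ B2; have [X hX] := eventually_powR (2 / B) ltr01; have [i1 hi1] := d_ev X.
exists (maxn i0 i1) => i; rewrite geq_max => /andP[/hi0 ei /hi1/hX [l1 lB h]].
apply: le_lt_trans (hu i) _; rewrite fE.
have : 1 / ln (x_ i) <= B / 2.
  by rewrite ler_pdivrMr//; rewrite ler_pdivrMr// in lB; lra.
by lra.
Qed.

Let finite_setL g' B : (Ncount g' L B < +oo)%E ->
  finite_set [set a | (L `\` roots_of_unity L) a /\ wheight g' a < B].
Proof.
move=> h; have : finite_set [set a | L a /\ wheight g' a < B].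
  by apply: contrapT => /Ncount_infinite E; rewrite E in h.
by apply: sub_finite_set => a /= [[La _] ha].
Qed.

Let has_N_ge g' : has_N g' L -> g <= g'.
Proof. by move=> h; rewrite leNgt; apply/negP => /not_has_B_lt; apply; apply: has_N_has_B. Qed.

Let has_B_ge g' : has_B g' L -> g <= g'.
Proof. by move=> h; rewrite leNgt; apply/negP => /not_has_B_lt. Qed.

Lemma main_result :
  [/\ f = (fun x : R => ln x) ->
        I_N L = I_B L /\ I_B L = `[g, +oo[%classic,
      f = (fun _ : R => c) ->
        [/\ I_N L = `]g, +oo[%classic,
            (`]g, +oo[%classic : set R) `<` `[g, +oo[%classic,
            `[g, +oo[%classic = I_B L
          & Northcott_number g L = c%:E]
    & f = (fun x : R => 1 / ln x) ->
        I_N L = I_B L /\ I_B L = `]g, +oo[%classic].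
Proof.
split=> fE.
- have NE : I_N L = `[g, +oo[%classic.
    apply/seteqP; split=> x; rewrite /I_N /= in_itv /= andbT; first exact: has_N_ge.
    by rewrite le_eqVlt => /orP[/eqP <-|/has_N_gt//]; apply: has_N_log.
  have BE : I_B L = `[g, +oo[%classic.
    apply/seteqP; split=> [x|x gx].
      by rewrite /I_B /= in_itv /= andbT; apply: has_B_ge.
    by have : I_N L x; [rewrite NE|move=> /has_N_has_B].
  by rewrite NE BE.
- have lt_of_N x : has_N x L -> g < x.
    move=> hx; rewrite lt_neqAle has_N_ge// andbT; apply/eqP => gx.
    have c1 : c < c + 1 by rewrite ltrDl.
    apply: (infinite_const fE c1); apply: finite_setL; rewrite gx; apply: hx.
    by rewrite addr_gt0.
  split.
  + apply/seteqP; split=> x; rewrite /I_N /= in_itv /= andbT; first exact: lt_of_N.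
    exact: has_N_gt.
  + split=> [x|/(_ g)]; rewrite /= !in_itv /= !andbT; first exact: ltW.
    by rewrite lexx ltxx => /(_ isT).
  + apply/seteqP; split=> x; rewrite /I_B /= in_itv /= andbT; last exact: has_B_ge.
    rewrite le_eqVlt => /orP[/eqP <-|/has_N_gt/has_N_has_B//].
    have c2 : c / 2 < c by rewrite ltr_pdivrMr// ltr_pMr// ltr1n.
    exists (c / 2); first by rewrite divr_gt0.
    apply: Ncount_lty; apply: sub_finite_set (finite_const fE c2) => a /=.
    by case=> -[].
  + apply/le_anti/andP; split.
      apply/lee_addgt0Pr => e e0; apply: ereal_inf_lbound; exists (c + e) => //.
      split; first by rewrite addr_gt0.
      have ce : c < c + e by rewrite ltrDl.
      apply: Ncount_infinite => fin; apply: (infinite_const fE ce).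
      by apply: sub_finite_set fin => a /= [[La _] ha].
    apply: le_ereal_inf_tmp => _ [B [B0 hB] <-]; rewrite lee_fin leNgt; apply/negP => Bc.
    by have := Ncount_lty (finite_const fE Bc); rewrite hB.
- have lt_of_B x : has_B x L -> g < x.
    move=> hx; rewrite lt_neqAle has_B_ge// andbT; apply/eqP => gx.
    case: hx => B B0; rewrite -gx Ncount_infinite//.
    exact: infinite_invlog.
  have BE : I_B L = `]g, +oo[%classic.
    apply/seteqP; split=> x; rewrite /I_B /= in_itv /= andbT; first exact: lt_of_B.
    by move=> /has_N_gt/has_N_has_B.
  split=> //; rewrite BE; apply/seteqP; split=> x; rewrite /I_N /= in_itv /= andbT.
    by move=> /has_N_has_B/lt_of_B.
  exact: has_N_gt.
Qed.

End Main.

Theorem theorem4p1 (R : realType) (g c : R) (p q d : nat -> nat) (f : R -> R)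
  (g_lt1 : g < 1) (c_gt0 : 0 < c)
  (p_prime : forall i, prime (p i))
  (q_prime : forall i, prime (q i))
  (d_prime : forall i, prime (d i))
  (p_incr : forall i j, (i < j)%N -> (p i < p j)%N)
  (q_incr : forall i j, (i < j)%N -> (q i < q j)%N)
  (d_incr : forall i j, (i < j)%N -> (d i < d j)%N)
  (qp : forall i, (q i < p i.+1)%N)
  (pq : forall i, (p i < q i < 2 * p i)%N)
  (f_cases : [\/ f = (fun x : R => ln x), f = (fun _ : R => c)
               | f = (fun x : R => 1 / ln x)])
  (hyp_nonneg : 0 <= g -> forall i,
     let E := expR (f (d i)%:R * (d i)%:R `^ (1 - g)) in
     E <= (p i)%:R <= 2 * E)
  (hyp_neg : g < 0 -> forall i,
     let E := expR (f (d i)%:R * (\prod_(j < i) (d j)%:R) `^ (- g) *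
                    (d i)%:R `^ (1 - g)) in
     E <= (p i)%:R <= 2 * E)
  (hyp_lim : g < 0 ->
     (i.+1%:R * ln (d i)%:R / (d i)%:R `^ (- g) : R) @[i --> \oo] --> (0 : R)) :
  let L : set R[i] := rootfield p q d in
  [/\ f = (fun x : R => ln x) ->
        I_N L = I_B L /\ I_B L = `[g, +oo[%classic,
      f = (fun _ : R => c) ->
        [/\ I_N L = `]g, +oo[%classic,
            (`]g, +oo[%classic : set R) `<` `[g, +oo[%classic,
            `[g, +oo[%classic = I_B L
          & Northcott_number g L = c%:E]
    & f = (fun x : R => 1 / ln x) ->
        I_N L = I_B L /\ I_B L = `]g, +oo[%classic].
Proof. by move=> L; apply: main_result. Qed.
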